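(* Let $f:\mathbb{T}\to\mathbb{R}$ be a piecewise smooth function (as defined in the context). Then for $\mu$-almost every $\alpha\in\mathbb{T}$ (the exceptional null set depending only on $f$, not on $x_0$) and for every $x_0\in\mathbb{T}$ the following holds: there do not exist sequences $(A_M)_{M\in\mathbb{N}}$ of real numbers and $(B_M)_{M\in\mathbb{N}}$ of positive real numbers with $\lim_{M\to\infty}B_M=\infty$, together with a non-constant real random variable $Y$ (i.e. one whose distribution is not a point mass), such that $$\lim_{M\to\infty}\frac1M\,\#\left\{1\le N\le M:\ \frac{S_N(f,\alpha,x_0)-A_M}{B_M}\le a\right\}=\mathbb{P}[Y\le a]$$ for every $a\in\mathbb{R}$ at which $a\mapsto\mathbb{P}[Y\le a]$ is continuous. (The sequences $A_M,B_M$ and the variable $Y$ are allowed to depend on $f,\alpha,x_0$.) Equivalently, if $N$ is uniformly distributed on $\{1,\ldots,M\}$, the random variables $\frac{S_N(f,\alpha,x_0)-A_M}{B_M}$ do not converge in distribution, as $M\to\infty$, to a non-constant random variable, for any choice of $(A_M)$ and of $(B_M)$ with $B_M\to\infty$.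
   Context: $\mathbb{T}=\mathbb{R}/\mathbb{Z}$, with normalized Haar measure $\mu$; $\iota:\mathbb{T}\to[0,1)$ is the map $x+\mathbb{Z}\mapsto\{x\}=x-\lfloor x\rfloor$. For $\alpha,x_0\in\mathbb{T}$, $f:\mathbb{T}\to\mathbb{R}$ and $N\in\mathbb{N}=\{1,2,\ldots\}$, the Birkhoff sum of the circle rotation $T_\alpha(x)=x+\alpha$ is $$S_N(f,\alpha,x_0)=\sum_{k=0}^{N-1}f(x_0+k\alpha).$$ A function $f:\mathbb{T}\to\mathbb{R}$ with $\int_{\mathbb{T}}f\,d\mu=0$ is called piecewise smooth if there exist $\nu\ge1$ and $\gamma_1,\ldots,\gamma_\nu\in\mathbb{T}$ with $0\le\iota(\gamma_1)<\cdots<\iota(\gamma_\nu)<1$ such that: (i) $f$ is differentiable on $\mathbb{T}\setminus\{\gamma_1,\ldots,\gamma_\nu\}$; (ii) $f'$ extends to a function of bounded variation on $\mathbb{T}$; (iii) there is an $i\in\{1,\ldots,\nu\}$ with $\lim_{\delta\to0^+}\left[f(\gamma_i-\delta)-f(\gamma_i+\delta)\right]\ne0$. *)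

(* Defs.v *)
From HB Require Import structures.
From mathcomp Require Import all_boot all_order all_algebra.
From mathcomp Require Import all_classical all_reals all_analysis.

Set Implicit Arguments.
Unset Strict Implicit.
Unset Printing Implicit Defensive.

Import Order.TTheory GRing.Theory Num.Theory.
Import numFieldNormedType.Exports.

Local Open Scope classical_set_scope.
Local Open Scope ring_scope.

(* Over an arbitrary [R : realType] of MathComp-Analysis.

   The circle T = R/Z is handled through the covering R -> T: a function on T
   is a 1-periodic function on R, a point of T is given by any of its real
   representatives, and the normalized Haar measure of T is the Lebesgue
   measure on the fundamental domain [0, 1[. *)

(* The representative in [0, 1[ of the class of x modulo Z. *)
Definition iota01 (R : realType) (x : R) : R := x - (Num.floor x)%:~R.

Definition zero_mean (R : realType) (f : R -> R) : Prop :=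
  lebesgue_measure.-integrable `[0%R, 1%R[ (EFin \o f) /\
  (\int[lebesgue_measure]_(x in `[0%R, 1%R[) (f x)%:E = 0)%E.

(* For a 1-periodic g, bounded variation on the circle amounts to bounded
   variation on [0, 1].  The points gamma i are the representatives in [0, 1[,
   so [iota01 x != gamma i] says that x and gamma i are distinct on T. *)
Definition piecewise_smooth (R : realType) (f : R -> R) : Prop :=
  [/\ periodic f 1,
      zero_mean f &
      exists (nu : nat) (gamma : 'I_nu -> R),
        [/\ (0 < nu)%N,
            (forall i, 0 <= gamma i < 1) /\
            (forall i j : 'I_nu, (i < j)%N -> gamma i < gamma j),
            forall x, (forall i, iota01 x != gamma i) -> derivable f x 1,
            exists g : R -> R,
              [/\ periodic g 1,
                  bounded_variation 0 1 g &
                  forall x, (forall i, iota01 x != gamma i) ->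
                    g x = derive1 f x] &
            exists (i : 'I_nu) (l : R), l != 0 /\
              f (gamma i - delta) - f (gamma i + delta)
                @[delta --> 0^'+] --> l]].

Definition birkhoff_sum (R : realType) (f : R -> R) (alpha x0 : R) (N : nat)
    : R :=
  \sum_(0 <= k < N) f (x0 + k%:R * alpha).

(* Distribution function, at a, of (S_N - A) / B for N uniformly distributed on
   {1, ..., M}. *)
Definition empirical_cdf (R : realType) (S : nat -> R) (A B : R) (M : nat)
    (a : R) : R :=
  (count (fun N => (S N - A) / B <= a) (index_iota 1 M.+1))%:R / M%:R.

Definition nonconstant_rv (R : realType) (d : measure_display)
    (T : measurableType d) (P : probability T R) (Y : {RV P >-> R}) : Prop :=
  ~ exists c : R, forall D : set R, measurable D ->
      distribution P Y D = \d_c D.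

(* The index M ranges over the positive integers; A 0 and B 0 are irrelevant. *)
Definition has_temporal_limit_law (R : realType) (S : nat -> R) : Prop :=
  exists (A B : nat -> R),
    [/\ forall M, (0 < M)%N -> 0 < B M,
        B M @[M --> \oo] --> +oo &
        exists (d : measure_display) (T : measurableType d)
               (P : probability T R) (Y : {RV P >-> R}),
          nonconstant_rv Y /\
          forall a : R, {for a, continuous (cdf Y)} ->
            (empirical_cdf S (A M) (B M) M a)%:E @[M --> \oo] --> cdf Y a].

(* Main.v *)
Require Import Defs.
From mathcomp Require Import all_boot all_order all_algebra.
From mathcomp Require Import all_classical all_reals all_analysis.
From mathcomp Require Import measurable_realfun.
From mathcomp Require Import ring lra zify.
Set Implicit Arguments.
Unset Strict Implicit.
Unset Printing Implicit Defensive.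
Import Order.TTheory GRing.Theory Num.Theory.
Import numFieldNormedType.Exports.
Local Open Scope classical_set_scope.
Local Open Scope ring_scope.

(** Why Birkhoff sums over a rotation have no temporal limit law.

    Suppose that a reduced fraction p / q approximates al so well that
    a := 1 / (q |q al - p|) is much larger than every sum S_N with N < q. At
    the times j q + r with r < q the sums then follow the walk w_j := S_(j q) up
    to an error small against a. Its increments, the values of S_q along
    x0 + j (q al - p), are bounded by the Denjoy-Koksma inequality
    [denjoy_koksma]. In about a steps the point x0 + j (q al - p) travels more
    than 1 / q, so it crosses a preimage gamma - k al, k < q, of a point gamma at
    which f jumps by l. All other singularities of S_q stay away from there, so
    the increments before and after the crossing differ by nearly l
    ([window_difference]) over a number of steps of order a, and |w| reaches a
    height of order a. On the other hand w is bounded again after about 2 a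
    steps, at twice the next good denominator. Such an [excursion] exists for
    arbitrarily large a ([well_approximated_excursions]).

    Excursions exclude a limit law ([excursions_no_law]). Say that w climbs, let
    M1 be the time of its maximum and M2 a slightly later time, M1 <= lam M2 with
    lam < 1. Up to an error small against a, the ranges of S over [1, M1] and over
    [1, M2] agree, and between M1 and M2 the sums stay in the upper half of that
    range. A fixed proportion of
    the times is spent near either end of the range, so that the normalized ranges
    for M1 and for M2 both converge to the convex hull of the support of the limit
    Y. For z < z' in the lower half of this interval, the times N <= M2 counted by
    P(Y <= z) are all at most M1 and are counted by P(Y <= z'); hence
    P(Y <= z) <= lam P(Y <= z'). Letting z' tend to z gives P(Y <= z) = 0 with z
    inside the support ([types_contradiction]).

    The fractions p / q exist, for almost every al, with q of any size
    ([ae_well_approximated]). Expanding N in good denominators bounds the sums of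
    length less than 2^(k+1) by O(k log k) outside a set of al of small measure
    ([exceptional_fractions]). Intervals of length of order 1 / (4^k k log k)
    around the reduced fractions with denominator about 2^k have measures with a
    divergent sum and are nearly independent at different scales, so they fill a
    fixed proportion of every interval ([local_density]), and Lebesgue's density
    theorem concludes. The denominators are taken 1 modulo a suitable Q in order
    to keep q (gamma_j - gamma) away from the integers, which is what isolates
    the jump from the other singularities ([resonant_count]). *)

(** * Piecewise smooth functions *)

Section PiecewiseLipschitz.
Context {R : realType}.
Implicit Types (f : R -> R) (x y z : R).

Definition avoids nu (gamma : 'I_nu -> R) y z : Prop :=
  forall i (m : int), ~ (y <= gamma i + m%:~R <= z).

(** What the sequel uses of a piecewise smooth function. Functions live on the line,
   hence the integer translates in [avoids]. *)
Record piecewise_lipschitz f nu (gamma : 'I_nu -> R) (C F0 : R) : Prop := {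
  pl_periodic : forall x (m : int), f (x + m%:~R) = f x;
  pl_bounded : forall x, `|f x| <= F0;
  pl_lipschitz : forall y z, y <= z -> avoids gamma y z ->
    `|f z - f y| <= C * (z - y) }.

Lemma periodic_int f : periodic f 1 -> forall x (m : int), f (x + m%:~R) = f x.
Proof.
move=> pf x; have pn n y : f (y + n%:R) = f y.
  by elim: n y => [|n IH] y; rewrite ?addr0// -natr1 addrA pf IH.
case=> n; first exact: pn.
by rewrite NegzE mulrNz -(pn n.+1 (x - _)) subrK.
Qed.

Lemma iota01_int x y : 0 <= y < 1 -> iota01 x = y <-> exists m : int, x = y + m%:~R.
Proof.
move=> y01; split=> [<-|[m ->]]; first by exists (Num.floor x); rewrite subrK.
rewrite /iota01 (_ : Num.floor (y + m%:~R) = m) ?addrK//.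
by apply/floor_def; rewrite rmorphD /=; lra.
Qed.

Lemma bounded_variation_bounded f : bounded_variation 0 1 f ->
  exists C, forall x, 0 <= x < 1 -> `|f x| <= C.
Proof.
move=> bv; exists (`|f 0| + fine (total_variation 0 1 f)) => x /andP[x0 x1].
have x1' := ltW x1.
have bvx : bounded_variation 0 x f := bounded_variationl x0 x1' bv.
have h := total_variation_ge f x0.
have h2 : (total_variation 0 x f <= total_variation 0 1 f)%E.
  by rewrite (total_variationD f x0 x1') leeDl// total_variation_ge0.
have fn : total_variation 0 1 f \is a fin_num by apply/bounded_variationP.
have := le_trans h h2; rewrite -{1}(fineK fn) lee_fin => h3.
have := ler_normD (f 0) (f x - f 0); rewrite addrCA subrr addr0; lra.
Qed.

Lemma avoids_sub nu (gamma : 'I_nu -> R) y z y' z' :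
  y <= y' -> z' <= z -> avoids gamma y z -> avoids gamma y' z'.
Proof. by move=> yy zz h i m hm; apply: (h i m); lra. Qed.

Lemma derivable_lipschitz f (g : R -> R) C y z : y <= z ->
  (forall x, y <= x <= z -> derivable f x 1 /\ g x = derive1 f x) ->
  (forall x, `|g x| <= C) -> `|f z - f y| <= C * (z - y).
Proof.
move=> yz df gC.
have dfi x : y <= x <= z -> is_derive x 1 f (g x).
  move=> /df[d ->]; rewrite derive1E; exact: derivableP.
have [||c cyz ->] := @MVT_segment R f g y z yz.
- by move=> x; rewrite in_itv/= => /andP[/ltW a /ltW b]; apply: dfi; rewrite a b.
- apply: derivable_within_continuous => x; rewrite in_itv/= => xyz.
  by have [] := df _ xyz.
by rewrite normrM (ger0_norm (x:=z - y)) ?ler_wpM2r ?subr_ge0.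
Qed.

(** Cutting the interval at the points of [s] one after the other leaves pieces on
   which the Lipschitz bound holds throughout. *)
Lemma piecewise_lipschitz_bounded f (s : seq R) C : 0 <= C ->
  forall a b : R, a <= b ->
  (forall y z, a < y -> y <= z -> z < b -> (forall t, t \in s -> ~ (y <= t <= z)) ->
     `|f z - f y| <= C * (z - y)) ->
  exists F0, forall x, a < x < b -> `|f x| <= F0.
Proof.
move=> C0; elim: s => [|t s IH] a b ab lip.
  exists (`|f ((a + b) / 2)| + C * (b - a)) => x xab.
  have ab' : a < b by lra.
  have : `|f x - f ((a + b) / 2)| <= C * (b - a).
    have [h|h] := lerP x ((a + b) / 2).
      rewrite distrC (le_trans (lip _ _ _ h _ _))//; try lra.
      by rewrite ler_wpM2l//; lra.
    rewrite (le_trans (lip _ _ _ (ltW h) _ _))//; try lra.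
    by rewrite ler_wpM2l//; lra.
  have := ler_normD (f x - f ((a + b) / 2)) (f ((a + b) / 2)).
  by rewrite subrK; lra.
have [/andP[at_ tb]|nt] := boolP (a < t < b); last first.
  apply: (IH a b ab) => y z ay yz zb h; apply: lip => // u.
  rewrite inE => /orP[/eqP ->|]; last exact: h.
  move=> utz; move/negP: nt; apply; lra.
have [|F1 h1] := IH a t (ltW at_).
  move=> y z ay yz zt h; apply: lip => //; first lra.
  by move=> u; rewrite inE => /orP[/eqP -> ?|]; [lra|exact: h].
have [|F2 h2] := IH t b (ltW tb).
  move=> y z ay yz zt h; apply: lip => //; first lra.
  by move=> u; rewrite inE => /orP[/eqP -> ?|]; [lra|exact: h].
exists (`|F1| + `|F2| + `|f t|) => x /andP[ax xb].
have := normr_ge0 F1; have := normr_ge0 F2; have := normr_ge0 (f t).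
case: (ltgtP x t) => [xt|tx|->]; last by lra.
  by have := h1 x; rewrite ax xt => /(_ isT); have := ler_norm F1; lra.
by have := h2 x; rewrite xb tx => /(_ isT); have := ler_norm F2; lra.
Qed.

(** A function of bounded variation is bounded, so the derivative is bounded off the
   singularities and the mean value theorem applies between them. *)
Lemma piecewise_smooth_lipschitz f : piecewise_smooth f ->
  exists (nu : nat) (gamma : 'I_nu -> R) (C F0 : R) (i0 : 'I_nu) (l : R),
  [/\ piecewise_lipschitz f gamma C F0, 0 <= C /\ 0 <= F0,
      forall i j, i != j -> forall m : int, gamma i - gamma j <> m%:~R,
      l != 0 & f (gamma i0 - delta) - f (gamma i0 + delta)
                @[delta --> 0^'+] --> l].
Proof.
case=> pf [_ _] [nu [gamma [nu0 [g01 gS] df [g [pg bvg gE]] [i0 [l [l0 hl]]]]]].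
have [C hC] := bounded_variation_bounded bvg.
have gC x : `|g x| <= C.
  rewrite -(periodic_int pg x (- Num.floor x)); apply: hC.
  by have := floor_itv x; rewrite rmorphD /= rmorphN /=; lra.
have C0 : 0 <= C := le_trans (normr_ge0 _) (gC 0).
have lip y z : y <= z -> avoids gamma y z -> `|f z - f y| <= C * (z - y).
  move=> yz av; apply: derivable_lipschitz gC => // x xyz.
  have h i : iota01 x != gamma i.
    by apply/eqP => /(iota01_int _ (g01 i))[m xE]; apply: (av i m); rewrite -xE.
  by split; [exact: df|exact: gE].
(* translates by -1, 0 and 1 are those that meet (-1, 2), which contains a period *)
have [||F0 hF0] := @piecewise_lipschitz_bounded f
    (flatten [seq [:: gamma i - 1; gamma i; gamma i + 1] | i <- enum 'I_nu]) C C0 (-1) 2.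
- lra.
- move=> y z y1 yz z2 h; apply: lip => // i m hm.
  have gi := g01 i.
  have m1 : (m < 3)%R by rewrite -(ltr_int R); lra.
  have m2 : (-3 < m)%R by rewrite -(ltr_int R); lra.
  have hh k : k \in [:: -1; 0; 1 : int] -> gamma i + k%:~R \in
     flatten [seq [:: gamma i - 1; gamma i; gamma i + 1] | i <- enum 'I_nu].
    move=> kk; apply/flattenP; exists [:: gamma i - 1; gamma i; gamma i + 1].
      by apply: map_f; rewrite mem_enum.
    by move: kk; rewrite !inE => /or3P[] /eqP ->; rewrite ?addr0 ?eqxx ?orbT.
  have mm : m = -2 \/ m = -1 \/ m = 0 \/ m = 1 \/ m = 2 by lia.
  case: mm => [mE|[mE|[mE|[mE|mE]]]]; try by apply: (h _ (hh m _) hm); rewrite mE.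
  + by rewrite mE in hm; lra.
  + by rewrite mE in hm; lra.
exists nu, gamma, C, F0, i0, l; split=> //.
- split=> //; first exact: periodic_int.
  move=> x; rewrite -(periodic_int pf x (- Num.floor x)); apply: hF0.
  by have := floor_itv x; rewrite rmorphD /= rmorphN /=; lra.
- by split=> //; apply: le_trans (hF0 0 _); [exact: normr_ge0|lra].
- move=> i j ij m hm.
  have gi := g01 i; have gj := g01 j.
  have m0 : m = 0.
    have m1 : (m < 1)%R by rewrite -(ltr_int R); lra.
    have m2 : (-1 < m)%R by rewrite -(ltr_int R); lra.
    lia.
  rewrite m0 in hm.
  case: (ltngtP i j) => h.
  + by have := gS _ _ h; rewrite mulr0z in hm; lra.
  + by have := gS _ _ h; rewrite mulr0z in hm; lra.
  + by move/eqP: ij; apply; apply: val_inj.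
Qed.

End PiecewiseLipschitz.

(** * The Denjoy-Koksma inequality *)

(** The orbit of a rotation by [p / q] visits each of the q arcs of a regular partition
   exactly once. *)
Lemma shift_mod_inj (q p m : nat) (q0 : (0 < q)%N) : coprime p q ->
  injective (fun k : 'I_q => Ordinal (ltn_pmod (m + k * p) q0)).
Proof.
move=> cop k1 k2; wlog k12 : k1 k2 / (k1 <= k2)%N.
  by move=> H E; case: (leqP k1 k2) => [|/ltnW] h12; [exact: H|apply/esym/H].
move=> /(congr1 val)/= /eqP; rewrite eqn_modDl eq_sym eqn_mod_dvd ?leq_mul2r ?k12 ?orbT//.
rewrite -mulnBl Gauss_dvdl 1?coprime_sym// => /dvdnP[c hc].
apply: val_inj => /=; have := ltn_ord k2; case: c hc => [|c] hc; nia.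
Qed.

(** The study of almost every rotation uses [f] through this bound and the next one only. *)
Definition denjoy_koksma_bound (R : realType) (f : R -> R) (V : R) : Prop :=
  forall p q al x, (0 < q)%N -> coprime p q ->
    `|al - p%:R / q%:R| <= 1 / q%:R ^+ 2 -> `|birkhoff_sum f al x q| <= V.

Definition perturbation_bound (R : realType) (f : R -> R) (V : R) : Prop :=
  forall p q al al' x N, (0 < q)%N -> coprime p q ->
    `|al - p%:R / q%:R| < 1 / (2 * q%:R ^+ 2) -> `|al' - p%:R / q%:R| < 1 / (2 * q%:R ^+ 2) ->
    (N <= q)%N -> `|birkhoff_sum f al x N - birkhoff_sum f al' x N| <= V.

Section RotationSums.
Context {R : realType} (f : R -> R) (nu : nat) (gamma : 'I_nu -> R) (C F0 : R).
Hypothesis hf : piecewise_lipschitz f gamma C F0.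
Hypothesis C0 : 0 <= C.
Hypothesis F00 : 0 <= F0.
Implicit Types x y z al : R.

(** Plays the part of the total variation of [f] on the circle: over q arcs of length
   [1 / q] the Lipschitz parts oscillate by [C] in total, and each singularity spoils a
   single arc, by at most [2 * F0]. *)
Definition arc_variation : R := C + 2 * F0 * nu%:R.

Definition in_arc (q : nat) x j y : Prop :=
  x + j%:R / q%:R <= y < x + j.+1%:R / q%:R.

Lemma arc_variation_ge0 : 0 <= arc_variation.
Proof. by rewrite addr_ge0// !mulr_ge0. Qed.

Lemma sum_bool_le1 (q : nat) (b : 'I_q -> bool) :
  (forall i j, b i -> b j -> i = j) -> \sum_(j < q) ((b j)%:R : R) <= 1.
Proof.
move=> h; have [j0 b0|nb] := pickP b.
  rewrite (bigD1 j0)//= big1 ?addr0 ?b0// => j jj; case bj: (b j) => //.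
  by rewrite (h _ _ bj b0) eqxx in jj.
by rewrite big1 // => j _; rewrite nb.
Qed.

Lemma arc_oscillation q x : (0 < q)%N -> exists o : nat -> R,
  [/\ forall j, 0 <= o j,
      forall j y z, (j < q)%N -> in_arc q x j y -> in_arc q x j z ->
         `|f y - f z| <= o j &
      \sum_(j < q) o j <= arc_variation].
Proof.
move=> q0; have qR : 0 < q%:R :> R by rewrite ltr0n.
pose hit (i : 'I_nu) (j : nat) := `[< exists m : int, in_arc q x j (gamma i + m%:~R) >].
exists (fun j => C / q%:R + \sum_(i < nu) 2 * F0 * (hit i j)%:R); split.
- move=> j; rewrite addr_ge0 ?divr_ge0 ?ler0n// sumr_ge0// => i _.
  by rewrite !mulr_ge0.
- move=> j y z jq.
  wlog yz : y z / y <= z.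
    move=> H; have [/H//|/ltW zy] := lerP y z.
    by move=> hy hz; rewrite distrC; exact: H.
  move=> /andP[y1 y2] /andP[z1 z2]; rewrite distrC.
  have [[i hi]|nh] := pselect (exists i, hit i j).
    rewrite (le_trans (ler_normB _ _))//.
    apply: (@le_trans _ _ (2 * F0)).
      have := pl_bounded hf y; have := pl_bounded hf z; lra.
    rewrite (bigD1 i)//= hi mulr1 addrCA lerDl addr_ge0 ?divr_ge0 ?ler0n//.
    by rewrite sumr_ge0// => ? _; rewrite !mulr_ge0.
  have av : avoids gamma y z.
    move=> i m hm; apply: nh; exists i; apply/asboolP; exists m; apply/andP; lra.
  apply: (le_trans (pl_lipschitz hf yz av)).
  rewrite -[leLHS]addr0 lerD//; last by rewrite sumr_ge0// => ? _; rewrite !mulr_ge0.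
  rewrite ler_wpM2l//; move: y1 z2; rewrite -natr1 mulrDl; lra.
- rewrite big_split/= sumr_const card_ord -[X in X + _]mulr_natr divfK ?gt_eqF// lerD2l.
  have -> : 2 * F0 * nu%:R = \sum_(i < nu) 2 * F0 by rewrite sumr_const card_ord mulr_natr.
  rewrite exchange_big/= ler_sum// => i _.
  rewrite -mulr_sumr ler_piMr ?mulr_ge0//; apply: sum_bool_le1 => j1 j2.
  wlog j12 : j1 j2 / (j1 <= j2)%N.
    by move=> H; case: (leqP j1 j2) => [|/ltnW]; [exact: H|move=> h b1 b2; rewrite (H j2 j1)].
  move: j12; rewrite leq_eqVlt => /orP[/eqP/val_inj//|j12].
  move=> /asboolP[m1 /andP[a1 a2]] /asboolP[m2 /andP[a3 a4]]; exfalso.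
  have b1 : j1.+1%:R / q%:R <= j2%:R / q%:R :> R by rewrite ler_pM2r ?invr_gt0// ler_nat.
  have b2 : j2.+1%:R / q%:R <= 1 :> R by rewrite ler_pdivrMr// mul1r ler_nat.
  have b3 : 0 <= j1%:R / q%:R :> R by rewrite divr_ge0.
  have m12 : (m1 < m2)%R by rewrite -(ltr_int R); lra.
  have m21 : (m2 < m1 + 1)%R by rewrite -(ltr_int R) rmorphD/=; lra.
  lia.
Qed.

Lemma sum_shift_mod (q p m : nat) (F : nat -> R) : (0 < q)%N -> coprime p q ->
  \sum_(k < q) F ((m + k * p) %% q)%N = \sum_(j < q) F j.
Proof. by move=> q0 cop; rewrite [RHS](reindex_inj (shift_mod_inj (m := m) (q0 := q0) cop)). Qed.

Lemma rotation_arc_sum p q x (y z : nat -> R) : (0 < q)%N -> coprime p q ->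
  (forall k, (k < q)%N ->
    [/\ x + k%:R * (p%:R / q%:R) <= y k, y k < x + k%:R * (p%:R / q%:R) + 1 / q%:R,
        x + k%:R * (p%:R / q%:R) <= z k & z k < x + k%:R * (p%:R / q%:R) + 1 / q%:R]) ->
  \sum_(k < q) `|f (y k) - f (z k)| <= arc_variation.
Proof.
move=> q0 cop hyz; have [osc [_ hosc osum]] := arc_oscillation x q0.
have qR : 0 < q%:R :> R by rewrite ltr0n.
apply: le_trans osum; rewrite -(sum_shift_mod 0 osc q0 cop) ler_sum// => k _.
rewrite add0n; set j := (k * p %% q)%N.
have [h1 h2 h3 h4] := hyz k (ltn_ord k).
have E : k%:R * (p%:R / q%:R) = (k * p %/ q)%:R + j%:R / q%:R :> R.
  by rewrite mulrA -natrM {1}(divn_eq (k * p) q) natrD natrM mulrDl mulfK ?gt_eqF.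
rewrite E in h1 h2 h3 h4.
rewrite -(pl_periodic hf (y k) (- (k * p %/ q)%N%:Z)) -(pl_periodic hf (z k) (- (k * p %/ q)%N%:Z)).
by apply: hosc; rewrite /in_arc ?ltn_pmod// -natr1 mulrDl rmorphN/=; apply/andP; lra.
Qed.

(** Up to time q, both orbits are within [1 / (2 * q)] of the orbit of the rotation by
   [p / q], so at each time they share one of the arcs centred at that orbit. *)
Lemma rotation_perturbation : perturbation_bound f arc_variation.
Proof.
move=> p q al al' x N q0 cop h1 h2 Nq.
have qR : 0 < q%:R :> R by rewrite ltr0n.
have key (k : nat) (a : R) : (k < q)%N -> `|a - p%:R / q%:R| < 1 / (2 * q%:R ^+ 2) ->
   `|k%:R * a - k%:R * (p%:R / q%:R)| < 1 / (2 * q%:R).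
  move=> kq ha; rewrite -mulrBr normrM ger0_norm ?ler0n//.
  apply: (@le_lt_trans _ _ (q%:R * `|a - p%:R / q%:R|)).
    by rewrite ler_wpM2r// ler_nat ltnW.
  rewrite (lt_le_trans (y:=q%:R * (1 / (2 * q%:R ^+ 2))))// ?ltr_pM2l//.
  by rewrite le_eqVlt; apply/orP; left; apply/eqP; field; rewrite gt_eqF.
rewrite /birkhoff_sum -sumrB (le_trans (ler_norm_sum _ _ _))//.
pose y k := x + k%:R * al; pose z k := x + k%:R * al'.
apply: (@le_trans _ _ (\sum_(0 <= k < q) `|f (y k) - f (z k)|)).
  by rewrite [leRHS](big_cat_nat (n:=N))//= lerDl sumr_ge0.
rewrite big_mkord.
apply: (@rotation_arc_sum p q (x - 1 / (2 * q%:R))) => // k kq.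
have := key _ _ kq h1; have := key _ _ kq h2.
have -> : 1 / q%:R = 1 / (2 * q%:R) + 1 / (2 * q%:R) :> R by field; rewrite gt_eqF.
by rewrite !ltr_norml /y /z => /andP[? ?] /andP[? ?]; split; lra.
Qed.

Hypothesis hz : zero_mean f.

(** Each term differs from the mean of [f] over its arc by at most the oscillation there,
   and the means add up to a multiple of the integral, which vanishes. *)
Lemma arc_average q s : (0 < q)%N -> 0 <= s < 1 / q%:R ->
  `|\sum_(j < q) f (s + j%:R / q%:R)| <= arc_variation.
Proof.
move=> q0 hs; have [osc [_ hosc osum]] := arc_oscillation 0 q0.
have qR : 0 < q%:R :> R by rewrite ltr0n.
have [fi f0] := hz.
have sub (a b : R) : 0 <= a -> b <= 1 -> `[a, b[ `<=` `[0, 1[.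
  move=> a0 b1 t /=; rewrite !in_itv/=; lra.
have inte (a b : R) : 0 <= a -> b <= 1 -> lebesgue_measure.-integrable `[a, b[ (EFin \o f).
  move=> a0 b1; by apply: integrableS fi => //; exact: sub.
have icst (a b c : R) : lebesgue_measure.-integrable `[a, b[ (EFin \o cst c).
  apply: measurable_bounded_integrable => //=; last exact: bounded_cst.
  by rewrite lebesgue_measure_itv/=; case: ifPn => // _; rewrite -EFinB ltry.
pose I n := (\int[lebesgue_measure]_(t in `[0%R, (n%:R / q%:R)%R[) f t)%R.
have step n : (n <= q)%N ->
   `|I n - q%:R^-1 * \sum_(j < n) f (s + j%:R / q%:R)| <= q%:R^-1 * \sum_(j < n) osc j.
  elim: n => [|n IH] nq.
    by rewrite /I mul0r set_itvco0 Rintegral_set0 !big_ord0 !mulr0 subr0 normr0.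
  have n1 : n.+1%:R / q%:R <= 1 :> R by rewrite ler_pdivrMr// mul1r ler_nat.
  have n0 : 0 <= n%:R / q%:R :> R by rewrite divr_ge0.
  have nE : n.+1%:R / q%:R = n%:R / q%:R + q%:R^-1 :> R by rewrite -natr1 mulrDl mul1r.
  have qi : 0 < q%:R^-1 :> R by rewrite invr_gt0.
  have split : I n.+1 = I n +
      (\int[lebesgue_measure]_(t in `[(n%:R / q%:R)%R, (n.+1%:R / q%:R)%R[) f t)%R.
    rewrite /I -Rintegral_setU//=; try exact: measurable_itv.
    - congr Rintegral; apply/seteqP; split=> t /=; rewrite !in_itv/=.
        by case: (ltrP t (n%:R / q%:R)) => h1 /andP[h2 h3]; [left|right]; lra.
      by move=> [|]; lra.
    - apply: (integrableS _ _ _ (inte 0 (n.+1%:R / q%:R) (lexx 0) n1)).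
      + exact: measurable_itv.
      + apply: measurableU; exact: measurable_itv.
      + move=> t /=; rewrite !in_itv/= => -[|]; lra.
    - apply/disj_setPS => t /=; rewrite !in_itv/= => -[]; lra.
  have i1 := inte _ _ n0 n1.
  set J := (\int[lebesgue_measure]_(t in `[(n%:R / q%:R)%R, (n.+1%:R / q%:R)%R[) f t)%R in split.
  pose len := fine (lebesgue_measure (`[(n%:R / q%:R)%R, (n.+1%:R / q%:R)%R[%classic : set R)).
  have ms : len = q%:R^-1.
    rewrite /len lebesgue_measure_itv/= lte_fin nE ltrDl qi -EFinB/=; lra.
  have hst t : t \in `[n%:R / q%:R, n.+1%:R / q%:R[ -> `|f t - f (s + n%:R / q%:R)| <= osc n.
    rewrite in_itv/= => ht; apply: hosc => //.
      by rewrite /in_arc !add0r.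
    rewrite /in_arc !add0r nE; have := hs; rewrite mul1r => ?; apply/andP; lra.
  have J1 : J <= (f (s + n%:R / q%:R) + osc n) * len.
    rewrite -Rintegral_cst; last exact: measurable_itv.
    apply: le_Rintegral => [|||t /= ht]; [exact: measurable_itv|exact: i1|exact: icst|].
    have := hst _ ht; rewrite ler_norml /= => ?; lra.
  have J2 : (f (s + n%:R / q%:R) - osc n) * len <= J.
    rewrite -Rintegral_cst; last exact: measurable_itv.
    apply: le_Rintegral => [|||t /= ht]; [exact: measurable_itv|exact: icst|exact: i1|].
    have := hst _ ht; rewrite ler_norml /= => ?; lra.
  rewrite ms in J1 J2; rewrite split !big_ord_recr/= !mulrDr.
  have := IH (ltnW nq); rewrite !ler_norml; move: J1 J2; rewrite !mulrDl !(mulrC _ q%:R^-1); lra.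
have := step _ (leqnn q); rewrite /I divff ?gt_eqF//.
rewrite /Rintegral f0 /= sub0r normrN normrM gtr0_norm ?invr_gt0// ler_pM2l ?invr_gt0// => h.
exact: le_trans h osum.
Qed.

Lemma rational_birkhoff_sum p q x : (0 < q)%N -> coprime p q ->
  `|birkhoff_sum f (p%:R / q%:R) x q| <= arc_variation.
Proof.
move=> q0 cop; have qR : 0 < q%:R :> R by rewrite ltr0n.
pose x' := x - (Num.floor x)%:~R.
have x'01 : 0 <= x' < 1.
  by have := floor_itv x; rewrite /x' rmorphD /=; lra.
pose m := Num.truncn (x' * q%:R).
have hm : m%:R <= x' * q%:R < m.+1%:R.
  by apply: truncn_itv; rewrite mulr_ge0//; case/andP: x'01.
pose s := x' - m%:R / q%:R.
have hs : 0 <= s < 1 / q%:R.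
  move: hm; rewrite -ler_pdivrMr// -ltr_pdivlMr// -natr1 mulrDl /s; lra.
have <- : \sum_(j < q) f (s + j%:R / q%:R) = birkhoff_sum f (p%:R / q%:R) x q.
  rewrite -(sum_shift_mod m (fun j => f (s + j%:R / q%:R)) q0 cop) /birkhoff_sum big_mkord.
  apply: eq_bigr => k _.
  rewrite -(pl_periodic hf (s + _) (((m + k * p) %/ q)%N%:Z + Num.floor x)); congr (f _).
  rewrite rmorphD /= /s /x'.
  have E : (m + k * p)%:R / q%:R = ((m + k * p) %/ q)%:R + ((m + k * p) %% q)%:R / q%:R :> R.
    by rewrite {1}(divn_eq (m + k * p) q) natrD natrM mulrDl mulfK ?gt_eqF.
  move: E; rewrite natrD natrM mulrDl -mulrA; lra.
exact: arc_average.
Qed.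

(** Compared with the rotation by [p / q], the orbit drifts by less than [1 / q] up to
   time q: both orbits share their arcs, and the rational orbit is controlled by the mean. *)
Theorem denjoy_koksma : denjoy_koksma_bound f (2 * arc_variation).
Proof.
move=> p q al x q0 cop hal; have qR : 0 < q%:R :> R by rewrite ltr0n.
pose d := al - p%:R / q%:R.
have dq : `|d| * q%:R <= q%:R^-1.
  by rewrite -ler_pdivlMr// (le_trans hal)// expr2 invfM mul1r.
have q1 : (q.-1)%:R + 1 = q%:R :> R by rewrite natr1 prednK.
have qi : 0 < q%:R^-1 :> R by rewrite invr_gt0.
have d0 := normr_ge0 d.
have : `|birkhoff_sum f al x q - birkhoff_sum f (p%:R / q%:R) x q| <= arc_variation.
  rewrite /birkhoff_sum -sumrB (le_trans (ler_norm_sum _ _ _))// big_mkord.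
  pose y k := x + k%:R * al; pose z k := x + k%:R * (p%:R / q%:R).
  (* the drift has the sign of d, so the arcs open on that side of the rational orbit *)
  apply: (@rotation_arc_sum p q (if 0 <= d then x else x - (q.-1)%:R * `|d|) y z) => // k kq.
  have yE : y k = z k + k%:R * d by rewrite /y /z /d; ring.
  have kd : 0 <= k%:R * `|d| <= (q.-1)%:R * `|d|.
    by rewrite mulr_ge0//= ler_wpM2r// ler_nat -ltnS prednK.
  have qd : (q.-1)%:R * `|d| < q%:R^-1.
    have [->|dn0] := eqVneq `|d| 0; first by rewrite mulr0.
    apply: lt_le_trans dq; rewrite mulrC ltr_pM2l ?lt_def ?dn0//; lra.
  rewrite yE /z mul1r; case: ifP => hd.
    by rewrite (ger0_norm hd) in kd qd; split; lra.
  have hd' : d < 0 by rewrite ltNge hd.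
  rewrite (ltr0_norm hd') in kd qd *; split; lra.
have := rational_birkhoff_sum x q0 cop.
move=> h1 h2; have := ler_normD (birkhoff_sum f al x q - birkhoff_sum f (p%:R / q%:R) x q)
  (birkhoff_sum f (p%:R / q%:R) x q); rewrite subrK; lra.
Qed.

End RotationSums.

(** * Birkhoff sums over dyadic ranges of lengths *)

Section DyadicBound.
Context {R : realType}.
Implicit Types (x al : R).

Lemma dirichlet_approximation al (N : nat) : 0 <= al -> (0 < N)%N ->
  exists p q : nat, [/\ (0 < q <= N)%N, coprime p q &
    `|q%:R * al - p%:R| < 1 / N%:R].
Proof.
move=> al0 N0; have NR : 0 < N%:R :> R by rewrite ltr0n.
pose fr (k : nat) : R := k%:R * al - (Num.truncn (k%:R * al))%:R.
have fr01 k : 0 <= fr k < 1.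
  have : 0 <= k%:R * al by rewrite mulr_ge0.
  by move/truncn_itv; rewrite /fr -natr1; lra.
pose b (k : nat) := Num.truncn (fr k * N%:R).
have bitv k : (b k)%:R <= fr k * N%:R < (b k).+1%:R.
  by apply: truncn_itv; rewrite mulr_ge0//; case/andP: (fr01 k).
have bN (k : nat) : (b k < N)%N.
  rewrite -(ltr_nat R); have /andP[h _] := bitv k; apply: (le_lt_trans h).
  by rewrite gtr_pMl//; case/andP: (fr01 k).
pose h (k : 'I_N.+1) : 'I_N := Ordinal (bN k).
have /injectivePn[k1 [k2 k12 hk]] : ~~ injectiveb h.
  by apply/negP => /injectiveP/leq_card; rewrite !card_ord ltnn.
wlog {k12} k12 : k1 k2 hk / (k1 < k2)%N.
  move=> H; case: (ltngtP k1 k2) => [|lt|/val_inj E]; [exact: H|exact: (H k2 k1)|].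
  by rewrite E eqxx in k12.
move: hk => /(congr1 val)/= hk.
pose q := (k2 - k1)%N; pose t1 := Num.truncn (k1%:R * al); pose t2 := Num.truncn (k2%:R * al).
have t12 : (t1 <= t2)%N by apply: le_truncn; rewrite ler_wpM2r// ler_nat ltnW.
pose p := (t2 - t1)%N.
have close : `|q%:R * al - p%:R| < 1 / N%:R.
  rewrite /q /p !natrB// ?(ltnW k12)//.
  have -> : (k2%:R - k1%:R) * al - (t2%:R - t1%:R) = fr k2 - fr k1.
    by rewrite /fr -/t1 -/t2; ring.
  have := bitv k1; have := bitv k2; rewrite hk -natr1 => /andP[a1 a2] /andP[a3 a4].
  by rewrite ltr_pdivlMr// -{1}(gtr0_norm NR) -normrM ltr_norml; apply/andP; split; lra.
have q0 : (0 < q)%N by rewrite subn_gt0.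
have qN : (q <= N)%N by rewrite leq_subLR (leq_trans _ (leq_addl _ _))// -ltnS ltn_ord.
pose g := gcdn p q; have g0 : (0 < g)%N by rewrite gcdn_gt0 q0 orbT.
exists (p %/ g)%N, (q %/ g)%N; split.
- by rewrite divn_gt0// dvdn_leq ?dvdn_gcdr//= (leq_trans (leq_div _ _)).
- rewrite /coprime -(eqn_pmul2l g0) muln_gcdr muln1.
  by rewrite ![(g * _)%N]mulnC !divnK ?dvdn_gcdl ?dvdn_gcdr.
- apply: le_lt_trans close.
  have E : q%:R * al - p%:R = g%:R * ((q %/ g)%:R * al - (p %/ g)%:R).
    have Eq : q%:R = g%:R * (q %/ g)%:R :> R by rewrite -natrM mulnC divnK ?dvdn_gcdr.
    have Ep : p%:R = g%:R * (p %/ g)%:R :> R by rewrite -natrM mulnC divnK ?dvdn_gcdl.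
    by rewrite {1}Eq {1}Ep; ring.
  by rewrite E normrM ger0_norm// ler_peMl// ler1n.
Qed.

(** Resonance of strength [2 ^ l] at scale [2 ^ j]: a denominator q about [2 ^ l]
   times smaller than [2 ^ j] already brings [q * al] within [1 / 2 ^ j] of an integer. *)
Definition near_rational (j l : nat) : set R :=
  [set al | exists p q : nat, [/\ (0 < q)%N, (q * 2 ^ l < 2 ^ j.+1)%N &
     `|q%:R * al - p%:R| < 1 / 2 ^+ j]].

(** A resonance of strength [2 ^ l] entails the weaker ones, so when all are weaker than
   [2 ^ L] this sum is at least the strength of the strongest one. *)
Definition dyadic_count (L j : nat) al : R :=
  \sum_(l < L) 2 ^+ l * \1_(near_rational j l) al.

Lemma dyadic_count_ge0 L j al : 0 <= dyadic_count L j al.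
Proof. by apply: sumr_ge0 => l _; rewrite mulr_ge0 ?exprn_ge0. Qed.

Lemma birkhoff_sumD f al x (m n : nat) :
  birkhoff_sum f al x (m + n) = birkhoff_sum f al x m + birkhoff_sum f al (x + m%:R * al) n.
Proof.
rewrite /birkhoff_sum (big_cat_nat (n := m)) ?leq_addr//=; congr (_ + _).
rewrite -{1}[m]add0n big_addn addKn; apply: eq_big_nat => k _.
by rewrite natrD; congr (f _); ring.
Qed.

Lemma birkhoff_sum0 f al x : birkhoff_sum f al x 0 = 0.
Proof. by rewrite /birkhoff_sum big_geq. Qed.

Lemma birkhoff_sumM f al (q b : nat) V : (forall x, `|birkhoff_sum f al x q| <= V) ->
  forall x, `|birkhoff_sum f al x (b * q)| <= b%:R * V.
Proof.
move=> h; elim: b => [|b IH] x; first by rewrite birkhoff_sum0 normr0 mul0r.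
rewrite mulSn birkhoff_sumD (le_trans (ler_normD _ _))//.
by rewrite -natr1 mulrDl mul1r addrC lerD.
Qed.

Context (f : R -> R) (V : R) (V0 : 0 <= V).
Hypothesis dk : denjoy_koksma_bound f V.

Lemma denjoy_koksma_mul p q al x : (0 < q)%N -> coprime p q ->
  `|q%:R * al - p%:R| <= 1 / q%:R -> `|birkhoff_sum f al x q| <= V.
Proof.
move=> q0 cop h; have qR : 0 < q%:R :> R by rewrite ltr0n.
apply: (dk x q0 cop).
have -> : al - p%:R / q%:R = q%:R^-1 * (q%:R * al - p%:R) by field; rewrite gt_eqF.
by rewrite normrM gtr0_norm ?invr_gt0// mul1r expr2 invfM ler_pM2l ?invr_gt0// -[leRHS]mul1r.
Qed.

(** Dirichlet's theorem at N gives q <= N, and N = b q + r. Each of the b blocks costs V by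
   Denjoy-Koksma; b is at most twice the strength of the resonance at the scale of N, and
   r is below half of N, hence belongs to a smaller scale. *)
Lemma dyadic_bound L k al : 0 <= al ->
  (forall j, (j < k)%N -> ~ near_rational j L al) ->
  forall N, (N < 2 ^ k)%N -> forall x,
  `|birkhoff_sum f al x N| <= V * \sum_(j < k) dyadic_count L j al.
Proof.
move=> al0; elim: k => [|k IH] nr N Nk x.
  by move: Nk; rewrite expn0 ltnS leqn0 => /eqP ->; rewrite birkhoff_sum0 normr0 big_ord0 mulr0.
have {}IH := IH (fun j jk => nr j (leq_trans jk (leqnSn k))).
rewrite big_ord_recr/= mulrDr.
have [Nk'|kN] := ltnP N (2 ^ k).
  by rewrite (le_trans (IH _ Nk' x))// lerDl mulr_ge0// dyadic_count_ge0.
have N0 : (0 < N)%N by rewrite (leq_trans _ kN)// expn_gt0.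
have [p [q [/andP[q0 qN] cop hq]]] := dirichlet_approximation al0 N0.
have NR : 0 < N%:R :> R by rewrite ltr0n.
have qR : 0 < q%:R :> R by rewrite ltr0n.
have Sq y : `|birkhoff_sum f al y q| <= V.
  apply: (denjoy_koksma_mul _ q0 cop); rewrite (le_trans (ltW hq))// !mul1r.
  by rewrite lef_pV2// ler_nat.
have rk : (N %% q < 2 ^ k)%N.
  have := ltn_pmod N q0; have := divn_eq N q.
  have : (0 < N %/ q)%N by rewrite divn_gt0.
  move: Nk; rewrite expnS; nia.
rewrite {1}(divn_eq N q) birkhoff_sumD (le_trans (ler_normD _ _))// addrC lerD//.
  exact: IH.
rewrite (le_trans (birkhoff_sumM _ Sq _))// mulrC ler_wpM2l//.
set b := (N %/ q)%N.
have b0 : (0 < b)%N by rewrite divn_gt0.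
pose l := trunc_log 2 b.
have /andP[lb bl] := trunc_log_bounds (isT : 1 < 2)%N b0.
have nrl l' : (l' <= l)%N -> near_rational k l' al.
  move=> ll; exists p, q; split=> //.
    have : (2 ^ l' <= b)%N by rewrite (leq_trans _ lb)// leq_exp2l.
    move=> h; apply: leq_ltn_trans Nk; rewrite (divn_eq N q) -/b; nia.
  apply: (lt_le_trans hq); rewrite !mul1r lef_pV2 ?posrE ?exprn_gt0//.
  by rewrite -natrX ler_nat.
have lL : (l < L)%N.
  by rewrite ltnNge; apply/negP => Ll; apply: (nr k) => //; exact: nrl.
(* 1 + 2 + ... + 2 ^ l = 2 ^ (l + 1) - 1 is at least b *)
apply: (@le_trans _ _ (\sum_(i < l.+1) 2 ^+ i)).
  have -> : \sum_(i < l.+1) 2 ^+ i = 2 ^+ l.+1 - 1 :> R.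
    by rewrite (subrX1 2 l.+1) /=; lra.
  have : b.+1%:R <= 2 ^+ l.+1 :> R by rewrite -natrX ler_nat.
  by rewrite -natr1; lra.
rewrite /dyadic_count -(big_mkord xpredT (fun i => 2 ^+ i)).
rewrite -(big_mkord xpredT (fun i => 2 ^+ i * \1_(near_rational k i) al)).
rewrite [leRHS](big_cat_nat (n := l.+1))//=.
apply: ler_wpDr; first by apply: sumr_ge0 => i _; rewrite mulr_ge0 ?exprn_ge0.
rewrite le_eqVlt; apply/orP; left; apply/eqP; apply: eq_big_nat => i /andP[_ il].
by rewrite indicE mem_set ?mulr1//; apply: nrl.
Qed.

End DyadicBound.

(** * Lengths of subsets of the unit interval *)

Section UnitLength.
Context {R : realType}.
Implicit Types (A B E : set R) (x y : R).
Local Notation mu := (@lebesgue_measure R).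

(** Lebesgue measure on [0, 1] as a real number, which makes the estimates below
   inequalities in an ordered field. *)
Definition unit_length A : R := fine (mu (A `&` `[0, 1])).

Let mI : measurable (`[0, 1]%classic : set R). Proof. exact: measurable_itv. Qed.

Lemma lebesgue_unit_itv : mu `[0, 1]%classic = 1%E.
Proof. by rewrite lebesgue_measure_itv/= lte_fin ltr01 oppr0 adde0. Qed.

Lemma unit_lengthE A : measurable A -> (unit_length A)%:E = mu (A `&` `[0, 1]).
Proof.
move=> mA; rewrite fineK// ge0_fin_numE//.
by rewrite (@le_lt_trans _ _ 1%E) ?ltry// -lebesgue_unit_itv le_measure ?inE//; apply: measurableI.
Qed.

Lemma unit_length_ge0 A : 0 <= unit_length A.
Proof. exact: fine_ge0. Qed.

Lemma unit_length_mono A B : measurable A -> measurable B -> A `&` `[0, 1] `<=` B ->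
  unit_length A <= unit_length B.
Proof.
move=> mA mB AB; rewrite -lee_fin !unit_lengthE//.
by apply: le_measure; rewrite ?inE; [exact: measurableI|exact: measurableI|
  move=> t [? ?]; split=> //; exact: AB].
Qed.

Lemma unit_length0 : unit_length set0 = 0.
Proof. by rewrite /unit_length set0I measure0. Qed.

Lemma unit_lengthU A B : measurable A -> measurable B ->
  unit_length (A `|` B) + unit_length (A `&` B) = unit_length A + unit_length B.
Proof.
move=> mA mB; apply: EFin_inj; rewrite !EFinD !unit_lengthE//; [|exact: measurableI|exact: measurableU].
have mA' := measurableI _ _ mA mI; have mB' := measurableI _ _ mB mI.
have fB : mu (B `&` `[0, 1]) \is a fin_num by rewrite -unit_lengthE.
have fAB : mu (A `&` B `&` `[0, 1]) \is a fin_num by rewrite -unit_lengthE//; exact: measurableI.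
rewrite setIUl measureUfinr//; last by rewrite -ge0_fin_numE.
by rewrite -setIIl subeK.
Qed.

Lemma unit_lengthU_le A B : measurable A -> measurable B ->
  unit_length (A `|` B) <= unit_length A + unit_length B.
Proof. by move=> mA mB; rewrite -unit_lengthU// lerDl unit_length_ge0. Qed.

Lemma unit_length_bigU_le (I : Type) (r : seq I) (P : pred I) (F : I -> set R) :
  (forall i, measurable (F i)) ->
  unit_length (\big[setU/set0]_(i <- r | P i) F i) <= \sum_(i <- r | P i) unit_length (F i).
Proof.
move=> mF; elim: r => [|i r IH]; first by rewrite !big_nil unit_length0.
rewrite !big_cons; case: ifP => // _; apply: le_trans (lerD (lexx _) IH).
by apply: unit_lengthU_le => //; apply: bigsetU_measurable.
Qed.

Lemma unit_length_bigU (I : eqType) (r : seq I) (F : I -> set R) : uniq r ->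
  (forall i, measurable (F i)) ->
  (forall i j, i \in r -> j \in r -> i != j -> F i `&` F j = set0) ->
  unit_length (\big[setU/set0]_(i <- r) F i) = \sum_(i <- r) unit_length (F i).
Proof.
move=> + mF; elim: r => [|i r IH] /=; first by rewrite !big_nil unit_length0.
move=> /andP[ir ur] dis; rewrite !big_cons -IH//; last first.
  by move=> a b ar br; apply: dis; rewrite inE ?ar ?br orbT.
rewrite -unit_lengthU//; last by apply: bigsetU_measurable.
suff -> : F i `&` \big[setU/set0]_(j <- r) F j = set0 by rewrite unit_length0 addr0.
rewrite big_distrr/= big_seq big1// => j jr; apply: dis; rewrite ?inE ?eqxx ?jr ?orbT//.
by apply: contraNneq ir => ->.
Qed.

Lemma unit_length_ball_le x r : 0 <= r -> unit_length (ball x r) <= 2 * r.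
Proof.
move=> r0; have mb : measurable (ball x r) by exact: measurable_ball.
rewrite -lee_fin unit_lengthE// mulrC mulr_natr -(lebesgue_measure_ball x)//.
by apply: le_measure; rewrite ?inE//; exact: measurableI.
Qed.

Lemma unit_length_ball x r : 0 <= r -> 0 <= x - r -> x + r <= 1 ->
  unit_length (ball x r) = 2 * r.
Proof.
move=> r0 h1 h2; have mb : measurable (ball x r) by exact: measurable_ball.
apply: EFin_inj; rewrite unit_lengthE// mulrC mulr_natr -(lebesgue_measure_ball x)//; congr (mu _).
by apply: setIidl => t; rewrite ball_itv/= !in_itv/=; lra.
Qed.

(** Markov's inequality for a combination of indicators. *)
Lemma unit_length_markov (I : Type) (r : seq I) (c : I -> R) (F : I -> set R) (t : R) :
  0 < t -> (forall i, 0 <= c i) -> (forall i, measurable (F i)) ->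
  exists B, [/\ measurable B, unit_length B <= (\sum_(i <- r) c i * unit_length (F i)) / t &
     forall x, 0 <= x <= 1 -> ~ B x -> \sum_(i <- r) c i * \1_(F i) x < t].
Proof.
move=> t0 c0 mF.
pose g x : \bar R := (\sum_(i <- r) (c i * \1_(F i) x)%:E)%E.
have gE x : g x = (\sum_(i <- r) c i * \1_(F i) x)%:E by rewrite /g sumEFin.
have mi i : measurable_fun (`[0, 1]%classic : set R) (fun x => (\1_(F i) x)%:E).
  by apply/measurable_EFinP; exact: measurable_indic.
have mfi i : measurable_fun (`[0, 1]%classic : set R) (fun x => (c i * \1_(F i) x)%:E).
  apply/measurable_EFinP; apply: measurable_funM; first exact: measurable_cst.
  exact: measurable_indic.
have fi0 i (x : R) : `[0, 1]%classic x -> (0 <= (c i * \1_(F i) x)%:E)%E.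
  by move=> _; rewrite lee_fin mulr_ge0.
have mg : measurable_fun (`[0, 1]%classic : set R) g by apply: emeasurable_sum.
have g0 x : (0 <= g x)%E by apply: sume_ge0 => i _; rewrite lee_fin mulr_ge0.
pose B : set R := `[0, 1]%classic `&` [set x | (t%:E <= `|g x|)%E].
have mB : measurable B.
  by apply: emeasurable_fun_c_infty => //; exact: measurableT_comp.
exists B; split=> //.
- rewrite ler_pdivlMr// mulrC -lee_fin EFinM unit_lengthE//.
  have -> : B `&` `[0, 1] = B by rewrite /B setIAC setIid.
  apply: (le_trans (le_integral_abse mu mI mg t0)).
  under eq_integral do rewrite gee0_abs//.
  rewrite /g ge0_integral_sum// -sumEFin; apply: lee_sum => i _.
  under eq_integral do rewrite EFinM.
  rewrite ge0_integralZl_EFin//; last exact: mi.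
  rewrite (integral_indic mu mI (mF i)).
  have E : (c i * unit_length (F i))%:E = ((c i)%:E * mu (F i `&` `[0%R, 1%R]))%E.
    by rewrite EFinM unit_lengthE.
  have := lexx (c i * unit_length (F i))%:E; rewrite {1}E; exact.
- move=> x x01 nB; rewrite ltNge; apply/negP => h; apply: nB; split=> /=.
    by rewrite in_itv.
  by rewrite gee0_abs// gE lee_fin.
Qed.

(** Points satisfying [P] fill an open set [U] which takes a proportion at least [c] of
   every interval, so the complement of [U] has no density point: it is negligible by
   Lebesgue's density theorem. *)
Theorem ae_of_local_density (P : R -> Prop) (c : R) : 0 < c ->
  (forall u v, 0 < u -> u < v -> v < 1 -> exists E, [/\ open E,
     forall x, E x -> u < x < v /\ P x & c * (v - u) <= unit_length E]) ->
  {ae mu, forall x, 0 < x < 1 -> P x}.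
Proof.
move=> c0 H.
pose U := \bigcup_(E in [set E | open E /\ forall x, E x -> P x]) E.
have oU : open U by apply: bigcup_open => E [].
have mU : measurable U by exact: open_measurable.
have UP x : U x -> P x by move=> [E [_ EP] Ex]; exact: EP.
pose N := `]0, 1[ `\` U : set R.
have mN : measurable N by apply: measurableD => //; exact: measurable_itv.
have key x : 0 < x < 1 -> ~ (mu (N `&` ball x r) * (mu (ball x r))^-1 @[r --> 0^'+] --> 1)%E.
  move=> x01 lim.
  have c' : (((1 - c)%:E : \bar R) < 1)%E by rewrite lte_fin; lra.
  have h : \forall r \near 0^'+, ((1 - c)%:E < mu (N `&` ball x r) * (mu (ball x r))^-1)%E.
    exact: lim _ (open_ereal_gt' c').
  have [r [hr [r0 rx]]] : exists r, ((1 - c)%:E < mu (N `&` ball x r) * (mu (ball x r))^-1)%E /\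
      0 < r /\ (r < x /\ r < 1 - x).
    have [x0 x1] : 0 < x /\ 0 < 1 - x by lra.
    near (0 : R)^'+ => r; exists r; split; first by near: r.
    split; first by near: r; exact: nbhs_right_gt.
    by split; near: r; exact: nbhs_right_lt.
  have [||| E [oE EP Em]] := H (x - r) (x + r); [lra..|].
  have mE := open_measurable oE.
  have mb : measurable (ball x r) by exact: measurable_ball.
  have bE : mu (ball x r) = (2 * r)%:E by rewrite lebesgue_measure_ball ?ltW// mulrC mulr_natr.
  have Eb : E `<=` ball x r by move=> t /EP[ht _]; rewrite ball_itv/= in_itv/=; lra.
  have E01 : E `<=` `[0, 1] by move=> t /EP[ht _]; rewrite /= in_itv/=; lra.
  have EE : mu E = (unit_length E)%:E by rewrite unit_lengthE// setIidl.
  have : (mu (N `&` ball x r) <= (2 * r)%:E - (unit_length E)%:E)%E.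
    rewrite -EE -bE -[X in (_ - mu X)%E](setIidr Eb) -measureD//; last by have := ltry (2 * r); rewrite -bE.
    apply: le_measure; rewrite ?inE; [exact: measurableI|exact: measurableD|].
    move=> t [[_ nU] bt]; split=> // Et; apply: nU; exists E => //; split=> // y /EP[].
    by [].
  move=> le1; move: hr; rewrite bE inver gt_eqF ?mulr_gt0//; apply/negP; rewrite -leNgt.
  apply: (le_trans (lee_wpmul2r _ le1)); first by rewrite lee_fin invr_ge0 mulr_ge0 ?ltW.
  rewrite -EFinB -EFinM lee_fin ler_pdivrMr ?mulr_gt0//; move: Em; nra.
have := lebesgue_density mN.
apply: filter_app; first exact: (ae_filter_ringOfSetsType mu).
apply: aeW => /= x hx x01.
apply: UP; apply: contrapT => nU; apply: (key x x01).
by move: hx; rewrite indicE mem_set//; split=> //=; rewrite in_itv/=.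
Unshelve. all: by end_near. Qed.

End UnitLength.

(** * Rotations with large Birkhoff sums are rare *)

Section ExceptionalSet.
Context {R : realType}.
Implicit Types (x al : R).

Lemma near_rational_measurable j l : measurable (@near_rational R j l).
Proof.
have -> : @near_rational R j l = \bigcup_(p in [set: nat])
    \bigcup_(q in [set q | (0 < q)%N && (q * 2 ^ l < 2 ^ j.+1)%N])
      ball (p%:R / q%:R : R) (1 / 2 ^+ j / q%:R).
  have E (al : R) (p q : nat) : (0 < q)%N ->
    (`|q%:R * al - p%:R| < 1 / 2 ^+ j) = (`|p%:R / q%:R - al| < 1 / 2 ^+ j / q%:R).
    move=> q0; have qR : 0 < q%:R :> R by rewrite ltr0n.
    rewrite (ltr_pdivlMr _ _ qR) -{3}(gtr0_norm qR) -normrM distrC; congr (`|_| < _).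
    by field; rewrite gt_eqF.
  apply/seteqP; split=> al /=.
    by move=> [p [q [q0 ql h]]]; exists p => //; exists q; rewrite /= ?q0//= /ball/= -E.
  by move=> [p _ [q /andP[q0 ql]]]; rewrite /ball/= -E// => h; exists p, q.
apply: bigcup_measurable => p _; apply: bigcup_measurable => q _.
exact: measurable_ball.
Qed.

(** For each q < 2^(j+1-l) there are q + 1 intervals of length 2 / (2^j q), of total length at
   most 4 / 2^j. *)
Lemma near_rational_length j l : unit_length (@near_rational R j l) <= 8 / 2 ^+ l.
Proof.
pose Q := ((2 ^ j.+1).-1 %/ 2 ^ l)%N.
pose rad (q : nat) : R := 1 / 2 ^+ j / q%:R.
pose U := \big[setU/set0]_(1 <= q < Q.+1) \big[setU/set0]_(0 <= p < q.+1)
            ball (p%:R / q%:R : R) (rad q).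
have p2 : 0 < 2 ^+ j :> R by rewrite exprn_gt0.
have p2l : 0 < 2 ^+ l :> R by rewrite exprn_gt0.
have mb (q : nat) : measurable (\big[setU/set0]_(0 <= p < q.+1)
            ball (p%:R / q%:R : R) (rad q)).
  by apply: bigsetU_measurable => p _; exact: measurable_ball.
have mU : measurable U by apply: bigsetU_measurable.
apply: (@le_trans _ _ (unit_length U)).
  apply: unit_length_mono => //; first exact: near_rational_measurable.
  move=> al [[p [q [q0 ql h]]]] /=; rewrite in_itv/= => al01.
  have qR : 0 < q%:R :> R by rewrite ltr0n.
  have qQ : (q <= Q)%N by rewrite leq_divRL ?expn_gt0// -ltnS prednK ?expn_gt0.
  have pq : (p < q.+1)%N.
    rewrite -(ltr_nat R) -natr1.
    have h1 : 1 / 2 ^+ j <= 1 :> R by rewrite ler_pdivrMr// mul1r exprn_ege1// ler1n.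
    have : q%:R * al <= q%:R by rewrite ler_piMr//; case/andP: al01.
    by move: h h1; rewrite ltr_norml => /andP[+ _]; move: (1 / 2 ^+ j) => e; lra.
  rewrite /U -bigcup_seq; exists q; first by rewrite /= mem_index_iota q0.
  rewrite -bigcup_seq; exists p; first by rewrite /= mem_index_iota.
  rewrite /ball/= /rad (ltr_pdivlMr _ _ qR) -{2}(gtr0_norm qR) -normrM.
  by apply: le_lt_trans h; rewrite le_eqVlt; apply/orP; left; apply/eqP; rewrite -[RHS]normrN; congr (`|_|); field; rewrite gt_eqF.
apply: (le_trans (unit_length_bigU_le _ _ _)) => //.
apply: (@le_trans _ _ (\sum_(1 <= q < Q.+1) 4 / 2 ^+ j)).
  apply: ler_sum_nat => q /andP[q0 _].
  have qR : 0 < q%:R :> R by rewrite ltr0n.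
  apply: (le_trans (unit_length_bigU_le _ _ _)); first by move=> p; exact: measurable_ball.
  apply: (@le_trans _ _ (\sum_(0 <= p < q.+1) 2 * rad q)).
    apply: ler_sum => p _; apply: unit_length_ball_le.
    by rewrite /rad !divr_ge0// ltW.
  rewrite sumr_const_nat subn0 -[_ *+ q.+1]mulr_natr -[q.+1%:R]natr1 /rad.
  have -> : 2 * (1 / 2 ^+ j / q%:R) * (q%:R + 1) = (2 + 2 / q%:R) / 2 ^+ j :> R.
    by field; rewrite !gt_eqF.
  rewrite ler_pM2r ?invr_gt0//.
  have : 2 / q%:R <= 2 :> R by rewrite ler_pdivrMr// ler_peMr// ler1n.
  lra.
rewrite sumr_const_nat subn1 -[_ *+ _]mulr_natr /=.
have : (Q * 2 ^ l <= 2 ^ j.+1)%N.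
  by rewrite (leq_trans (leq_trunc_div _ _))// leq_pred.
rewrite -(ler_nat R) natrM !natrX exprS => h.
rewrite ler_pdivlMr//.
have -> : 4 / 2 ^+ j * Q%:R * 2 ^+ l = 4 * (Q%:R * 2 ^+ l) / 2 ^+ j :> R by ring.
by rewrite ler_pdivrMr//; lra.
Qed.

Context (f : R -> R) (V : R) (V0 : 0 <= V).
Hypothesis dk : denjoy_koksma_bound f V.

(** Resonances of strength [2 ^ L] are discarded altogether. Weaker ones are discarded by
   Markov's inequality when their count is large: each of the k L levels contributes at
   most 8 to the mean of the count. *)
Lemma exceptional_set (k L : nat) (t : R) : 0 < t -> exists B : set R,
  [/\ measurable B, unit_length B <= 8 * k%:R * L%:R / t + 8 * k%:R / 2 ^+ L &
      forall al, 0 <= al <= 1 -> ~ B al -> forall N x, (N < 2 ^ k)%N ->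
        `|birkhoff_sum f al x N| <= V * t].
Proof.
move=> t0; have p2 n : 0 < 2 ^+ n :> R by rewrite exprn_gt0.
have [B0 [mB0 lB0 hB0]] := @unit_length_markov R ('I_k * 'I_L)%type (index_enum _)
  (fun jl => 2 ^+ jl.2) (fun jl => near_rational jl.1 jl.2) t t0
  (fun jl => ltW (p2 jl.2)) (fun jl => near_rational_measurable jl.1 jl.2).
pose B1 := \big[setU/set0]_(j < k) @near_rational R j L.
have mB1 : measurable B1 by apply: bigsetU_measurable => j _; exact: near_rational_measurable.
exists (B0 `|` B1); split.
- exact: measurableU.
- apply: (le_trans (unit_lengthU_le mB0 mB1)); apply: lerD.
    apply: (le_trans lB0); rewrite ler_pM2r ?invr_gt0//.
    apply: (@le_trans _ _ (\sum_(i : ('I_k * 'I_L)%type) 8)).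
      apply: ler_sum => jl _.
      rewrite (le_trans (ler_wpM2l (ltW (p2 _)) (near_rational_length _ _)))//.
      by rewrite mulrC divfK ?gt_eqF.
    by rewrite sumr_const card_prod !card_ord -mulrA -natrM mulr_natr.
  apply: (le_trans (unit_length_bigU_le _ _ _)); first by move=> j; exact: near_rational_measurable.
  apply: (@le_trans _ _ (\sum_(j < k) (8 / 2 ^+ L))).
    apply: ler_sum => j _; exact: near_rational_length.
  by rewrite sumr_const card_ord -[X in X <= _]mulr_natr mulrAC.
- move=> al al01 nB N x Nk.
  have al0 : 0 <= al by lra.
  apply: (le_trans (dyadic_bound V0 dk al0 (k := k) (L := L) _ Nk x)).
    move=> j jk h; apply: nB; right; rewrite /B1 -bigcup_seq.
    by exists (Ordinal jk) => //=; rewrite mem_index_enum.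
  rewrite ler_wpM2l//; apply: ltW; apply: le_lt_trans (hB0 al al01 _); last first.
    by move=> h; apply: nB; left.
  rewrite -(pair_bigA _ (fun (j : 'I_k) (l : 'I_L) => 2 ^+ l * \1_(near_rational j l) al))/=.
  by rewrite le_eqVlt; apply/orP; left; apply/eqP; apply: eq_bigr.
Qed.

End ExceptionalSet.

(** * Denominators avoiding resonances *)

Section Counting.
Local Close Scope classical_set_scope.
Local Open Scope set_scope.
Context {R : realType}.
Implicit Types (u v d rho : R).

Lemma card_separated (T : finType) (A : {set T}) (g : T -> R) (a b del : R) :
  0 < del -> a <= b -> (forall x, x \in A -> a <= g x <= b) ->
  (forall x y, x \in A -> y \in A -> x != y -> del <= `|g x - g y|) ->
  #|A|%:R <= (b - a) / del + 1.
Proof.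
move=> del0 ab gab sep.
pose n := Num.truncn ((b - a) / del).
have ba0 : 0 <= (b - a) / del by rewrite divr_ge0 ?subr_ge0// ltW.
have nle : n%:R <= (b - a) / del by have /andP[] := truncn_itv ba0.
pose h (x : T) : 'I_n.+1 := inord (Num.truncn ((g x - a) / del)).
have hE x : x \in A -> (h x)%:R <= (g x - a) / del < (h x).+1%:R.
  move=> xA; have := gab _ xA => gx.
  have g0 : 0 <= (g x - a) / del by rewrite divr_ge0 ?(ltW del0)//; lra.
  rewrite inordK; first exact: truncn_itv.
  by rewrite ltnS le_truncn// ler_pM2r ?invr_gt0//; lra.
have hinj : {in A &, injective h}.
  move=> x y xA yA hxy; apply/eqP; apply/negPn/negP => xy.
  have := sep _ _ xA yA xy; have := hE _ xA; have := hE _ yA; rewrite hxy -natr1.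
  move=> /andP[h1 h2] /andP[h3 h4]; apply/negP; rewrite -ltNge.
  have : `|(g x - g y) / del| < 1.
    have -> : (g x - g y) / del = (g x - a) / del - (g y - a) / del by ring.
    by rewrite ltr_norml; apply/andP; split; lra.
  by rewrite normrM [`|del^-1|]gtr0_norm ?invr_gt0// ltr_pdivrMr// mul1r.
have : (#|A| <= n.+1)%N.
  by rewrite -(card_in_imset hinj) -[X in (_ <= X)%N]card_ord max_card.
by rewrite -(ler_nat R) -natr1; lra.
Qed.

Lemma card_progression_ge (n : nat) (A : {set 'I_n}) (s D m : nat) : (0 < D)%N ->
  (forall i, (i < m)%N -> exists2 x : 'I_n, x \in A & val x = (s + D * i)%N) -> (m <= #|A|)%N.
Proof.
move=> D0 h; have hx (i : 'I_m) : {x : 'I_n | x \in A /\ val x = (s + D * i)%N}.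
  by apply: cid; have [x xA xE] := h i (ltn_ord i); exists x.
pose g i := sval (hx i).
have gi : injective g.
  move=> i j gij; apply: val_inj.
  have [_ e1] := svalP (hx i); have [_ e2] := svalP (hx j).
  have e3 : sval (hx i) = sval (hx j) by [].
  by move: e2; rewrite -e3 e1 => /eqP; rewrite eqn_add2l eqn_pmul2l// => /eqP.
rewrite -[X in (X <= _)%N]card_ord -cardsT -(card_imset _ gi).
by apply/subset_leq_card/fintype.subsetP => _ /imsetP[i _ ->]; have [] := svalP (hx i).
Qed.

Lemma card_cover_le (T : finType) (A : {set T}) (I : eqType) (r : seq I) (B : I -> {set T}) :
  (forall x, x \in A -> exists2 i, i \in r & x \in B i) ->
  (#|A| <= \sum_(i <- r) #|B i|)%N.
Proof.
elim: r A => [|i r IH] A h.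
  rewrite big_nil leqn0 cards_eq0; apply/eqP/setP => x; rewrite inE.
  by apply/negP => /h[].
rewrite big_cons -(cardsID (B i) A) leq_add//.
  by apply: subset_leq_card; apply: subsetIr.
apply: IH => x; rewrite inE => /andP[xB xA]; have [j] := h _ xA.
rewrite inE => /orP[/eqP ->|jr] xj; first by rewrite xj in xB.
by exists j.
Qed.

Lemma card_fibers (T1 T2 : finType) (A : {set T1 * T2}) :
  #|A| = (\sum_(q : T2) #|[set p | (p, q) \in A]|)%N.
Proof.
rewrite -sum1_card big_mkcond/=.
transitivity (\sum_(x : T1 * T2) (if (x.1, x.2) \in A then 1 else 0))%N.
  by apply: eq_bigr => -[].
rewrite -(pair_bigA _ (fun p q => if (p, q) \in A then 1 else 0))%N/=.
rewrite exchange_big/=; apply: eq_bigr => q _.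
by rewrite -sum1_card [RHS]big_mkcond/=; apply: eq_bigr => p _; rewrite ?inE.
Qed.

(** For [ds] the differences of the singularities of [f], this keeps the singularities of
   the sum of length q about [rho / q] apart. *)
Definition nonresonant (ds : seq R) rho (q : nat) : Prop :=
  forall d, d \in ds -> forall m : int, rho <= `|q%:R * d - m%:~R|.

Lemma dist_int_pos d : (forall m : int, d <> m%:~R) ->
  exists2 rho, 0 < rho & forall m : int, rho <= `|d - m%:~R|.
Proof.
move=> dm; have fl := floor_itv d; have fne := dm (Num.floor d).
set k := Num.floor d in fl fne *; move: fl; rewrite rmorphD/= => fl.
have lt1 : k%:~R < d by rewrite lt_neqAle; apply/andP; split; [apply/eqP => /esym|lra].
exists (Num.min (d - k%:~R) (k%:~R + 1 - d)).
  by rewrite lt_min; apply/andP; split; lra.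
move=> m; have [mk|km] := leP m k.
  have : m%:~R <= k%:~R :> R by rewrite ler_int.
  rewrite ge_min => ?; apply/orP; left; rewrite ger0_norm; lra.
have : (k + 1)%:~R <= m%:~R :> R by rewrite ler_int lezD1.
rewrite rmorphD/= ge_min => ?; apply/orP; right; rewrite ler0_norm; lra.
Qed.

Definition irrational_ratio d := forall h : nat, (0 < h)%N -> forall m : int, h%:R * d <> m%:~R.

Lemma common_denominator (ds : seq R) : exists2 Q : nat, (0 < Q)%N &
  forall d, d \in ds -> (exists m : int, Q%:R * d = m%:~R) \/ irrational_ratio d.
Proof.
elim: ds => [|d ds [Q Q0 hQ]]; first by exists 1%N.
have [irr|nirr] := pselect (irrational_ratio d).
  by exists Q => // e; rewrite inE => /orP[/eqP ->|/hQ//]; right.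
have [h [h0 [m hm]]] : exists h, (0 < h)%N /\ exists m : int, h%:R * d = m%:~R.
  apply: contrapT => n; apply: nirr => h h0 m hm; apply: n; exists h; split=> //; by exists m.
exists (Q * h)%N; first by rewrite muln_gt0 Q0.
move=> e; rewrite inE => /orP[/eqP ->|eds].
  by left; exists (Q%:Z * m); rewrite natrM -mulrA hm rmorphM.
have [[m' hm']|] := hQ _ eds; last by right.
by left; exists (h%:Z * m'); rewrite natrM mulrAC hm' rmorphM/= mulrC.
Qed.

Lemma irrational_gap d (Q H : nat) : (0 < Q)%N -> irrational_ratio d ->
  exists2 rho, 0 < rho & forall h, (0 < h < H)%N -> forall m : int, rho <= `|(Q * h)%:R * d - m%:~R|.
Proof.
move=> Q0 irr; elim: H => [|H [r r0 hr]]; first by exists 1 => // h; rewrite ltn0 andbF.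
case: (posnP H) => [->|H0]; first by exists 1 => // h; lia.
have [|s s0 hs] := @dist_int_pos ((Q * H)%:R * d).
  by apply: irr; rewrite muln_gt0 Q0.
exists (Num.min r s); first by rewrite lt_min r0.
move=> h /andP[h0]; rewrite ltnS leq_eqVlt => /orP[/eqP ->|hH] m; rewrite ge_min.
  by rewrite hs orbT.
by rewrite hr ?h0.
Qed.

(** When [Q] is a common denominator of the rational differences [d], the residue 1 makes
   [q * d] congruent to [d] modulo 1; when [Q] is even, it makes q odd. *)
Definition residue_one (Q X q : nat) : bool := [&& (X <= q)%N, (q < 2 * X)%N & (q == 1 %[mod Q])%N].

(** Rational [d] never resonate along [q = 1 %[mod Q]]. For irrational [d], two resonant
   values of q differ by [Q * h] with [(Q * h) * d] close to an integer, which forces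
   [h >= H]: resonant values are [Q * H]-separated. *)
Lemma resonant_count (ds : seq R) (H : nat) : (0 < H)%N ->
  (forall d, d \in ds -> forall m : int, d <> m%:~R) ->
  exists (Q : nat) (rho : R), [/\ (0 < Q)%N, ~~ odd Q, 0 < rho &
    forall X, (0 < X)%N ->
     #|[set q : 'I_(2 * X) | residue_one Q X q && ~~ `[< nonresonant ds rho q >]]|%:R
        <= (size ds)%:R * (X%:R / (Q * H)%:R + 1) :> R].
Proof.
move=> H0 nint; have [Q0 Q00 hQ] := common_denominator ds.
pose Q := (2 * Q0)%N; have Qpos : (0 < Q)%N by rewrite muln_gt0.
suff [rho rho0 hrho] : exists2 rho, 0 < rho & forall X, (0 < X)%N ->
     #|[set q : 'I_(2 * X) | residue_one Q X q && ~~ `[< nonresonant ds rho q >]]|%:R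
        <= (size ds)%:R * (X%:R / (Q * H)%:R + 1) :> R.
  by exists Q, rho; rewrite /Q oddM.
elim: ds nint hQ => [|d ds IH] nint hQ.
  exists 1 => // X X0; rewrite mul0r (_ : [set q | _] = finset.set0) ?cards0//.
  by apply/setP => q; rewrite !inE; apply/negP => /andP[_ /negP]; apply; apply/asboolP.
have [||r r0 hr] := IH.
- by move=> e eds; apply: nint; rewrite inE eds orbT.
- by move=> e eds; apply: hQ; rewrite inE eds orbT.
suff [s s0 hs] : exists2 s, 0 < s & forall X, (0 < X)%N ->
     #|[set q : 'I_(2 * X) | residue_one Q X q && ~~ `[< nonresonant [:: d] s q >]]|%:R
        <= X%:R / (Q * H)%:R + 1 :> R.
  exists (Num.min r s); first by rewrite lt_min r0.
  move=> X X0; rewrite /= -natr1 mulrDl mul1r.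
  apply: le_trans (lerD (hr X X0) (hs X X0)); rewrite -natrD ler_nat.
  apply: leq_trans (leq_card_setU _ _); apply: subset_leq_card.
  apply/fintype.subsetP => q; rewrite !inE => /andP[-> /=] nr.
  rewrite -negb_and; apply: contra nr => /andP[/asboolP h1 /asboolP h2].
  apply/asboolP => e; rewrite inE => /orP[/eqP ->|eds] m; rewrite ge_min.
    by rewrite (h2 d) ?orbT// inE.
  by rewrite h1.
have dd : d \in d :: ds by rewrite inE eqxx.
have [[m hm]|irr] := hQ d dd.
  have [s s0 hs] := dist_int_pos (nint d dd).
  exists s => // X X0; rewrite (_ : [set q | _] = finset.set0) ?cards0 ?addr_ge0 ?divr_ge0//.
  apply/setP => q; rewrite !inE; apply/negP => /andP[/and3P[Xq qX q1] /negP]; apply; apply/asboolP.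
  move=> e; rewrite inE => /eqP -> m'.
  have q0 : (0 < q)%N by apply: leq_trans Xq.
  have [t qE] : exists t, (q : nat) = (1 + Q * t)%N.
    have : (Q %| q - 1)%N by rewrite -eqn_mod_dvd.
    by move=> /dvdnP[t ht]; exists t; rewrite (mulnC Q) -ht addnC subnK.
  have -> : q%:R * d - m'%:~R = d - (m' - 2 * t%:Z * m)%:~R.
    rewrite qE natrD natrM /Q natrM !rmorphB/= !rmorphM/= -hm; ring.
  exact: hs.
have [s s0 hs] := irrational_gap H Qpos irr.
exists (s / 2); first by rewrite divr_gt0.
move=> X X0.
have -> : X%:R / (Q * H)%:R = ((2 * X)%:R - X%:R) / (Q * H)%:R :> R by rewrite natrM; congr (_ / _); ring.
apply: (@card_separated _ _ (fun q : 'I_(2 * X) => q%:R)).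
- by rewrite ltr0n muln_gt0 Qpos.
- by rewrite ler_nat leq_pmull.
- by move=> q; rewrite inE => /andP[/and3P[Xq qX _] _]; rewrite !ler_nat Xq ltnW.
move=> q1 q2; wlog q12 : q1 q2 / (q1 < q2)%N.
  move=> Hw a1 a2 ne; case: (ltngtP q1 q2) => [lt|lt|/val_inj E].
  - exact: Hw.
  - by rewrite distrC; apply: Hw => //; rewrite eq_sym.
  - by rewrite E eqxx in ne.
rewrite !inE => /andP[/and3P[X1 X1' m1] r1] /andP[/and3P[X2 X2' m2] r2] _.
have {}r1 : exists m : int, `|q1%:R * d - m%:~R| < s / 2.
  apply: contrapT => n; move/negP: r1; apply; apply/asboolP => e; rewrite inE => /eqP -> m.
  by rewrite leNgt; apply/negP => lt; apply: n; exists m.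
have {}r2 : exists m : int, `|q2%:R * d - m%:~R| < s / 2.
  apply: contrapT => n; move/negP: r2; apply; apply/asboolP => e; rewrite inE => /eqP -> m.
  by rewrite leNgt; apply/negP => lt; apply: n; exists m.
have [n1 h1] := r1; have [n2 h2] := r2.
have [h hE] : exists h, (q2 - q1 = Q * h)%N.
  have : (Q %| q2 - q1)%N by rewrite -eqn_mod_dvd ?(ltnW q12)// (eqP m1) (eqP m2).
  by move=> /dvdnP[h ->]; exists h; rewrite (mulnC Q).
have hH : (H <= h)%N.
  rewrite leqNgt; apply/negP => hlt.
  have h0 : (0 < h)%N by case: h hE hlt => // ; rewrite muln0; lia.
  have := hs h; rewrite h0 hlt => /(_ isT (n2 - n1)); rewrite -hE natrB ?(ltnW q12)//.
  apply/negP; rewrite -ltNge rmorphB/=.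
  have -> : (q2%:R - q1%:R) * d - (n2%:~R - n1%:~R) = (q2%:R * d - n2%:~R) - (q1%:R * d - n1%:~R) by ring.
  by apply: (le_lt_trans (ler_normB _ _)); lra.
rewrite distrC ger0_norm ?subr_ge0 ?ler_nat ?(ltnW q12)//.
by rewrite -natrB ?(ltnW q12)// ler_nat hE leq_pmul2l.
Qed.

End Counting.

(** * Counting reduced fractions *)

Local Notation pair_set X := {set 'I_(2 * X) * 'I_(2 * X)}.

Section FractionCount.
Context {R : realType}.
Local Close Scope classical_set_scope.
Local Open Scope set_scope.
Implicit Types (u v : R).

Definition in_window u v (p q : nat) : bool := (u * q%:R <= p%:R <= v * q%:R).

Lemma residue_count_ge (Q X : nat) : (1 < Q)%N ->
  X%:R / Q%:R - 2 <= #|[set q : 'I_(2 * X) | residue_one Q X q]|%:R :> R.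
Proof.
move=> Q1; have Q0 : (0 < Q)%N by apply: ltnW.
have QR : 0 < Q%:R :> R by rewrite ltr0n.
apply: (@le_trans _ _ ((X %/ Q).-1)%:R).
  have := ltn_ceil X Q0; rewrite -(ltr_nat R) natrM -natr1 -ltr_pdivrMr// => h.
  case: (X %/ Q)%N h => [|k] /= h; first by lra.
  by rewrite -natr1 in h; lra.
rewrite ler_nat; apply: (@card_progression_ge _ _ (1 + Q * (X %/ Q).+1) Q) => // i hi.
have XQ : (Q * (X %/ Q) <= X)%N by rewrite mulnC leq_trunc_div.
have lt2 : (1 + Q * (X %/ Q).+1 + Q * i < 2 * X)%N by nia.
exists (Ordinal lt2) => //; rewrite inE /residue_one lt2 /=; apply/andP; split.
  by have := ltn_ceil X Q0; rewrite mulnC => ?; lia.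
by rewrite -addnA -mulnDr (mulnC Q) eq_sym addnC modnMDl.
Qed.

Lemma window_count_ge u v (X q : nat) : 0 < u -> u < v -> v < 1 -> (0 < q < 2 * X)%N ->
  (v - u) * q%:R - 1 <= #|[set p : 'I_(2 * X) | in_window u v p q]|%:R.
Proof.
move=> u0 uv v1 /andP[q0 qX]; have qR : 0 < q%:R :> R by rewrite ltr0n.
have := truncn_itv (ltW (mulr_gt0 u0 qR)); set a := Num.truncn _ => ha.
have v0 : 0 < v by lra.
have := truncn_itv (ltW (mulr_gt0 v0 qR)); set b := Num.truncn _ => hb.
have ab : (a <= b)%N by apply: le_truncn; rewrite ler_pM2r// ltW.
apply: (@le_trans _ _ (b - a)%:R).
  by rewrite natrB//; move: ha hb; rewrite -!natr1; lra.
rewrite ler_nat; apply: (@card_progression_ge _ _ a.+1 1) => // i hi; rewrite mul1n.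
have bq : (b < q)%N.
  by rewrite -(ltr_nat R); case/andP: hb => h _; apply: (le_lt_trans h); rewrite gtr_pMl.
have lt2 : (a.+1 + i < 2 * X)%N by clear -hi ab bq qX; lia.
exists (Ordinal lt2) => //; rewrite inE /in_window /=.
have ib : (a.+1 + i)%:R <= b%:R :> R by rewrite ler_nat; clear -hi ab; lia.
have ia : a.+1%:R <= (a.+1 + i)%:R :> R by rewrite ler_nat leq_addr.
by apply/andP; split; lra.
Qed.

Lemma residue_dvd_count (Q X l : nat) : (0 < Q)%N -> (0 < l)%N ->
  #|[set q : 'I_(2 * X) | residue_one Q X q && (l %| q)%N]|%:R <= X%:R / (Q * l)%:R + 1 :> R.
Proof.
move=> Q0 l0.
have -> : X%:R / (Q * l)%:R = ((2 * X)%:R - X%:R) / (Q * l)%:R :> R by rewrite natrM; congr (_ / _); ring.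
apply: (@card_separated _ _ _ (fun q : 'I_(2 * X) => q%:R)).
- by rewrite ltr0n muln_gt0 Q0.
- by rewrite ler_nat leq_pmull.
- by move=> q; rewrite inE => /andP[/and3P[Xq qX _] _]; rewrite !ler_nat Xq ltnW.
move=> q1 q2; wlog q12 : q1 q2 / (q1 < q2)%N.
  move=> Hw a1 a2 ne; case: (ltngtP q1 q2) => [lt|lt|/val_inj E].
  - exact: Hw.
  - by rewrite distrC; apply: Hw => //; rewrite eq_sym.
  - by rewrite E eqxx in ne.
rewrite !inE => /andP[/and3P[X1 X1' m1] r1] /andP[/and3P[X2 X2' m2] r2] _.
have cop : coprime Q l.
  apply: (coprime_dvdr r1); rewrite coprime_sym -coprime_modl (eqP m1) coprime_modl.
  exact: coprime1n.
have d1 : (Q %| q2 - q1)%N by rewrite -eqn_mod_dvd ?(ltnW q12)// (eqP m1) (eqP m2).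
have d2 : (l %| q2 - q1)%N by apply: dvdn_sub.
have : (Q * l %| q2 - q1)%N by rewrite Gauss_dvd// d1.
move=> /dvdn_leq; rewrite subn_gt0 => /(_ q12).
by rewrite distrC -natrB ?(ltnW q12)// normr_nat ler_nat.
Qed.

Lemma window_dvd_count u v (X q l : nat) : u < v -> (0 < l)%N -> (q < 2 * X)%N ->
  #|[set p : 'I_(2 * X) | in_window u v p q && (l %| p)%N]|%:R <= (v - u) * (2 * X)%:R / l%:R + 1.
Proof.
move=> uv l0 qX; have lR : 0 < l%:R :> R by rewrite ltr0n.
apply: (@le_trans _ _ ((v * q%:R - u * q%:R) / l%:R + 1)); last first.
  rewrite lerD2r ler_pM2r ?invr_gt0// -mulrBl ler_wpM2l ?subr_ge0 ?(ltW uv)//.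
  by rewrite ler_nat ltnW.
apply: (@card_separated _ _ _ (fun p : 'I_(2 * X) => p%:R)) => //.
- by rewrite ler_wpM2r// ltW.
- by move=> p; rewrite inE => /andP[].
move=> q1 q2; wlog q12 : q1 q2 / (q1 < q2)%N.
  move=> Hw a1 a2 ne; case: (ltngtP q1 q2) => [lt|lt|/val_inj E].
  - exact: Hw.
  - by rewrite distrC; apply: Hw => //; rewrite eq_sym.
  - by rewrite E eqxx in ne.
rewrite !inE => /andP[_ r1] /andP[_ r2] _.
have d2 : (l %| q2 - q1)%N by apply: dvdn_sub.
move: d2 => /dvdn_leq; rewrite subn_gt0 => /(_ q12).
by rewrite distrC -natrB ?(ltnW q12)// normr_nat ler_nat.
Qed.

Lemma sum_odd_inv_sqr (n : nat) : \sum_(1 <= i < n.+1) 1 / (2 * i + 1)%:R ^+ 2 <= 1 / 4 :> R.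
Proof.
suff : \sum_(1 <= i < n.+1) 1 / (2 * i + 1)%:R ^+ 2 <= 1 / 4 * (1 - 1 / n.+1%:R) :> R.
  have : 0 <= 1 / n.+1%:R :> R by rewrite divr_ge0.
  by move: (1 / n.+1%:R) (\sum_(_ <= _ < _) _) => z s; lra.
elim: n => [|n IH]; first by rewrite big_geq// divr1 subrr mulr0.
rewrite big_nat_recr//=; apply: (le_trans (lerD IH (lexx _))).
have n1 : 0 < n.+1%:R :> R by rewrite ltr0n.
have n2 : 0 < n.+2%:R :> R by rewrite ltr0n.
have n3 : 0 < (2 * n.+1 + 1)%:R :> R by rewrite ltr0n addn1.
have -> : n.+2%:R = n.+1%:R + 1 :> R by rewrite -natr1.
rewrite -lerBrDl.
have -> : 1 / 4 * (1 - 1 / (n.+1%:R + 1)) - 1 / 4 * (1 - 1 / n.+1%:R) =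
   1 / (4 * n.+1%:R * (n.+1%:R + 1)) :> R.
  by field; rewrite gt_eqF//= gt_eqF// ltr_wpDl.
have pos1 : 0 < 4 * n.+1%:R * (n.+1%:R + 1) :> R by rewrite !mulr_gt0// ltr_wpDl.
have pos2 : 0 < (2 * n.+1 + 1)%:R ^+ 2 :> R by rewrite exprn_gt0.
rewrite !mul1r (lef_pV2 pos2 pos1) natrD natrM expr2; nra.
Qed.

(** As q is odd, a common divisor other than 1 gives one of the form 2 i + 1 >= 3. The inverse
   squares of these sum to at most 1 / 4, so non-coprime pairs are a minority. *)
Lemma noncoprime_count u v (Q X : nat) : 0 < u -> u < v -> v < 1 -> (0 < Q)%N -> ~~ odd Q ->
  #|[set pq : 'I_(2 * X) * 'I_(2 * X) |
      [&& residue_one Q X pq.2, in_window u v pq.1 pq.2 & ~~ coprime pq.1 pq.2]]|%:R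
   <= 9 * (v - u) * X%:R ^+ 2 / (16 * Q%:R) + X%:R * (1 + 9 * Q%:R / (v - u)).
Proof.
move=> u0 uv v1 Q0 oQ; set w := v - u; have w0 : 0 < w by rewrite subr_gt0.
have w1 : w < 1 by rewrite /w; lra.
have QR : 1 <= Q%:R :> R by rewrite ler1n.
pose N (i : nat) : pair_set X :=
  [set pq : 'I_(2 * X) * 'I_(2 * X) | (residue_one Q X pq.2 && (2 * i + 1 %| pq.2)) && (in_window u v pq.1 pq.2 && (2 * i + 1 %| pq.1))]%N.
have cov : (#|[set pq : 'I_(2 * X) * 'I_(2 * X) |
      [&& residue_one Q X pq.2, in_window u v pq.1 pq.2 & ~~ coprime pq.1 pq.2]]|
   <= \sum_(i <- index_iota 1 X) #|N i|)%N.
  apply: card_cover_le => -[p q]; rewrite inE /= => /and3P[rq iw nc].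
  have /and3P[Xq qX q1] := rq.
  have pR : 0 < p%:R :> R.
    case/andP: iw => h _; apply: lt_le_trans h; rewrite mulr_gt0// ltr0n.
    apply: leq_trans Xq; have := ltn_ord q; clear; lia.
  have p0 : (0 < p)%N by rewrite -(ltr_nat R).
  have oq : odd q.
    have : odd ((q : nat) %% Q) = odd (1 %% Q) by rewrite (eqP q1).
    by rewrite !odd_mod// (negbTE oQ).
  pose g := gcdn p q; have g0 : (0 < g)%N by rewrite gcdn_gt0 p0.
  have og : odd g by apply: dvdn_odd oq; apply: dvdn_gcdr.
  have gp : (g <= p)%N by apply: dvdn_leq => //; apply: dvdn_gcdl.
  have g1 : g != 1%N by [].
  have pX := ltn_ord p.
  have gE : g = (2 * g./2 + 1)%N by rewrite -{1}(odd_double_half g) og addnC -mul2n.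
  exists g./2.
    rewrite mem_index_iota; move: gE g1 gp pX; move: (g./2) => h.
    by clear; move=> *; lia.
  by rewrite inE /= -gE rq iw !dvdn_gcdl !dvdn_gcdr.
have Nb (i : nat) : (0 < i)%N -> #|N i|%:R <=
    (X%:R / (Q * (2 * i + 1))%:R + 1) * (w * (2 * X)%:R / (2 * i + 1)%:R + 1) :> R.
  move=> i0; have l0 : (0 < 2 * i + 1)%N by rewrite addn1.
  rewrite card_fibers natr_sum.
  apply: (@le_trans _ _ (\sum_(q in [set q : 'I_(2 * X) | residue_one Q X q && (2 * i + 1 %| q)%N])
     (w * (2 * X)%:R / (2 * i + 1)%:R + 1))).
    rewrite [leRHS]big_mkcond; apply: ler_sum => q _; rewrite inE.
    case: ifP => hq.
      apply: le_trans (window_dvd_count uv l0 (ltn_ord q)).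
      rewrite ler_nat; apply: subset_leq_card; apply/fintype.subsetP => p.
      by rewrite !inE /= hq.
    rewrite (_ : [set _ | _] = finset.set0) ?cards0//.
    by apply/setP => p; rewrite !inE /= hq.
  rewrite sumr_const -[leLHS]mulr_natl; apply: ler_wpM2r.
    by rewrite addr_ge0// divr_ge0// mulr_ge0// ltW.
  exact: residue_dvd_count.
have term (i : nat) : (0 < i)%N -> #|N i|%:R <=
    9 * w * X%:R ^+ 2 / (4 * Q%:R) * (1 / (2 * i + 1)%:R ^+ 2) + (1 + 9 * Q%:R / w) :> R.
  move=> i0; apply: (le_trans (Nb _ i0)).
  have lR : 0 < (2 * i + 1)%:R :> R by rewrite ltr0n addn1.
  rewrite !natrM; set l := (2 * i + 1)%:R in lR *.
  set t := X%:R / l.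
  have t0 : 0 <= t by rewrite divr_ge0// ltW.
  have -> : X%:R / (Q%:R * l) = t / Q%:R by rewrite /t; field; rewrite !gt_eqF//; lra.
  have -> : w * (2 * X%:R) / l = 2 * w * t by rewrite /t; ring.
  have -> : 9 * w * X%:R ^+ 2 / (4 * Q%:R) * (1 / l ^+ 2) = 9 * w / (4 * Q%:R) * t ^+ 2.
    by rewrite /t; field; rewrite !gt_eqF//; lra.
  have tQ : t / Q%:R <= t by rewrite ler_pdivrMr ?ler_peMr//; lra.
  have wt : 2 * w * t <= 2 * t by rewrite ler_wpM2r//; lra.
  have -> : (t / Q%:R + 1) * (2 * w * t + 1) =
     2 * w / Q%:R * t ^+ 2 + (t / Q%:R + 2 * w * t) + 1 by field; lra.
  (* the linear terms in t are absorbed by a small multiple of t ^ 2 *)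
  have amgm : 3 * t <= w / (4 * Q%:R) * t ^+ 2 + 9 * Q%:R / w.
    have : 0 <= (t * w - 6 * Q%:R) ^+ 2 / (4 * Q%:R * w).
      by rewrite divr_ge0 ?sqr_ge0// !mulr_ge0// ltW//; lra.
    have -> : (t * w - 6 * Q%:R) ^+ 2 / (4 * Q%:R * w) =
       w / (4 * Q%:R) * t ^+ 2 + 9 * Q%:R / w - 3 * t by field; lra.
    by lra.
  have -> : 9 * w / (4 * Q%:R) * t ^+ 2 = 2 * w / Q%:R * t ^+ 2 + w / (4 * Q%:R) * t ^+ 2 by field; lra.
  by lra.
move: cov; rewrite -(ler_nat R) natr_sum => cov; apply: (le_trans cov).
apply: (@le_trans _ _ (\sum_(1 <= i < X.+1) (9 * w * X%:R ^+ 2 / (4 * Q%:R) * (1 / (2 * i + 1)%:R ^+ 2) + (1 + 9 * Q%:R / w)))).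
  have pos (i : nat) : 0 <= 9 * w * X%:R ^+ 2 / (4 * Q%:R) * (1 / (2 * i + 1)%:R ^+ 2) + (1 + 9 * Q%:R / w) :> R.
    have w0' := ltW w0.
    apply: addr_ge0; last by rewrite addr_ge0// divr_ge0// mulr_ge0.
    by apply: mulr_ge0; [apply: divr_ge0; rewrite ?mulr_ge0 ?exprn_ge0|rewrite divr_ge0 ?exprn_ge0].
  apply: (@le_trans _ _ (\sum_(1 <= i < X) (9 * w * X%:R ^+ 2 / (4 * Q%:R) * (1 / (2 * i + 1)%:R ^+ 2) + (1 + 9 * Q%:R / w)))).
    by apply: ler_sum_nat => i /andP[i0 _]; apply: term.
  have [X0|X0] := posnP X; first by rewrite [leLHS]big_geq; [apply: sumr_ge0 => i _; exact: pos|rewrite X0].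
  by rewrite [leRHS]big_nat_recr//= lerDl; exact: pos.
rewrite big_split/= -mulr_sumr sumr_const_nat subn1/= -[X in _ + X <= _]mulr_natl lerD//.
have -> : 9 * w * X%:R ^+ 2 / (16 * Q%:R) = 9 * w * X%:R ^+ 2 / (4 * Q%:R) * (1 / 4) by field; lra.
rewrite ler_wpM2l ?sum_odd_inv_sqr//.
by rewrite divr_ge0 ?mulr_ge0 ?exprn_ge0 ?(ltW w0).
Qed.

Definition good_fractions (ds : seq R) rho (Q : nat) u v (X : nat) : pair_set X :=
  [set pq : 'I_(2 * X) * 'I_(2 * X) | [&& residue_one Q X pq.2, `[< nonresonant ds rho pq.2 >],
                in_window u v pq.1 pq.2 & coprime pq.1 pq.2]].

(** Among the pairs with q = 1 mod Q and p / q in the window, about w X^2 / Q at least,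
   resonances remove a sixteenth and common factors nine sixteenths; lower order terms are
   below two sixteenths for large X, which leaves a quarter. *)
Lemma many_good_fractions (ds : seq R) : (forall d, d \in ds -> forall m : int, d <> m%:~R) ->
  exists (Q : nat) rho, [/\ (0 < Q)%N, 0 < rho &
    forall u v, 0 < u -> u < v -> v < 1 -> exists X0 : nat, forall X, (X0 <= X)%N ->
      (v - u) * X%:R ^+ 2 / (4 * Q%:R) <= #|good_fractions ds rho Q u v X|%:R].
Proof.
move=> nint; pose H := (16 * (size ds).+1)%N.
have [//|Q [rho [Q0 oQ rho0 hres]]] := @resonant_count R ds H _ nint.
exists Q, rho; split=> // u v u0 uv v1; set w := v - u; have w0 : 0 < w by rewrite subr_gt0.
have w1 : w < 1 by rewrite /w; lra.
have Q1 : (1 < Q)%N by case: Q Q0 oQ {hres} => [|[|]].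
have QR : 1 <= Q%:R :> R by rewrite ler1n.
pose sd : R := (size ds)%:R; have sd0 : 0 <= sd by rewrite ler0n.
pose K := (3 + sd + 9 * Q%:R / w + 2) * (8 * Q%:R / w) + 1 / w + 32 * Q%:R * (3 + sd).
exists (Num.truncn K).+1 => X hX.
have XK : K < X%:R by apply: lt_le_trans (truncnS_gt K) _; rewrite ler_nat.
have XR0 : 0 <= X%:R :> R by [].
have QR0 : 0 <= Q%:R :> R by [].
have w0' := ltW w0.
have a0 : 0 <= 9 * Q%:R / w by rewrite divr_ge0// mulr_ge0.
have b0 : 0 <= 8 * Q%:R / w by rewrite divr_ge0// mulr_ge0.
have ab0 : 0 <= (3 + sd + 9 * Q%:R / w + 2) * (8 * Q%:R / w) by apply: mulr_ge0 => //; lra.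
have c0 : 0 <= 32 * Q%:R * (3 + sd) by apply: mulr_ge0; [rewrite mulr_ge0|lra].
have d0 : 0 <= 1 / w by rewrite divr_ge0.
have K0 : 0 <= K by rewrite /K; lra.
have X0 : (0 < X)%N by rewrite -(ltr_nat R); apply: le_lt_trans XK.
pose G := [set q : 'I_(2 * X) | residue_one Q X q && `[< nonresonant ds rho q >]].
have cG : X%:R / Q%:R * (15 / 16) - (2 + sd) <= #|G|%:R.
  have h1 := residue_count_ge X Q1.
  have h2 := hres X X0.
  have h3 : (#|[set q : 'I_(2 * X) | residue_one Q X q]| <= #|G| +
    #|[set q : 'I_(2 * X) | residue_one Q X q && ~~ `[< nonresonant ds rho q >]]|)%N.
    apply: leq_trans (leq_card_setU _ _); apply: subset_leq_card.
    by apply/fintype.subsetP => q; rewrite !inE => ->; case: asboolP.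
  rewrite -(ler_nat R) natrD in h3.
  have h4 : sd * (X%:R / (Q * H)%:R + 1) <= X%:R / Q%:R * (1 / 16) + sd.
    rewrite mulrDr mulr1 lerD2r /H !natrM -[(size ds).+1%:R]natr1 -/sd.
    have -> : sd * (X%:R / (Q%:R * (16%:R * (sd + 1)))) = X%:R / Q%:R * (1 / 16) * (sd / (sd + 1)).
      by field; lra.
    rewrite ler_piMr ?mulr_ge0 ?invr_ge0//.
    by rewrite ler_pdivrMr; lra.
  by move: h2; rewrite -/sd => h2; lra.
pose T := [set pq : 'I_(2 * X) * 'I_(2 * X) | (pq.2 \in G) && in_window u v pq.1 pq.2].
have cT : #|G|%:R * (w * X%:R - 1) <= #|T|%:R.
  rewrite card_fibers natr_sum.
  apply: (@le_trans _ _ (\sum_(q in G) (w * X%:R - 1))).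
    by rewrite sumr_const -[leRHS]mulr_natl.
  rewrite big_mkcond; apply: ler_sum => q _; case: ifP => // qG.
  have /andP[/and3P[Xq qX _] _] : residue_one Q X q && `[< nonresonant ds rho q >] by rewrite inE in qG.
  apply: (@le_trans _ _ (w * q%:R - 1)).
    by rewrite lerD2r ler_wpM2l ?(ltW w0)// ler_nat.
  have q0 : (0 < q < 2 * X)%N by rewrite qX (leq_trans X0).
  apply: (le_trans (window_count_ge u0 uv v1 q0)).
  rewrite ler_nat; apply: subset_leq_card; apply/fintype.subsetP => p.
  by move: qG; rewrite !inE /= => ->.
have cNC := noncoprime_count X u0 uv v1 Q0 oQ.
set NC := [set pq | _] in cNC.
have cTN : (#|T| <= #|good_fractions ds rho Q u v X| + #|NC|)%N.
  apply: leq_trans (leq_card_setU _ _); apply: subset_leq_card.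
  apply/fintype.subsetP => -[p q]; rewrite !inE /= => /andP[/andP[-> ->] ->] /=.
  by case: coprime.
rewrite -(ler_nat R) natrD in cTN; rewrite -/w in cNC.
have wX : 1 <= w * X%:R.
  have : 1 / w <= X%:R.
    by apply: le_trans (ltW XK); rewrite /K; lra.
  by rewrite ler_pdivrMr// mulrC.
have cGT : (X%:R / Q%:R * (15 / 16) - (2 + sd)) * (w * X%:R - 1) <= #|T|%:R.
  by apply: le_trans cT; apply: ler_wpM2r => //; lra.
have big : X%:R * (3 + sd + 9 * Q%:R / w + 2) <= w * X%:R ^+ 2 / (8 * Q%:R).
  have h : (3 + sd + 9 * Q%:R / w + 2) * (8 * Q%:R / w) <= X%:R.
    by apply: le_trans (ltW XK); rewrite /K; lra.
  have -> : w * X%:R ^+ 2 / (8 * Q%:R) = X%:R * (X%:R * (w / (8 * Q%:R))) by ring.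
  rewrite ler_wpM2l//.
  have wq : 0 < w / (8 * Q%:R) by rewrite divr_gt0//; lra.
  rewrite -ler_pdivrMr//.
  by have -> : (w / (8 * Q%:R))^-1 = 8 * Q%:R / w by field; lra.
have e1 : (X%:R / Q%:R * (15 / 16) - (2 + sd)) * (w * X%:R - 1) =
   15 * w * X%:R ^+ 2 / (16 * Q%:R) - X%:R / Q%:R * (15 / 16) - (2 + sd) * w * X%:R + (2 + sd).
  by field; lra.
have e2 : 15 * w * X%:R ^+ 2 / (16 * Q%:R) = 9 * w * X%:R ^+ 2 / (16 * Q%:R) +
   w * X%:R ^+ 2 / (8 * Q%:R) + w * X%:R ^+ 2 / (4 * Q%:R) by field; lra.
have e3 : X%:R / Q%:R * (15 / 16) <= X%:R :> R.
  have : X%:R / Q%:R <= X%:R :> R by rewrite ler_pdivrMr ?ler_peMr//; lra.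
  have : 0 <= X%:R / Q%:R :> R by rewrite divr_ge0.
  lra.
have e4 : (2 + sd) * w * X%:R <= (2 + sd) * X%:R.
  by rewrite ler_wpM2r// ler_piMr ?(ltW w1)// addr_ge0.
move: cGT; rewrite e1 e2; move: cNC; rewrite mulrDr => cNC cGT.
have e5 : X%:R * (3 + sd + 9 * Q%:R / w + 2) = (2 + sd) * X%:R + 3 * X%:R + X%:R * (9 * Q%:R / w) by ring.
rewrite e5 in big.
by lra.
Qed.

End FractionCount.

(** * Intervals around fractions *)

Section FractionGeometry.
Context {R : realType}.
Implicit Types (u v : R).

Definition quot (pq : nat * nat) : R := pq.1%:R / pq.2%:R.

Lemma quot_separated (p q p' q' : nat) : (0 < q)%N -> (0 < q')%N ->
  coprime p q -> coprime p' q' -> (p, q) != (p', q') ->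
  1 / (q%:R * q'%:R) <= `|quot (p, q) - quot (p', q')|.
Proof.
move=> q0 q0' cop cop' ne.
have qR : 0 < q%:R :> R by rewrite ltr0n.
have qR' : 0 < q'%:R :> R by rewrite ltr0n.
have ne' : (p * q' != p' * q)%N.
  apply: contraNneq ne => E.
  have d1 : (q %| q')%N by rewrite -(Gauss_dvdr _ (m:=q) (n:=p)) 1?coprime_sym// E dvdn_mull.
  have d2 : (q' %| q)%N by rewrite -(Gauss_dvdr _ (m:=q') (n:=p')) 1?coprime_sym// -E dvdn_mull.
  have qq : q = q' by apply/eqP; rewrite eqn_dvd d1.
  by move: E; rewrite qq => /eqP; rewrite eqn_pmul2r// => /eqP ->.
have -> : quot (p, q) - quot (p', q') = ((p * q')%:R - (p' * q)%:R) / (q%:R * q'%:R).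
  by rewrite /quot /= !natrM; field; rewrite !gt_eqF.
rewrite normrM [`|_^-1|]gtr0_norm ?invr_gt0 ?mulr_gt0//.
rewrite ler_pM2r ?invr_gt0 ?mulr_gt0//.
have [lt|lt|eq] := ltngtP (p * q')%N (p' * q)%N; last by rewrite eq eqxx in ne'.
  by rewrite distrC -natrB ?(ltnW lt)// normr_nat ler1n subn_gt0.
by rewrite -natrB ?(ltnW lt)// normr_nat ler1n subn_gt0.
Qed.

Definition fraction_family (X : nat) u v (G : pair_set X) : Prop :=
  forall pq : 'I_(2 * X) * 'I_(2 * X), pq \in G ->
    [/\ (X <= pq.2)%N, coprime pq.1 pq.2 & u <= quot (nat_of_ord pq.1, nat_of_ord pq.2) <= v].

Definition fraction (X : nat) (pq : 'I_(2 * X) * 'I_(2 * X)) : R :=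
  quot (nat_of_ord pq.1, nat_of_ord pq.2).

Lemma family_separated (X : nat) u v G : (0 < X)%N -> @fraction_family X u v G ->
  forall a b, a \in G -> b \in G -> a != b -> 1 / (4 * X%:R ^+ 2) <= `|fraction a - fraction b|.
Proof.
move=> X0 hG [p q] [p' q'] a b ab.
have [/= h1 h2 _] := hG _ a; have [/= h1' h2' _] := hG _ b.
have q0 : (0 < q)%N by apply: leq_trans h1.
have q0' : (0 < q')%N by apply: leq_trans h1'.
have qR : 0 < q%:R :> R by rewrite ltr0n.
have qR' : 0 < q'%:R :> R by rewrite ltr0n.
apply: (@le_trans _ _ (1 / (q%:R * q'%:R))); last first.
  apply: quot_separated => //; apply: contra ab => /eqP[/val_inj -> /val_inj ->]//.
rewrite !mul1r lef_pV2 ?posrE ?mulr_gt0 ?exprn_gt0 ?ltr0n//.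
have := ltn_ord q; have := ltn_ord q'; rewrite -!(ltr_nat R) !natrM => k1 k2.
have -> : 4 * X%:R ^+ 2 = (2 * X%:R) * (2 * X%:R) :> R by ring.
by apply: ler_pM; rewrite // ltW.
Qed.

Lemma family_card_le (X : nat) u v (G : pair_set X) : (0 < X)%N -> u <= v ->
  fraction_family u v G -> #|G|%:R <= (v - u) * (4 * X%:R ^+ 2) + 1.
Proof.
move=> X0 uv hG; have XR : 0 < X%:R :> R by rewrite ltr0n.
have -> : (v - u) * (4 * X%:R ^+ 2) = (v - u) / (1 / (4 * X%:R ^+ 2)).
  by field; rewrite gt_eqF.
apply: (@card_separated _ _ _ (@fraction X)) => //.
- by rewrite divr_gt0// mulr_gt0// exprn_gt0.
- by move=> pq /hG[].
- exact: family_separated hG.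
Qed.

Definition balls (X : nat) (G : pair_set X) (r : R) : set R :=
  \big[setU/set0]_(pq <- enum G) ball (fraction pq) r.

Lemma ballsP X G r x : @balls X G r x <-> exists2 pq, pq \in G & `|fraction pq - x| < r.
Proof.
rewrite /balls -bigcup_seq; split.
  by move=> [pq /=]; rewrite mem_enum => pqG h; exists pq.
by move=> [pq pqG h]; exists pq => //=; rewrite mem_enum.
Qed.

Lemma balls_open X G r : open (@balls X G r).
Proof. by rewrite /balls; elim/big_ind : _ => [|A B oA oB|i _]; [exact: open0|exact: openU|by rewrite ball_itv; exact: interval_open]. Qed.

Lemma balls_measurable X G r : measurable (@balls X G r).
Proof. by apply: open_measurable; exact: balls_open. Qed.

Lemma balls_length (X : nat) u v (G : pair_set X) (r : R) : (0 < X)%N -> 0 < u -> v < 1 ->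
  fraction_family u v G -> 0 <= r -> r <= 1 / (8 * X%:R ^+ 2) ->
  unit_length (balls G r) = 2 * r * #|G|%:R.
Proof.
move=> X0 u0 v1 hG r0 rX; have XR : 0 < X%:R :> R by rewrite ltr0n.
rewrite /balls unit_length_bigU ?enum_uniq//; last 2 first.
- by move=> pq; exact: measurable_ball.
- move=> a b; rewrite !mem_enum => aG bG ab; rewrite -subset0 => x [] /=.
  rewrite /ball/= => h1 h2.
  have := family_separated X0 hG aG bG ab; apply/negP; rewrite -ltNge.
  have -> : fraction a - fraction b = (fraction a - x) - (fraction b - x) by ring.
  apply: (le_lt_trans (ler_normB _ _)); apply: lt_le_trans (ltrD h1 h2) _.
  have -> : 1 / (4 * X%:R ^+ 2) = 1 / (8 * X%:R ^+ 2) + 1 / (8 * X%:R ^+ 2) :> R.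
    by field; rewrite gt_eqF.
  exact: lerD.
rewrite (eq_big_seq (fun=> 2 * r)); last first.
  move=> [p q]; rewrite mem_enum => pG; have [/= h1 h2 h3] := hG _ pG.
  have q0 : (0 < q)%N by apply: leq_trans h1.
  have qR : 0 < q%:R :> R by rewrite ltr0n.
  rewrite /quot /= in h3.
  have q2 : q%:R <= 2 * X%:R :> R by rewrite -natrM ler_nat ltnW.
  have rq : r <= 1 / q%:R.
    apply: (le_trans rX); rewrite !mul1r lef_pV2 ?posrE ?mulr_gt0 ?exprn_gt0//.
    apply: (le_trans q2).
    have : 1 <= X%:R :> R by rewrite ler1n.
    by move: (X%:R : R) => t; nra.
  have p1 : 1 / q%:R <= p%:R / q%:R :> R.
    rewrite ler_pM2r ?invr_gt0// ler1n lt0n; apply/negP => /eqP p0.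
    by move: h3; rewrite p0 mul0r; lra.
  have pq1 : p%:R / q%:R <= 1 - 1 / q%:R :> R.
    rewrite lerBrDr -mulrDl ler_pdivrMr// mul1r natr1 ler_nat.
    rewrite -(ltr_nat R); rewrite -[ltRHS]mul1r -ltr_pdivrMr//; lra.
  by rewrite unit_length_ball//= /fraction /quot /=; lra.
rewrite big_const_seq count_predT -cardE iter_addr_0 -[X in X = _]mulr_natr.
by ring.
Qed.

(** A ball around p / q meets only balls around the fractions of [G'] within [2 * r] of it.
   These are separated from each other, and also from p / q, which is not in [G']; so their
   number is O(r X'^2), without an additive constant, and the overlap has the size expected
   of independent sets. *)
Lemma balls_overlap (X X' : nat) u v (G : pair_set X) (G' : pair_set X')
    (r r' : R) : (0 < X)%N -> (2 * X <= X')%N ->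
  fraction_family u v G -> fraction_family u v G' -> 0 < r' -> r' <= r ->
  unit_length (balls G r `&` balls G' r') <= #|G|%:R * (32 * r * X'%:R ^+ 2 * (2 * r')).
Proof.
move=> X0 XX hG hG' r0' rr.
have X0' : (0 < X')%N by lia.
have XR : 0 < X%:R :> R by rewrite ltr0n.
have XR' : 0 < X'%:R :> R by rewrite ltr0n.
have r0 : 0 < r by exact: lt_le_trans rr.
pose H (pq : 'I_(2 * X) * 'I_(2 * X)) : pair_set X' :=
  finset (fun a => (a \in G') && (`|fraction a - fraction pq| <= 2 * r)).
have mB pq : measurable (balls (H pq) r') by exact: balls_measurable.
apply: (@le_trans _ _ (unit_length (\big[setU/set0]_(pq <- enum G) balls (H pq) r'))).
  apply: unit_length_mono.
  - by apply: measurableI; exact: balls_measurable.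
  - by apply: bigsetU_measurable.
  - move=> x [[/ballsP[pq pqG h1] /ballsP[a aG h2]] _].
    rewrite -bigcup_seq; exists pq; first by rewrite /= mem_enum.
    apply/ballsP; exists a => //; rewrite inE aG /=.
    have -> : fraction a - fraction pq = (fraction a - x) - (fraction pq - x) by ring.
    by apply: (le_trans (ler_normB _ _)); lra.
apply: (le_trans (unit_length_bigU_le _ _ mB)).
have -> : #|G|%:R * (32 * r * X'%:R ^+ 2 * (2 * r')) = \sum_(pq <- enum G) (32 * r * X'%:R ^+ 2 * (2 * r')).
  by rewrite big_const_seq count_predT -cardE iter_addr_0 mulr_natl.
rewrite !big_seq; apply: ler_sum => pq; rewrite mem_enum => pqG.
have Hfam : fraction_family (fraction pq - 2 * r) (fraction pq + 2 * r) (H pq).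
  move=> a; rewrite inE => /andP[aG' ar]; have [h1 h2 _] := hG' _ aG'; split=> //.
  by move: ar; rewrite ler_norml /fraction => /andP[? ?]; apply/andP; split; lra.
apply: (@le_trans _ _ (#|H pq|%:R * (2 * r'))).
  rewrite /balls; apply: (le_trans (unit_length_bigU_le _ _ _)).
    by move=> a; exact: measurable_ball.
  apply: (@le_trans _ _ (\sum_(a <- enum (H pq)) 2 * r')).
    by apply: ler_sum => a _; apply: unit_length_ball_le; exact: ltW.
  by rewrite big_const_seq count_predT -cardE iter_addr_0 -[X in X <= _]mulr_natl.
rewrite ler_pM2r ?mulr_gt0//.
have [H0|] := boolP (H pq == finset.set0).
  by rewrite (eqP H0) cards0 mulr_ge0 ?exprn_ge0// mulr_ge0// ltW.
move=> /set0Pn[a]; rewrite inE => /andP[aG' ar].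
apply: (le_trans (family_card_le X0' _ Hfam)); first by lra.
have -> : fraction pq + 2 * r - (fraction pq - 2 * r) = 4 * r by ring.
(* the additive 1 of family_card_le is absorbed, because some fraction of G' is that close *)
suff : 1 <= 16 * r * X'%:R ^+ 2 by lra.
case: a pq aG' ar pqG {Hfam mB H} => [p' q'] [p q] aG' ar pqG.
have [/= h1 h2 _] := hG _ pqG; have [/= h1' h2' _] := hG' _ aG'.
have q0 : (0 < q)%N by apply: leq_trans h1.
have q0' : (0 < q')%N by apply: leq_trans h1'.
have lq := ltn_ord q; have lq' := ltn_ord q'.
have ne : (nat_of_ord p', nat_of_ord q') != (nat_of_ord p, nat_of_ord q).
  by apply/eqP => -[_ e]; move: h1'; rewrite e; clear -lq XX; lia.
have := le_trans (quot_separated q0' q0 h2' h2 ne) ar.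
have qR : 0 < q%:R :> R by rewrite ltr0n.
have qR' : 0 < q'%:R :> R by rewrite ltr0n.
rewrite ler_pdivrMr ?mulr_gt0// => k1.
have k2 : q%:R <= X'%:R :> R by rewrite ler_nat; clear -lq XX; lia.
have k3 : q'%:R <= 2 * X'%:R :> R by rewrite -natrM ler_nat ltnW.
apply: (le_trans k1).
have qq : q'%:R * q%:R <= 2 * (X'%:R * X'%:R) :> R by rewrite mulrA; apply: ler_pM.
have XX0 : 0 <= r * (X'%:R * X'%:R) by rewrite !mulr_ge0// ltW.
have := ler_wpM2l (ltW r0) qq; rewrite expr2; lra.
Qed.

(** Inclusion-exclusion truncated at pairwise intersections, for quasi-independent sets. *)
Lemma bonferroni_union (E : nat -> set R) (r : nat -> R) (k0 : nat) (a b : R) : 0 <= b ->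
  (forall k, 0 <= r k) ->
  (forall k, measurable (E k)) ->
  (forall k, (k0 <= k)%N -> a * r k <= unit_length (E k)) ->
  (forall k k', (k0 <= k < k')%N -> unit_length (E k `&` E k') <= b * r k * r k') ->
  forall k1, let s := \sum_(k0 <= k < k1) r k in
    a * s - b * s ^+ 2 <= unit_length (\big[setU/set0]_(k0 <= k < k1) E k).
Proof.
move=> b0 r0 mE hE hEE; elim=> [|k1 IH] /=.
  by rewrite !big_geq// unit_length0 mulr0 expr0n/= mulr0 subr0.
have [k1k0|k0k1] := ltnP k1 k0.
  by rewrite !big_geq// unit_length0 mulr0 expr0n/= mulr0 subr0.
rewrite !big_nat_recr//=; set s := \sum_(k0 <= k < k1) r k.
set U := \big[setU/set0]_(k0 <= k < k1) E k.
have mU : measurable U by apply: bigsetU_measurable.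
have := unit_lengthU mU (mE k1).
have : unit_length (U `&` E k1) <= b * s * r k1.
  rewrite /U big_distrl/= /s mulr_sumr mulr_suml.
  apply: (le_trans (unit_length_bigU_le _ _ _)); first by move=> k; exact: measurableI.
  by apply: ler_sum_nat => k kk; apply: hEE.
have := hE _ k0k1; have := IH; rewrite /= -/s -/U.
have s0 : 0 <= s by apply: sumr_ge0.
have := r0 k1.
have -> : a * (s + r k1) - b * (s + r k1) ^+ 2 = (a * s - b * s ^+ 2) + a * r k1 - b * s * r k1
   - (b * s * r k1 + b * r k1 ^+ 2) by ring.
have := mulr_ge0 (mulr_ge0 b0 s0) (r0 k1).
have := mulr_ge0 b0 (sqr_ge0 (r k1)).
lra.
Qed.

End FractionGeometry.

(** * One dyadic scale of denominators *)

Section DivergentRates.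
Context {R : realType}.

(** A dyadic version of [k * log k]: its inverses have a divergent sum, and they are the
   measures, up to constants, that the scales [2 ^ k] contribute. *)
Definition scale_cost (e k : nat) : nat :=
  (2 ^ trunc_log 2 k.+1 * (trunc_log 2 k.+1 + e))%N.

Lemma scale_cost_mono e k k' : (k <= k')%N -> (scale_cost e k <= scale_cost e k')%N.
Proof.
move=> kk; have tl : (trunc_log 2 k.+1 <= trunc_log 2 k'.+1)%N by apply: leq_trunc_log.
by rewrite /scale_cost leq_mul ?leq_add2r// leq_pexp2l.
Qed.

Lemma scale_cost_ge e k : (0 < e)%N -> (k.+1 <= 2 * scale_cost e k)%N.
Proof.
move=> e0; have /andP[_ h] := trunc_log_bounds (isT : 1 < 2)%N (ltn0Sn k).
rewrite (leq_trans (ltnW h))// expnS leq_pmul2l// leq_pmulr// addn_gt0 e0 orbT//.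
Qed.

Lemma scale_cost_gt0 e k : (0 < e)%N -> (0 < scale_cost e k)%N.
Proof. by move=> /(scale_cost_ge k); case: scale_cost. Qed.

Lemma condensation (a b : nat -> R) :
  (forall j n, (2 ^ j <= n < 2 ^ j.+1)%N -> b j <= 2 ^+ j * a n) ->
  forall J, \sum_(0 <= j < J) b j <= \sum_(1 <= n < 2 ^ J) a n.
Proof.
move=> h; elim=> [|J IH]; first by rewrite !big_geq.
rewrite big_nat_recr//= [leRHS](big_cat_nat (n := 2 ^ J))/= ?expn_gt0 ?leq_pexp2l//.
apply: lerD; first exact: IH.
have p2 : 0 < 2 ^+ J :> R by rewrite exprn_gt0.
apply: (@le_trans _ _ (\sum_(2 ^ J <= n < 2 ^ J.+1) b J / 2 ^+ J)).
  rewrite sumr_const_nat expnS mul2n -addnn addnK -[leRHS]mulr_natr natrX.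
  by rewrite divfK ?gt_eqF.
apply: ler_sum_nat => n hn; rewrite ler_pdivrMr// mulrC; exact: h.
Qed.

(** Cauchy condensation turns the terms into [1 / (j + e)], and a second time into a
   constant. *)
Lemma scale_cost_diverges e (B : R) (k0 : nat) : (0 < e)%N ->
  exists k1, B <= \sum_(k0 <= k < k1) 1 / (scale_cost e k)%:R.
Proof.
move=> e0; pose a k : R := 1 / (scale_cost e k)%:R.
have a0 k : 0 <= a k by rewrite divr_ge0.
have step1 J : \sum_(0 <= j < J) 1 / (j + e)%:R <= \sum_(1 <= n < 2 ^ J) a n.-1.
  apply: condensation => j n /andP[n1 n2].
  have n0 : (0 < n)%N by apply: leq_trans n1; rewrite expn_gt0.
  have tl : trunc_log 2 n = j by apply: trunc_log_eq; rewrite ?n1.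
  have je : 0 < (j + e)%:R :> R by rewrite ltr0n addn_gt0 e0 orbT.
  rewrite /a /scale_cost prednK// tl natrM natrX; move: ((j + e)%:R) je => c c0.
  have p2 : 0 < 2 ^+ j :> R by rewrite exprn_gt0.
  by rewrite le_eqVlt; apply/orP; left; apply/eqP; field; rewrite !gt_eqF.
have step2 J : J%:R / (2 + e%:R) <= \sum_(1 <= m < 2 ^ J) 1 / (m + e)%:R :> R.
  apply: le_trans (condensation (b := fun=> 1 / (2 + e%:R)) _ J).
    by rewrite sumr_const_nat subn0 -[leRHS]mulr_natl mul1r.
  move=> j m /andP[m1 m2].
  have p2 : 0 < 2 ^+ j :> R by rewrite exprn_gt0.
  have mR : m%:R <= 2 * 2 ^+ j :> R by rewrite -exprS -natrX ler_nat ltnW.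
  have p21 : 1 <= 2 ^+ j :> R by rewrite exprn_ege1// ler1n.
  rewrite mulrA mulr1 ler_pdivrMr ?ltr_wpDr// mulrAC ler_pdivlMr ?ltr0n ?addn_gt0 ?e0 ?orbT//.
  have e0R : 0 <= e%:R :> R by [].
  by rewrite mul1r natrD mulrDr [_ * 2]mulrC lerD// ler_peMl.
pose B' := (B + \sum_(0 <= k < k0) a k) * (2 + e%:R).
pose J := (Num.truncn `|B'|).+1.
pose k1 := (k0 + 2 ^ (2 ^ J))%N; exists k1.
have e2 : 0 < 2 + e%:R :> R by rewrite ltr_wpDr.
have tot : B + \sum_(0 <= k < k0) a k <= \sum_(0 <= k < k1) a k.
  apply: (@le_trans _ _ (\sum_(1 <= n < 2 ^ (2 ^ J)) a n.-1)).
    apply: le_trans (step1 _).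
    have : \sum_(1 <= m < 2 ^ J) 1 / (m + e)%:R <= \sum_(0 <= j < 2 ^ J) 1 / (j + e)%:R :> R.
      by rewrite [leRHS]big_ltn ?expn_gt0// lerDr divr_ge0.
    apply: le_trans; apply: le_trans (step2 J); rewrite ler_pdivlMr// -/B'.
    by rewrite (le_trans (ler_norm _))// ltW// /J truncnS_gt.
  rewrite -{1}[1%N]add0n big_addn; under eq_bigr => i _ do rewrite addn1 /=.
  rewrite [leRHS](big_cat_nat (n := 2 ^ (2 ^ J) - 1)%N)//=; last by rewrite /k1; lia.
  by rewrite lerDl sumr_ge0.
have E : \sum_(0 <= k < k1) a k = \sum_(0 <= k < k0) a k + \sum_(k0 <= k < k1) a k.
  by rewrite (big_cat_nat (n := k0))//= leq_addr.
by rewrite E in tot; rewrite -/(a _); lra.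
Qed.

Lemma partial_sum_hits (r : nat -> R) (k0 : nat) (h : R) : 0 < h ->
  (forall k, (k0 <= k)%N -> r k <= h) ->
  (exists k1, h <= \sum_(k0 <= k < k1) r k) ->
  exists k1, h <= \sum_(k0 <= k < k1) r k <= 2 * h.
Proof.
move=> h0 rh ex; have ex' : exists k1, (fun k1 => h <= \sum_(k0 <= k < k1) r k) k1 by [].
case: (ex_minnP ex') => k1 hk1 kmin; exists k1; rewrite hk1 /=.
case: k1 hk1 kmin => [|k1] hk1 kmin; first by move: hk1; rewrite big_geq//; lra.
have [k01|k10] := leqP k0 k1; last by move: hk1; rewrite big_geq//; lra.
have lt : \sum_(k0 <= k < k1) r k < h.
  by rewrite ltNge; apply/negP => /kmin; rewrite ltnn.
by rewrite big_nat_recr//=; have := rh _ k01; lra.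
Qed.

End DivergentRates.

Section MetricTheorem.
Context {R : realType} (f : R -> R) (V : R) (V0 : 0 <= V).
Hypothesis dk : denjoy_koksma_bound f V.
Hypothesis pert : perturbation_bound f V.

(** With [a := 1 / (q * `|q al - p|)], the last two conditions bound below by [K] the quotients
   of [a] by 1 and by every sum of length less than q. *)
Definition well_approximated (ds : seq R) (rho : R) (K : nat) (al : R) : Prop :=
  exists p q : nat, [/\ (K <= q)%N && (0 < q)%N, coprime p q, nonresonant ds rho q,
    K%:R * (q%:R * `|q%:R * al - p%:R|) <= 1 &
    forall x N, (N < q)%N -> K%:R * `|birkhoff_sum f al x N| * (q%:R * `|q%:R * al - p%:R|) <= 1].

(** At [L] of the order of [log k], the strong resonances over all k scales have measure
   O(2^-e); Markov's inequality costs as much at a threshold of order [k * L]. *)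
Lemma exceptional_fractions (k e : nat) : (0 < e)%N -> exists B : set R,
  [/\ measurable B, unit_length B <= 32 / 2 ^+ e &
      forall al, 0 <= al <= 1 -> ~ B al -> forall N x, (N < 2 * 2 ^ k)%N ->
        `|birkhoff_sum f al x N| <= V * (2 ^+ e * (scale_cost e k)%:R)].
Proof.
move=> e0; pose m := trunc_log 2 k.+1; pose L := (m + e)%N.
have p2 n : 0 < 2 ^+ n :> R by rewrite exprn_gt0.
have LR : 0 < L%:R :> R by rewrite ltr0n addn_gt0 e0 orbT.
have c0 : 0 < 2 ^+ e * (scale_cost e k)%:R :> R by rewrite mulr_gt0// ltr0n scale_cost_gt0.
have [B [mB lB hB]] := exceptional_set V0 dk k.+1 L c0.
exists B; split=> //; last by move=> al al01 nB N x; rewrite -expnS => Nk; exact: hB.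
have /andP[_ km] := trunc_log_bounds (isT : 1 < 2)%N (ltn0Sn k).
have kR : k.+1%:R <= 2 * 2 ^+ m :> R by rewrite -exprS -natrX ler_nat ltnW.
apply: (le_trans lB).
have -> : 32 / 2 ^+ e = 8 * (2 * 2 ^+ m) * L%:R / (2 ^+ e * (2 ^+ m * L%:R)) + 8 * (2 * 2 ^+ m) / (2 ^+ m * 2 ^+ e) :> R.
  by field; rewrite !gt_eqF.
rewrite -exprD /scale_cost -/m -/L natrM natrX; apply: lerD.
  by rewrite ler_pM2r ?invr_gt0 ?mulr_gt0// ler_pM2r// ler_pM2l.
by rewrite ler_pM2r ?invr_gt0// ler_pM2l.
Qed.

Lemma ball_subset_unit (s t w z : R) : s <= w -> w <= t -> t <= 1 - w ->
  `|t - z| < s -> 0 <= z <= 1.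
Proof.
by move=> sw wt tw; rewrite ltr_norml => /andP[? ?]; apply/andP; split; lra.
Qed.

(** A fraction is discarded when its whole neighbourhood of radius 1 / (8 X^2) is
   exceptional; the neighbourhoods are disjoint, so few are. Around any other fraction
   some al' has small sums of length less than q, and [pert] carries this over to every
   al close to the fraction. *)
Lemma one_scale (ds : seq R) (rho : R) (Q : nat) (u v : R) (K : nat) :
  (0 < Q)%N -> 0 < u -> u < v -> v < 1 ->
  (exists X0 : nat, forall X, (X0 <= X)%N ->
      (v - u) * X%:R ^+ 2 / (4 * Q%:R) <= #|good_fractions ds rho Q u v X|%:R) ->
  exists (e : nat) (D : R) (k0 : nat), [/\ (0 < e)%N, 4 <= D &
    forall k, (k0 <= k)%N -> exists G : pair_set (2 ^ k),
      [/\ fraction_family u v G, (v - u) * (2 ^ k)%:R ^+ 2 / (8 * Q%:R) <= #|G|%:R &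
          forall al, balls G (1 / (D * (scale_cost e k)%:R) / (4 * (2 ^ k)%:R ^+ 2)) al ->
             well_approximated ds rho K al]].
Proof.
move=> Q0 u0 uv v1 [X0 hX0].
have w0 : 0 < v - u by lra.
have QR : 0 < Q%:R :> R by rewrite ltr0n.
pose E := 32 * (32 * (Q%:R / (v - u))).
have E0 : 0 < E by rewrite !mulr_gt0// invr_gt0.
pose e := (Num.truncn E).+1.
have eE : E <= 2 ^+ e.
  have h1 : E < e%:R by exact: truncnS_gt.
  have : e%:R < 2 ^+ e :> R by rewrite -natrX ltr_nat ltn_expl.
  lra.
have p2 n : 0 < 2 ^+ n :> R by rewrite exprn_gt0.
pose D : R := K%:R * (1 + V) * (2 + 2 ^+ e) + 4.
have D4 : 4 <= D.
  by rewrite /D lerDr !mulr_ge0// addr_ge0// ltW.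
have KD : K%:R * (1 + V) * (2 + 2 ^+ e) <= D by rewrite /D lerDl.
have D0 : 0 < D by apply: lt_le_trans D4.
have e_gt0 : (0 < e)%N by [].
clearbody D; clearbody e.
exists e, D, (X0 + K)%N; split=> // k hk.
pose X := (2 ^ k)%N; have Xk : (k < X)%N by rewrite ltn_expl.
have X_gt0 : (0 < X)%N by rewrite expn_gt0.
have XR : 0 < X%:R :> R by rewrite ltr0n.
have [B [mB lB hB]] := exceptional_fractions k e_gt0.
pose F := good_fractions ds rho Q u v X.
pose bad (pq : 'I_(2 * X) * 'I_(2 * X)) := `[< ball (fraction pq : R) (1 / (8 * X%:R ^+ 2)) `<=` B >].
pose Gb : pair_set X := finset (fun pq => (pq \in F) && bad pq).
pose G : pair_set X := finset (fun pq => (pq \in F) && ~~ bad pq).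
have famF (H : pair_set X) : (forall pq, pq \in H -> pq \in F) -> fraction_family u v H.
  move=> HF pq /HF; rewrite inE => /and4P[/and3P[Xq qX _] _ iw cop]; split=> //.
  have q0 : 0 < pq.2%:R :> R by rewrite ltr0n (leq_trans X_gt0).
  by move: iw; rewrite /in_window /quot /= ler_pdivrMr// ler_pdivlMr//.
have famG : fraction_family u v G by apply: famF => pq; rewrite inE => /andP[].
have famGb : fraction_family u v Gb by apply: famF => pq; rewrite inE => /andP[].
have r8 : 0 <= 1 / (8 * X%:R ^+ 2) :> R by rewrite divr_ge0// mulr_ge0// exprn_ge0.
have cGb : #|Gb|%:R <= (v - u) * X%:R ^+ 2 / (8 * Q%:R).
  have h : 2 * (1 / (8 * X%:R ^+ 2)) * #|Gb|%:R <= 32 / 2 ^+ e :> R.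
    apply: (@le_trans _ _ (unit_length (balls Gb (1 / (8 * X%:R ^+ 2))))).
      by rewrite (balls_length X_gt0 u0 v1 famGb).
    apply: le_trans lB.
    apply: unit_length_mono => //; first exact: balls_measurable.
    move=> x [/ballsP[pq pqG h] _]; move: pqG; rewrite inE => /andP[_ /asboolP]; exact.
  have h2 : #|Gb|%:R <= 128 * X%:R ^+ 2 / 2 ^+ e :> R.
    have -> : #|Gb|%:R = 2 * (1 / (8 * X%:R ^+ 2)) * #|Gb|%:R * (4 * X%:R ^+ 2) :> R.
      by field; rewrite gt_eqF.
    have -> : 128 * X%:R ^+ 2 / 2 ^+ e = 32 / 2 ^+ e * (4 * X%:R ^+ 2) :> R by ring.
    by rewrite ler_wpM2r// mulr_ge0// exprn_ge0.
  apply: (le_trans h2); rewrite ler_pdivrMr//.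
  apply: (@le_trans _ _ ((v - u) * X%:R ^+ 2 / (8 * Q%:R) * E)).
    by rewrite le_eqVlt; apply/orP; left; apply/eqP; rewrite /E; field; rewrite !gt_eqF.
  by rewrite ler_wpM2l// divr_ge0 ?mulr_ge0 ?exprn_ge0// ltW.
have cF : (v - u) * X%:R ^+ 2 / (4 * Q%:R) <= #|F|%:R by apply: hX0; exact: leq_trans (leq_trans (leq_addr K X0) hk) (ltnW Xk).
have cFG : (#|F| <= #|G| + #|Gb|)%N.
  apply: leq_trans (leq_card_setU _ _); apply: subset_leq_card.
  apply/fintype.subsetP => pq pqF; rewrite finset.in_setU; apply/orP.
  by case: (boolP (bad pq)) => b; [right|left]; rewrite inE; apply/andP.
rewrite -(ler_nat R) natrD in cFG.
exists G; split=> //.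
  have -> : (v - u) * (2 ^ k)%:R ^+ 2 / (8 * Q%:R) =
    (v - u) * X%:R ^+ 2 / (4 * Q%:R) - (v - u) * X%:R ^+ 2 / (8 * Q%:R) by rewrite /X; field; rewrite gt_eqF.
  by lra.
move=> al /ballsP[[p q] pqG]; rewrite -/X.
have [/= Xq cop /andP[uq qv]] := famG _ pqG.
have q0 : (0 < q)%N by apply: leq_trans Xq.
have qR : 0 < q%:R :> R by rewrite ltr0n.
have qX2 : q%:R <= 2 * X%:R :> R by rewrite -natrM ler_nat ltnW.
have TR : 1 <= (scale_cost e k)%:R :> R by rewrite ler1n scale_cost_gt0.
set T : R := (scale_cost e k)%:R in TR *.
have T0 : 0 < T by apply: lt_le_trans TR.
rewrite distrC /fraction /quot /= => hal.
have DT0 : 0 < D * T by rewrite mulr_gt0.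
have r0 : 0 < 1 / (D * T) by rewrite divr_gt0.
have q2 : q%:R ^+ 2 <= 4 * X%:R ^+ 2 :> R.
  have -> : 4 * X%:R ^+ 2 = (2 * X%:R) ^+ 2 :> R by ring.
  by rewrite ler_pXn2r// ?nnegrE ?mulr_ge0 ?(ltW qR).
have X2 : 0 < 4 * X%:R ^+ 2 :> R by rewrite mulr_gt0// exprn_gt0.
have q2i : 1 / (4 * X%:R ^+ 2) <= 1 / q%:R ^+ 2 :> R.
  by rewrite !mul1r lef_pV2 ?posrE ?exprn_gt0.
have close : q%:R * `|q%:R * al - p%:R| <= 1 / (D * T).
  have -> : q%:R * al - p%:R = q%:R * (al - p%:R / q%:R) by field; rewrite gt_eqF.
  rewrite normrM (gtr0_norm qR) mulrA -expr2.
  apply: (@le_trans _ _ (q%:R ^+ 2 * (1 / (D * T) / (4 * X%:R ^+ 2)))).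
    by rewrite ler_wpM2l ?exprn_ge0// ltW.
  by rewrite mulrCA ler_piMr ?(ltW r0)// ler_pdivrMr// mul1r.
have K0 : 0 <= K%:R :> R by [].
have e0 : 0 < 2 ^+ e :> R by [].
have KV : 0 <= K%:R * (1 + V) by rewrite mulr_ge0// addr_ge0.
exists p, q; split=> //.
- by rewrite q0 andbT (leq_trans _ Xq)// (leq_trans _ (ltnW Xk))// (leq_trans (leq_addl X0 K)).
- by move: pqG; rewrite inE => /andP[]; rewrite inE => /and4P[_ /asboolP].
- apply: (@le_trans _ _ (K%:R * (1 / (D * T)))); first by rewrite ler_wpM2l.
  rewrite mul1r ler_pdivrMr// mul1r.
  have KD' : K%:R <= D.
    apply: le_trans KD; rewrite -mulrA ler_peMr// mulr_ege1//.
      by rewrite lerDl.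
    by apply: ler_wpDr; rewrite ?(ltW e0)// ler1n.
  by apply: (le_trans KD'); rewrite ler_peMr// ltW.
- move=> x N Nq.
  have [al' al'b nB] : exists2 al', ball (p%:R / q%:R : R) (1 / (8 * X%:R ^+ 2)) al' & ~ B al'.
    move: pqG; rewrite inE => /andP[_ /asboolP nb]; apply: contrapT => n; apply: nb => y hy.
    by apply: contrapT => nBy; apply: n; exists y.
  rewrite /ball/= in al'b.
  have h8 : 1 / (8 * X%:R ^+ 2) <= 1 / (2 * q%:R ^+ 2) :> R.
    have -> : 1 / (8 * X%:R ^+ 2) = 1 / (4 * X%:R ^+ 2) / 2 :> R by field; rewrite gt_eqF.
    have -> : 1 / (2 * q%:R ^+ 2) = 1 / q%:R ^+ 2 / 2 :> R by field; rewrite gt_eqF.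
    by rewrite ler_pM2r ?invr_gt0.
  have al'c := lt_le_trans al'b h8; rewrite distrC in al'c.
  have alc : `|al - p%:R / q%:R| < 1 / (2 * q%:R ^+ 2).
    apply: (lt_le_trans hal); apply: le_trans h8.
    have -> : 1 / (8 * X%:R ^+ 2) = 1 / 2 / (4 * X%:R ^+ 2) :> R by field; rewrite gt_eqF.
    rewrite ler_pM2r ?invr_gt0// !mul1r lef_pV2 ?posrE//.
    apply: (@le_trans _ _ D); last by rewrite ler_peMr// ltW.
    by apply: le_trans D4; rewrite ler_nat.
  have al'01 : 0 <= al' <= 1.
    have i8 : 1 / (8 * X%:R ^+ 2) <= 1 / q%:R :> R.
      apply: (le_trans h8); rewrite !mul1r lef_pV2 ?posrE ?mulr_gt0 ?exprn_gt0//.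
      have : 1 <= q%:R :> R by rewrite ler1n.
      by move: (q%:R : R) => t; nra.
    have p1 : 1 / q%:R <= p%:R / q%:R :> R.
      rewrite ler_pM2r ?invr_gt0// ler1n lt0n; apply/negP => /eqP p0.
      by move: uq; rewrite /quot /= p0 mul0r; lra.
    have pq1 : p%:R / q%:R <= 1 - 1 / q%:R :> R.
      rewrite lerBrDr -mulrDl ler_pdivrMr// mul1r natr1 ler_nat.
      rewrite -(ltr_nat R) -[ltRHS]mul1r -ltr_pdivrMr//; move: qv; rewrite /quot /=; lra.
    exact: (ball_subset_unit i8 p1 pq1 al'b).
  have S' := hB _ al'01 nB N x (ltn_trans Nq (ltn_ord q)).
  have dS := pert x q0 cop alc al'c (ltnW Nq).
  have S1 : `|birkhoff_sum f al x N| <= V * (1 + 2 ^+ e) * T.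
    have h := ler_normD (birkhoff_sum f al x N - birkhoff_sum f al' x N) (birkhoff_sum f al' x N).
    rewrite subrK in h; apply: (le_trans h).
    have -> : V * (1 + 2 ^+ e) * T = V * T + V * (2 ^+ e * T) by ring.
    by apply: lerD; [apply: (le_trans dS); rewrite ler_peMr|exact: S'].
  apply: (@le_trans _ _ (K%:R * (V * (1 + 2 ^+ e) * T) * (1 / (D * T)))).
    by apply: ler_pM; rewrite ?mulr_ge0// ler_wpM2l.
  rewrite mul1r ler_pdivrMr// mul1r.
  have -> : K%:R * (V * (1 + 2 ^+ e) * T) = K%:R * (V * (1 + 2 ^+ e)) * T by ring.
  rewrite ler_pM2r//.
  apply: le_trans KD; rewrite -mulrA ler_wpM2l//.
  apply: ler_pM => //; [by rewrite lerDr|by rewrite lerD2r ler1n].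
Qed.

(** * Almost every rotation is well approximated *)

(** The neighbourhoods [E k] at the scales [2 ^ k] have measures of order [w * r k], with a
   divergent sum, and are quasi-independent: a Bonferroni bound on a stretch of scales of
   moderate total measure leaves a proportion independent of [w]. *)
Lemma local_density (ds : seq R) (rho : R) (Q K : nat) (u v : R) : (0 < Q)%N ->
  (forall u v, 0 < u -> u < v -> v < 1 -> exists X0 : nat, forall X, (X0 <= X)%N ->
      (v - u) * X%:R ^+ 2 / (4 * Q%:R) <= #|good_fractions ds rho Q u v X|%:R) ->
  0 < u -> u < v -> v < 1 -> exists E : set R,
   [/\ open E, forall x, E x -> u < x < v /\ well_approximated ds rho K x &
       1 / (64 * (32 * Q%:R)) / (64 * Q%:R) * (v - u) <= unit_length E].
Proof.
move=> Q0 many u0 uv v1; pose w := v - u; have w0 : 0 < w by rewrite subr_gt0.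
(* the margin w / 4 keeps the intervals around the fractions inside (u, v) *)
pose u' := u + w / 4; pose v' := v - w / 4.
have u'0 : 0 < u' by rewrite /u'; lra.
have v'1 : v' < 1 by rewrite /v'; lra.
have u'v' : u' < v' by rewrite /u' /v' /w; lra.
have w'E : v' - u' = w / 2 by rewrite /u' /v' /w; field.
have [e [D [k0 [e0 D4 scales]]]] := one_scale K Q0 u'0 u'v' v'1 (many _ _ u'0 u'v' v'1).
have QR : 0 < Q%:R :> R by rewrite ltr0n.
pose r k : R := 1 / (D * (scale_cost e k)%:R).
pose rad k : R := r k / (4 * (2 ^ k)%:R ^+ 2).
(* with the sum of the r k between h and 2 h, the quadratic term of the Bonferroni bound is
   at most half of the linear one *)
pose h : R := 1 / (64 * (32 * Q%:R)).
have h0 : 0 < h by rewrite divr_gt0// !mulr_gt0.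
have D0 : 0 < D by apply: lt_le_trans D4.
have T0 k : 0 < (scale_cost e k)%:R :> R by rewrite ltr0n scale_cost_gt0.
have r0 k : 0 < r k by rewrite divr_gt0// mulr_gt0.
have X1 k : 1 <= (2 ^ k)%:R :> R by rewrite ler1n expn_gt0.
have X0 k : 0 < (2 ^ k)%:R :> R by apply: lt_le_trans (X1 k).
have X20 k : 0 < 4 * (2 ^ k)%:R ^+ 2 :> R by rewrite mulr_gt0// exprn_gt0.
have rmono k k' : (k <= k')%N -> r k' <= r k.
  move=> kk; rewrite /r !mul1r lef_pV2 ?posrE ?mulr_gt0// ler_pM2l// ler_nat.
  exact: scale_cost_mono.
have rk k : r k <= 1 / k.+1%:R.
  rewrite /r !mul1r lef_pV2 ?posrE ?mulr_gt0//.
  have : k.+1%:R <= 2 * (scale_cost e k)%:R :> R by rewrite -natrM ler_nat scale_cost_ge.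
  move=> hk; apply: (le_trans hk); rewrite ler_pM2r//.
  by apply: le_trans D4; rewrite ler_nat.
have r14 k : r k <= 1 / 4.
  rewrite /r !mul1r lef_pV2 ?posrE ?mulr_gt0//.
  by apply: (le_trans D4); rewrite ler_peMr ?(ltW D0)// ler1n scale_cost_gt0.
have rad0 k : 0 < rad k by rewrite divr_gt0.
have radr k : rad k <= r k.
  rewrite ler_pdivrMr// ler_peMr ?(ltW (r0 k))//.
  by rewrite mulr_ege1 ?exprn_ege1// ler1n.
have rad8 k : rad k <= 1 / (8 * (2 ^ k)%:R ^+ 2).
  apply: (@le_trans _ _ (1 / 4 / (4 * (2 ^ k)%:R ^+ 2))).
    by rewrite ler_pM2r ?invr_gt0.
  have -> : 1 / (8 * (2 ^ k)%:R ^+ 2) = 1 / 2 / (4 * (2 ^ k)%:R ^+ 2) :> R.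
    by field; rewrite gt_eqF.
  by rewrite ler_pM2r ?invr_gt0//; lra.
pose k1 := (k0 + Num.truncn (1 / h) + Num.truncn (4 / w))%N.
have inv_bound (t : R) k : 0 < t -> (Num.truncn (1 / t) <= k)%N -> 1 / k.+1%:R <= t.
  move=> t0 tk; have h1 : 1 / t < k.+1%:R.
    by apply: lt_le_trans (truncnS_gt _) _; rewrite ler_nat ltnS.
  rewrite ler_pdivrMr ?ltr0n// mulrC -ler_pdivrMr//; exact: ltW.
have kh k : (k1 <= k)%N -> r k <= h.
  move=> kk; apply: (le_trans (rk k)); apply: inv_bound => //; apply: leq_trans kk.
  by rewrite /k1 addnAC leq_addl.
have kw k : (k1 <= k)%N -> 1 / k.+1%:R <= w / 4.
  move=> kk; apply: inv_bound; first by rewrite divr_gt0.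
  have -> : 1 / (w / 4) = 4 / w by field; rewrite gt_eqF.
  by apply: leq_trans kk; rewrite leq_addl.
have kk0 k : (k1 <= k)%N -> (k0 <= k)%N.
  by apply: leq_trans; rewrite /k1 -addnA leq_addr.
pose Pk k (G : pair_set (2 ^ k)) :=
  [/\ fraction_family u' v' G, (v' - u') * (2 ^ k)%:R ^+ 2 / (8 * Q%:R) <= #|G|%:R &
          forall al, balls G (rad k) al -> well_approximated ds rho K al].
have exG k : {G | (k1 <= k)%N -> Pk k G}.
  apply: cid; have [kk|kk] := leqP k1 k; last by exists finset.set0.
  by have [G hG] := scales k (kk0 _ kk); exists G.
pose G k := sval (exG k).
have hG k : (k1 <= k)%N -> Pk k (G k) by exact: svalP (exG k).
pose E k := balls (G k) (rad k).
have mE k : measurable (E k) by exact: balls_measurable.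
have Glen k : (k1 <= k)%N -> unit_length (E k) = 2 * rad k * #|G k|%:R.
  move=> kk; have [fam _ _] := hG _ kk.
  have X0' : (0 < 2 ^ k)%N by rewrite expn_gt0.
  exact: balls_length X0' u'0 v'1 fam (ltW (rad0 k)) (rad8 k).
have Gup k : (k1 <= k)%N -> #|G k|%:R <= 4 * w * (2 ^ k)%:R ^+ 2.
  move=> kk; have [fam _ _] := hG _ kk.
  have X0' : (0 < 2 ^ k)%N by rewrite expn_gt0.
  apply: (le_trans (family_card_le X0' (ltW u'v') fam)); rewrite w'E.
  suff : 1 <= 2 * w * (2 ^ k)%:R ^+ 2 by move: ((2 ^ k)%:R ^+ 2 : R) => t; lra.
  have kX : k.+1%:R <= (2 ^ k)%:R :> R by rewrite ler_nat ltn_expl.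
  have : 1 <= w / 4 * k.+1%:R by rewrite -ler_pdivrMr ?ltr0n//; exact: kw.
  move=> one; apply: (le_trans one).
  apply: (@le_trans _ _ (w / 4 * (2 ^ k)%:R ^+ 2)).
    rewrite ler_wpM2l ?divr_ge0 ?(ltW w0)//; apply: (le_trans kX).
    by rewrite expr2 ler_peMr// ltW.
  rewrite ler_wpM2r ?exprn_ge0//; clear -w0; lra.
have lower k : (k1 <= k)%N -> w / (32 * Q%:R) * r k <= unit_length (E k).
  move=> kk; have [_ low _] := hG _ kk; rewrite Glen//.
  have rad2 : 0 <= 2 * rad k by rewrite mulr_ge0// ltW.
  apply: le_trans (ler_wpM2l rad2 low); rewrite w'E /rad.
  rewrite le_eqVlt; apply/orP; left; apply/eqP; field.
  by rewrite !gt_eqF.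
have overlap k k' : (k1 <= k < k')%N -> unit_length (E k `&` E k') <= 16 * w * r k * r k'.
  move=> /andP[kk kk']; have [fam _ _] := hG _ kk.
  have [fam' _ _] := hG _ (leq_trans kk (ltnW kk')).
  have X0' : (0 < 2 ^ k)%N by rewrite expn_gt0.
  have XX : (2 * 2 ^ k <= 2 ^ k')%N by rewrite -expnS leq_pexp2l.
  have rr : rad k' <= rad k.
    apply: ler_pM; rewrite ?invr_ge0 ?(ltW (r0 _)) ?(ltW (X20 _))//.
      exact: rmono (ltnW kk').
    rewrite lef_pV2 ?posrE// ler_pM2l// ler_pXn2r ?nnegrE// ler_nat leq_pexp2l//.
    exact: ltnW.
  apply: (le_trans (balls_overlap X0' XX fam fam' (rad0 k') rr)).
  have cst0 : 0 <= 32 * rad k * (2 ^ k')%:R ^+ 2 * (2 * rad k').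
    move: (rad k) (rad k') (ltW (rad0 k)) (ltW (rad0 k')) => a b a0 b0.
    by rewrite !mulr_ge0 ?exprn_ge0.
  apply: (le_trans (ler_wpM2r cst0 (Gup _ kk))).
  rewrite le_eqVlt; apply/orP; left; apply/eqP; rewrite /rad; field.
  by rewrite !gt_eqF.
have [k2 /andP[s1 s2]] : exists k2, h <= \sum_(k1 <= k < k2) r k <= 2 * h.
  apply: partial_sum_hits => //.
  have [k2 hk2] := @scale_cost_diverges R e (D * h) k1 e0.
  exists k2; have -> : \sum_(k1 <= k < k2) r k = D^-1 * \sum_(k1 <= k < k2) 1 / (scale_cost e k)%:R.
    by rewrite mulr_sumr; apply: eq_bigr => k _; rewrite /r !mul1r invfM.
  by rewrite -ler_pdivrMl ?invr_gt0// invrK.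
pose s := \sum_(k1 <= k < k2) r k.
have b0 : 0 <= 16 * w by rewrite mulr_ge0// ltW.
have := bonferroni_union b0 (fun k => ltW (r0 k)) mE lower overlap k2.
rewrite -/s => hs.
exists (\big[setU/set0]_(k1 <= k < k2) E k); split.
- by elim/big_ind : _ => [|A B|k _]; [exact: open0|exact: openU|exact: balls_open].
- move=> x; rewrite -bigcup_seq => -[k /=]; rewrite mem_index_iota => /andP[kk _] Ekx.
  have [fam _ wa] := hG _ kk; split; last exact: wa.
  have /ballsP[pq pqG px] := Ekx; have [_ _] := fam _ pqG; rewrite -/(fraction pq) => pqb.
  have rw : rad k <= w / 4 by apply: le_trans (radr k) (le_trans (rk k) (kw _ kk)).
  by move: px pqb rw; rewrite ltr_norml /u' /v' /fraction; clear; move=> /andP[? ?] /andP[? ?] ?; apply/andP; split; lra.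
- apply: le_trans hs; rewrite -/w.
  have hw : 0 <= h by exact: ltW.
  have -> : w / (32 * Q%:R) * s - 16 * w * s ^+ 2 = w * s * (1 / (32 * Q%:R) - 16 * s).
    by field; rewrite gt_eqF.
  have hq : h = 1 / (64 * Q%:R) / 32 by rewrite /h; field; rewrite gt_eqF.
  have q32 : 1 / (32 * Q%:R) = 64 * h by rewrite hq; field; rewrite gt_eqF.
  rewrite -/h q32.
  have -> : h / (64 * Q%:R) * w = w * h * (32 * h) by rewrite hq; field; rewrite gt_eqF.
  have ss : h <= s by []. have ss2 : s <= 2 * h by [].
  have wh : w * h <= w * s by rewrite ler_wpM2l// ltW.
  have wh0 : 0 <= w * h by rewrite mulr_ge0// ltW.
  have ws0 : 0 <= w * s by exact: le_trans wh.
  have hs32 : 32 * h <= 64 * h - 16 * s.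
    by move: ss2; move: (s : R) (h : R) => a b; lra.
  have h32 : 0 <= 32 * h by apply: mulr_ge0.
  exact: le_trans (ler_wpM2r h32 wh) (ler_wpM2l ws0 hs32).
Qed.

Theorem ae_well_approximated (ds : seq R) : (forall d, d \in ds -> forall m : int, d <> m%:~R) ->
  exists2 rho, 0 < rho & forall K,
    {ae (@lebesgue_measure R), forall al, 0 < al < 1 -> well_approximated ds rho K al}.
Proof.
move=> nint; have [Q [rho [Q0 rho0 many]]] := many_good_fractions nint.
exists rho => // K.
have QR : 0 < Q%:R :> R by rewrite ltr0n.
have c0 : 0 < 1 / (64 * (32 * Q%:R)) / (64 * Q%:R) :> R by rewrite !divr_gt0// !mulr_gt0.
apply: (ae_of_local_density c0) => u v u0 uv v1; exact: local_density.
Qed.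

End MetricTheorem.

(** * Ends of the support of a limit law *)

Section DistributionFunctions.
Context {R : realType}.
Implicit Types F : R -> R.

(** What is used of the distribution function of a non-constant variable, in a form stable
   under the reflection [z |-> 1 - F (- z)], which would not preserve right continuity. *)
Record distribution_like (F : R -> R) : Prop := {
  dl_nd : {homo F : x y / x <= y};
  dl_01 : forall z, 0 <= F z <= 1;
  dl_cts : forall u v, u < v -> exists2 z, u < z < v & {for z, continuous F};
  dl_low : forall eps, 0 < eps -> exists z, F z < eps;
  dl_high : forall eps, 0 < eps -> exists z, 1 - eps < F z;
  dl_mid : exists z1 z2, [/\ z1 < z2, 0 < F z1 & F z2 < 1] }.

Definition reflect_cdf (F : R -> R) (z : R) : R := 1 - F (- z).

Lemma reflect_continuous F z : {for z, continuous (reflect_cdf F)} -> {for - z, continuous F}.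
Proof.
move=> c; have -> : F = fun y => 1 - reflect_cdf F (- y).
  by apply/funext => y; rewrite /reflect_cdf opprK opprB addrC subrK.
rewrite /prop_for /continuous_at; apply: cvgB; first exact: cvg_cst.
apply: (@continuous_comp _ _ _ (fun y : R => - y) (reflect_cdf F)); first exact: opp_continuous.
by rewrite opprK.
Qed.

Lemma reflect_continuous_inv F z : {for - z, continuous F} -> {for z, continuous (reflect_cdf F)}.
Proof.
move=> c; rewrite /prop_for /continuous_at /reflect_cdf; apply: cvgB; first exact: cvg_cst.
by apply: (@continuous_comp _ _ _ (fun y : R => - y) F) => //; exact: opp_continuous.
Qed.

Lemma reflect_distribution_like F : distribution_like F -> distribution_like (reflect_cdf F).
Proof.
move=> [nd F01 cts low high [z1 [z2 [z12 h1 h2]]]]; split; rewrite /reflect_cdf.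
- by move=> x y xy; rewrite lerD2l lerN2; apply: nd; rewrite lerN2.
- by move=> z; have := F01 (- z); lra.
- move=> u v uv; have [|z /andP[zu zv] zc] := cts (- v) (- u); first by rewrite ltrN2.
  by exists (- z); [apply/andP; split; lra|apply: reflect_continuous_inv; rewrite opprK].
- by move=> eps e0; have [z hz] := high eps e0; exists (- z); rewrite opprK; lra.
- by move=> eps e0; have [z hz] := low eps e0; exists (- z); rewrite opprK; lra.
- exists (- z2), (- z1); split; rewrite ?opprK; lra.
Qed.

Definition mass_at_ends (G : R -> R) (a b rho c : R) : Prop :=
  (forall z, a + rho * (b - a) < z -> c <= G z) /\
  (forall z, z < b - rho * (b - a) -> G z <= 1 - c).

(** Laws [Fn n] carried by [e n, E n] tend to [F] and give a mass bounded below to every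
   fixed fraction of this interval at either end. *)
Record laws_between F (Fn : nat -> R -> R) (e E : nat -> R) : Prop := {
  lb_lt : forall n, e n < E n;
  lb_before : forall n z, z < e n -> Fn n z = 0;
  lb_after : forall n z, E n < z -> Fn n z = 1;
  lb_mass : forall rho, 0 < rho -> exists2 c, 0 < c &
    \forall n \near \oo, mass_at_ends (Fn n) (e n) (E n) rho c;
  lb_cvg : forall z, {for z, continuous F} -> Fn n z @[n --> \oo] --> F z }.

Lemma reflect_laws_between F Fn e E : laws_between F Fn e E ->
  laws_between (reflect_cdf F) (fun n => reflect_cdf (Fn n)) (fun n => - E n) (fun n => - e n).
Proof.
move=> [eE Fn0 Fn1 mass Fconv]; split.
- by move=> n; rewrite ltrN2.
- by move=> n z zE; rewrite /reflect_cdf Fn1 ?subrr//; lra.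
- by move=> n z ez; rewrite /reflect_cdf Fn0 ?subr0//; lra.
- move=> rho /mass[c c0 near_mass]; exists c => //; apply: filterS near_mass => n [m1 m2].
  split=> z hz; rewrite /reflect_cdf.
    by have := m2 (- z); rewrite (_ : - z < _) => [/(_ isT)|]; lra.
  by have := m1 (- z); rewrite (_ : _ < - z) => [/(_ isT)|]; lra.
- move=> z /reflect_continuous/Fconv h; apply: cvgB => //; exact: cvg_cst.
Qed.

Definition lower_end F : R := inf [set z | 0 < F z].
Definition upper_end F : R := - lower_end (reflect_cdf F).

Section Ends.
Context F (dl : distribution_like F) (Fn : nat -> R -> R) (e E : nat -> R).
Hypothesis law : laws_between F Fn e E.

(** The mass near either end of [e n, E n] cannot sit beyond the extreme quantiles of [F]. *)
Lemma width_bounded : exists W u v : R, [/\ 0 < W, \forall n \near \oo, E n - e n <= W &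
  \forall n \near \oo, u <= e n /\ E n <= v].
Proof.
have q4 : 0 < 1 / 4 :> R by lra.
have [c c0 mass] := lb_mass law q4.
have [u0 hu0] := dl_low dl c0; have [v0 hv0] := dl_high dl c0.
have [u /andP[_ uu0] uc] : exists2 u, u0 - 1 < u < u0 & {for u, continuous F} by apply: (dl_cts dl); lra.
have [v /andP[vv0 _] vc] : exists2 v, v0 < v < v0 + 1 & {for v, continuous F} by apply: (dl_cts dl); lra.
have Fu : F u < c by apply: le_lt_trans hu0; apply: (dl_nd dl); lra.
have Fv : 1 - c < F v by apply: lt_le_trans hv0 _; apply: (dl_nd dl); lra.
pose W := `|2 * (v - u)| + 1.
have W0 : 0 < W by rewrite /W; have := normr_ge0 (2 * (v - u)); lra.
have H : \forall n \near \oo, [/\ u <= e n + 1 / 4 * (E n - e n), E n - 1 / 4 * (E n - e n) <= v & E n - e n <= W].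
  have n1 : \forall n \near \oo, Fn n u < c by exact: cvgr_lt _ (lb_cvg law uc) _ Fu.
  have n2 : \forall n \near \oo, 1 - c < Fn n v by exact: cvgr_gt _ (lb_cvg law vc) _ Fv.
  near=> n.
  have [m1 m2] : mass_at_ends (Fn n) (e n) (E n) (1 / 4) c by near: n.
  have f1 : Fn n u < c by near: n.
  have f2 : 1 - c < Fn n v by near: n.
  have h1 : u <= e n + 1 / 4 * (E n - e n).
    by rewrite leNgt; apply/negP => /m1; lra.
  have h2 : E n - 1 / 4 * (E n - e n) <= v.
    by rewrite leNgt; apply/negP => /m2; lra.
  split=> //; have := ler_norm (2 * (v - u)); rewrite /W; lra.
exists W, (u - W), (v + W); split=> //; apply: filterS H => n [h1 h2 h3] //.
by have := lb_lt law n; lra.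
Unshelve. all: end_near. Qed.

Lemma lower_end_has_inf : has_inf [set z | 0 < F z].
Proof.
have [W [u [v [W0 _ huv]]]] := width_bounded.
split; first by have [z1 [_ [_ h _]]] := (dl_mid dl); exists z1.
exists (u - 1) => z /= Fz.
have [z' /andP[zz' z'1] zc] : exists2 z', z < z' < z + 1 & {for z', continuous F} by apply: (dl_cts dl); lra.
have Fz' : 0 < F z' by apply: lt_le_trans Fz _; apply: (dl_nd dl); lra.
have n1 : \forall n \near \oo, 0 < Fn n z' by exact: cvgr_gt _ (lb_cvg law zc) _ Fz'.
have [n [[h1 _] h2]] : exists n, (u <= e n /\ E n <= v) /\ 0 < Fn n z'.
  by near \oo => n; exists n; split; near: n.
have : e n <= z' by rewrite leNgt; apply/negP => /(lb_before law); lra.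
by lra.
Unshelve. all: end_near. Qed.

Lemma lower_end_gt z : lower_end F < z -> 0 < F z.
Proof.
move=> lz; have d0 : 0 < z - lower_end F by rewrite subr_gt0.
have [y /= Fy yz] := inf_adherent d0 lower_end_has_inf.
by apply: lt_le_trans Fy _; apply: (dl_nd dl); move: yz; rewrite -/lower_end; lra.
Qed.

Lemma lower_end_lt z : z < lower_end F -> F z = 0.
Proof.
move=> zl; apply/eqP; rewrite eq_le; have /andP[-> _] := dl_01 dl z; rewrite andbT leNgt.
apply/negP => Fz; have := ge_inf lower_end_has_inf.2 Fz; rewrite -/lower_end; lra.
Qed.

(** Just above the end of the support [F] is positive, so [e n] cannot stay above; just below
   it [F] vanishes, and the mass near [e n] cannot stay below. *)
Lemma cvg_lower_end : e n @[n --> \oo] --> lower_end F.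
Proof.
have [W [_ [_ [W0 hW _]]]] := width_bounded.
apply/cvgrPdist_lt => eps eps0.
have [z1 /andP[l1 u1] c1] : exists2 z, lower_end F < z < lower_end F + eps & {for z, continuous F}.
  by apply: (dl_cts dl); lra.
have [z2 /andP[l2 u2] c2] : exists2 z, lower_end F - eps / 2 < z < lower_end F & {for z, continuous F}.
  by apply: (dl_cts dl); lra.
have r0 : 0 < eps / 2 / W by rewrite !divr_gt0.
have [c c0 mass] := lb_mass law r0.
have n1 : \forall n \near \oo, 0 < Fn n z1 by exact: cvgr_gt _ (lb_cvg law c1) _ (lower_end_gt l1).
have n2 : \forall n \near \oo, Fn n z2 < c.
  by apply: (cvgr_lt _ (lb_cvg law c2)); rewrite lower_end_lt.
near=> n.
have w : E n - e n <= W by near: n.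
have f1 : 0 < Fn n z1 by near: n.
have f2 : Fn n z2 < c by near: n.
have [m1 _] : mass_at_ends (Fn n) (e n) (E n) (eps / 2 / W) c by near: n.
have g1 : e n <= z1 by rewrite leNgt; apply/negP => /(lb_before law); lra.
have g2 : z2 <= e n + eps / 2 / W * (E n - e n) by rewrite leNgt; apply/negP => /m1; lra.
have g3 : eps / 2 / W * (E n - e n) <= eps / 2.
  have {2}-> : eps / 2 = eps / 2 / W * W by rewrite divfK// gt_eqF.
  by rewrite ler_wpM2l// ltW.
by rewrite ltr_norml; apply/andP; split; lra.
Unshelve. all: end_near. Qed.

End Ends.

Lemma cvg_upper_end F Fn e E : distribution_like F -> laws_between F Fn e E ->
  E n @[n --> \oo] --> upper_end F.
Proof.
move=> dl law; rewrite (_ : E = fun n => - - E n); last by apply/funext => n; rewrite opprK.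
exact: cvgN (cvg_lower_end (reflect_distribution_like dl) (reflect_laws_between law)).
Qed.

Lemma ends_lt F Fn e E : distribution_like F -> laws_between F Fn e E -> lower_end F < upper_end F.
Proof.
move=> dl law; have [z1 [z2 [z12 f1 f2]]] := dl_mid dl.
have := ge_inf (lower_end_has_inf dl law).2 f1.
have := ge_inf (lower_end_has_inf (reflect_distribution_like dl) (reflect_laws_between law)).2
  (_ : [set z | 0 < reflect_cdf F z] (- z2)).
rewrite /= /reflect_cdf opprK subr_gt0 => /(_ f2); rewrite /upper_end /lower_end; lra.
Qed.

End DistributionFunctions.

(** * Two times with the same range *)

Section ConvergenceOfTypes.
Context {R : realType}.

Definition empirical_cdf_lt (S : nat -> R) (A B : R) (M : nat) (a : R) : R :=
  (count (fun N => (S N - A) / B < a) (index_iota 1 M.+1))%:R / M%:R.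

Definition times_at_ends (S : nat -> R) (M : nat) (lo hi rho t : R) : Prop :=
  t <= (count (fun N => S N <= lo + rho * (hi - lo)) (index_iota 1 M.+1))%:R /\
  t <= (count (fun N => hi - rho * (hi - lo) <= S N) (index_iota 1 M.+1))%:R.

(** Convergence is recorded also for strict inequalities, since these describe the law of
   [- S]. *)
Definition weak_limit (S A B : nat -> R) (F : R -> R) : Prop :=
  forall z, {for z, continuous F} ->
   empirical_cdf S (A M) (B M) M z @[M --> \oo] --> F z /\
   empirical_cdf_lt S (A M) (B M) M z @[M --> \oo] --> F z.

Lemma count_iota_cat (p : pred nat) (M1 M2 : nat) : (M1 <= M2)%N ->
  count p (index_iota 1 M2.+1) =
  (count p (index_iota 1 M1.+1) + count p (index_iota M1.+1 M2.+1))%N.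
Proof.
by move=> M12; rewrite /index_iota !subn1 subSS /= -{1}(subnKC M12) iotaD count_cat.
Qed.

Lemma count_iota_mono (p : pred nat) (M1 M2 : nat) : (M1 <= M2)%N ->
  (count p (index_iota 1 M1.+1) <= count p (index_iota 1 M2.+1))%N.
Proof. by move=> M12; rewrite (count_iota_cat p M12) leq_addr. Qed.

Lemma empirical_cdf_ends (S : nat -> R) (A B : R) (M : nat) (lo hi : R) : 0 < B -> (0 < M)%N ->
  (forall N, (0 < N <= M)%N -> lo <= S N <= hi) ->
  (forall z, z < (lo - A) / B -> empirical_cdf S A B M z = 0) /\
  (forall z, (hi - A) / B <= z -> empirical_cdf S A B M z = 1).
Proof.
move=> B0 M0 h; split=> z hz; rewrite /empirical_cdf.
  rewrite (eq_in_count (a2 := pred0)) ?count_pred0 ?mul0r// => N; rewrite mem_index_iota ltnS => /h/andP[l _].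
  apply/negP => le; have := le_lt_trans le hz; rewrite ltr_pM2r ?invr_gt0//; lra.
rewrite (eq_in_count (a2 := predT)) ?count_predT ?size_iota ?subn1 ?divff ?pnatr_eq0 -?lt0n//.
move=> N; rewrite mem_index_iota ltnS => /h/andP[_ u].
by apply/idP; apply: le_trans hz; rewrite ler_pM2r ?invr_gt0//; lra.
Qed.

Lemma empirical_cdf_mass (S : nat -> R) (A B : R) (M : nat) (lo hi rho c : R) : 0 < B -> (0 < M)%N ->
  times_at_ends S M lo hi rho (c * M%:R) ->
  mass_at_ends (empirical_cdf S A B M) ((lo - A) / B) ((hi - A) / B) rho c.
Proof.
move=> B0 M0 [h1 h2]; set E := (hi - A) / B; set e := (lo - A) / B; have MR : 0 < M%:R :> R by rewrite ltr0n.
have eqE : E - e = (hi - lo) / B by rewrite /E /e; ring.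
split=> z hz; rewrite /empirical_cdf.
  rewrite ler_pdivlMr//; apply: (le_trans h1); rewrite ler_nat; apply: sub_count => N /= hN.
  apply: le_trans (ltW hz); rewrite eqE /e.
  have -> : (lo - A) / B + rho * ((hi - lo) / B) = (lo + rho * (hi - lo) - A) / B by ring.
  by rewrite ler_pM2r ?invr_gt0// lerD2r.
rewrite ler_pdivrMr// mulrBl mul1r lerBrDr.
apply: le_trans (lerD (lexx _) h2) _; rewrite -natrD ler_nat.
rewrite -[X in (_ <= X)%N](_ : size (index_iota 1 M.+1) = M); last by rewrite size_iota subn1.
rewrite -(count_predC (fun N => (S N - A) / B <= z)) leq_add2l; apply: sub_count => N /= hN.
rewrite -ltNge; apply: (lt_le_trans hz); rewrite eqE /E.
have -> : (hi - A) / B - rho * ((hi - lo) / B) = (hi - rho * (hi - lo) - A) / B by ring.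
by rewrite ler_pM2r ?invr_gt0// lerD2r.
Qed.

(** The sums have the same range over [1, M1] and [1, M2], so both normalizations send this
   range close to the support of [F]. For z < z' below the middle of the support, a time
   N <= M2 whose sum is normalized to at most z has N <= M1 and is normalized to at most z'
   at M1; since M1 / M2 <= lam, this gives F z <= lam F z', and F z = 0 as z' tends to z. *)
Lemma types_contradiction (S A B : nat -> R) (F : R -> R) (M1 M2 : nat -> nat) (lo hi : nat -> R) (lam : R) :
  distribution_like F -> weak_limit S A B F -> (forall M, (0 < M)%N -> 0 < B M) ->
  M1 n @[n --> \oo] --> \oo -> M2 n @[n --> \oo] --> \oo ->
  (forall n, (0 < M1 n <= M2 n)%N) -> lam < 1 -> (forall n, (M1 n)%:R <= lam * (M2 n)%:R) ->
  (forall n, lo n < hi n) -> (forall n N, (0 < N <= M2 n)%N -> lo n <= S N <= hi n) ->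
  (forall n N, (M1 n < N <= M2 n)%N -> (lo n + hi n) / 2 <= S N) ->
  (forall rho : R, 0 < rho -> exists2 c : R, 0 < c & \forall n \near \oo,
    times_at_ends S (M1 n) (lo n) (hi n) rho (c * (M2 n)%:R)) ->
  False.
Proof.
move=> dl wl B0 M1oo M2oo M12 lam1 M12l lohi Sr Smid mass.
pose nrm (M : nat -> nat) (x : nat -> R) n := (x n - A (M n)) / B (M n).
have M1p n : (0 < M1 n)%N by case/andP: (M12 n).
have M12' n : (M1 n <= M2 n)%N by case/andP: (M12 n).
have M2p n : (0 < M2 n)%N by apply: leq_trans (M12' n).
(* the masses near both ends, counted over [1, M1], serve for every M between M1 and M2 *)
have key (M : nat -> nat) : M n @[n --> \oo] --> \oo -> (forall n, (0 < M n)%N) ->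
  (forall n, (M1 n <= M n <= M2 n)%N) ->
  [/\ nrm M lo n @[n --> \oo] --> lower_end F, nrm M hi n @[n --> \oo] --> upper_end F,
     forall z, lower_end F < z -> 0 < F z & lower_end F < upper_end F].
  move=> Moo Mp Mb.
  have Bp n : 0 < B (M n) by exact: B0.
  have eE n : nrm M lo n < nrm M hi n by rewrite ltr_pM2r ?invr_gt0// ltrD2r.
  pose Fn n z := empirical_cdf S (A (M n)) (B (M n)) (M n) z.
  have Sr' n N : (0 < N <= M n)%N -> lo n <= S N <= hi n.
    move=> /andP[N0 NM]; apply: Sr; rewrite N0 (leq_trans NM)//; by case/andP: (Mb n).
  have Fn0 n z : z < nrm M lo n -> Fn n z = 0.
    by have [h _] := empirical_cdf_ends (A (M n)) (Bp n) (Mp n) (Sr' n); exact: h.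
  have Fn1 n z : nrm M hi n < z -> Fn n z = 1.
    by have [_ h] := empirical_cdf_ends (A (M n)) (Bp n) (Mp n) (Sr' n) => /ltW; exact: h.
  have Fmass (rho : R) : 0 < rho -> exists2 c : R, 0 < c & \forall n \near \oo,
    mass_at_ends (Fn n) (nrm M lo n) (nrm M hi n) rho c.
    move=> /mass[c c0 near_mass]; exists c => //; near=> n.
    have [h1 h2] : times_at_ends S (M1 n) (lo n) (hi n) rho (c * (M2 n)%:R) by near: n.
    have /andP[m1 m2] := Mb n.
    have cM : c * (M n)%:R <= c * (M2 n)%:R by rewrite ler_wpM2l ?(ltW c0)// ler_nat.
    apply: empirical_cdf_mass => //; split.
      apply: (le_trans (le_trans cM h1)); rewrite ler_nat; exact: count_iota_mono.
    apply: (le_trans (le_trans cM h2)); rewrite ler_nat; exact: count_iota_mono.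
  have Fconv z : {for z, continuous F} -> Fn n z @[n --> \oo] --> F z.
    move=> zc; have [h _] := wl z zc; exact: (cvg_comp _ _ Moo h).
  have law : laws_between F Fn (nrm M lo) (nrm M hi) by [].
  split; [exact: (cvg_lower_end dl law)|exact: (cvg_upper_end dl law)| |exact: (ends_lt dl law)].
  by move=> z; exact: (lower_end_gt dl law).
have [e1 E1 Fpos ymp] := key M1 M1oo M1p (fun n => introT andP (conj (leqnn _) (M12' n))).
have [e2 E2 _ _] := key M2 M2oo M2p (fun n => introT andP (conj (M12' n) (leqnn _))).
set ym := lower_end F in e1 e2 Fpos ymp; set yp := upper_end F in E1 E2 ymp.
have [z /andP[ymz zmid] zc] : exists2 z, ym < z < (ym + yp) / 2 & {for z, continuous F}.
  by apply: (dl_cts dl); lra.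
have step z' : z < z' -> z' < (ym + yp) / 2 -> {for z', continuous F} -> F z <= lam * F z'.
  move=> zz' z'mid z'c.
  have [c1 _] := wl z' z'c; have [c2 _] := wl z zc.
  have C1 : lam * empirical_cdf S (A (M1 n)) (B (M1 n)) (M1 n) z' @[n --> \oo] --> lam * F z'.
    by apply: cvgMr; exact: (cvg_comp _ _ M1oo c1).
  have C2 : empirical_cdf S (A (M2 n)) (B (M2 n)) (M2 n) z @[n --> \oo] --> F z.
    exact: (cvg_comp _ _ M2oo c2).
  apply: (ler_cvg_to C2 C1).
  (* L1 and L2 place z at M2 below z' at M1, and the latter below the middle of the range *)
  have L1 : (z' - nrm M1 lo n) * (nrm M2 hi n - nrm M2 lo n) -
     (z - nrm M2 lo n) * (nrm M1 hi n - nrm M1 lo n) @[n --> \oo] -->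
     (z' - ym) * (yp - ym) - (z - ym) * (yp - ym).
    by apply: cvgB; apply: cvgM; apply: cvgB => //; exact: cvg_cst.
  have L2 : (nrm M1 hi n - nrm M1 lo n) - 2 * (z' - nrm M1 lo n) @[n --> \oo] --> (yp - ym) - 2 * (z' - ym).
    by apply: cvgB; [exact: cvgB|apply: cvgMr; apply: cvgB => //; exact: cvg_cst].
  have N1 : \forall n \near \oo, 0 < (z' - nrm M1 lo n) * (nrm M2 hi n - nrm M2 lo n) -
     (z - nrm M2 lo n) * (nrm M1 hi n - nrm M1 lo n).
    by apply: (cvgr_gt _ L1); rewrite -mulrBl mulr_gt0//; lra.
  have N2 : \forall n \near \oo, 0 < (nrm M1 hi n - nrm M1 lo n) - 2 * (z' - nrm M1 lo n).
    by apply: (cvgr_gt _ L2); lra.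
  near=> n.
  have P1 : 0 < (z' - nrm M1 lo n) * (nrm M2 hi n - nrm M2 lo n) -
     (z - nrm M2 lo n) * (nrm M1 hi n - nrm M1 lo n) by near: n.
  have P2 : 0 < (nrm M1 hi n - nrm M1 lo n) - 2 * (z' - nrm M1 lo n) by near: n.
  have B1 := B0 _ (M1p n); have B2 := B0 _ (M2p n).
  have MR1 : 0 < (M1 n)%:R :> R by rewrite ltr0n.
  have MR2 : 0 < (M2 n)%:R :> R by rewrite ltr0n.
  have w1 : nrm M1 hi n - nrm M1 lo n = (hi n - lo n) / B (M1 n) by rewrite /nrm; ring.
  have w2 : nrm M2 hi n - nrm M2 lo n = (hi n - lo n) / B (M2 n) by rewrite /nrm; ring.
  have width : 0 < hi n - lo n by rewrite subr_gt0.
  have imp N : (S N - A (M2 n)) / B (M2 n) <= z ->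
      (S N - A (M1 n)) / B (M1 n) <= z' /\ S N < (lo n + hi n) / 2.
    move=> hN.
    have a2 : (S N - lo n) / B (M2 n) <= z - nrm M2 lo n.
      have -> : (S N - lo n) / B (M2 n) = (S N - A (M2 n)) / B (M2 n) - nrm M2 lo n by rewrite /nrm; ring.
      by rewrite lerD2r.
    have a1 : (S N - lo n) / B (M1 n) < z' - nrm M1 lo n.
      have : (z - nrm M2 lo n) * ((hi n - lo n) / B (M1 n)) < (z' - nrm M1 lo n) * ((hi n - lo n) / B (M2 n)).
        by rewrite -w1 -w2; lra.
      have : (S N - lo n) / B (M2 n) * ((hi n - lo n) / B (M1 n)) <= (z - nrm M2 lo n) * ((hi n - lo n) / B (M1 n)).
        by rewrite ler_wpM2r// divr_ge0 ?(ltW width) ?(ltW B1).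
      move=> k1 k2; have := le_lt_trans k1 k2.
      have -> : (S N - lo n) / B (M2 n) * ((hi n - lo n) / B (M1 n)) =
         (S N - lo n) / B (M1 n) * ((hi n - lo n) / B (M2 n)) by ring.
      by rewrite ltr_pM2r// divr_gt0.
    split.
      have -> : (S N - A (M1 n)) / B (M1 n) = (S N - lo n) / B (M1 n) + nrm M1 lo n by rewrite /nrm; ring.
      by lra.
    rewrite w1 in P2.
    have : 2 * ((S N - lo n) / B (M1 n)) < (hi n - lo n) / B (M1 n) by lra.
    rewrite mulrA ltr_pM2r ?invr_gt0//; lra.
  rewrite /empirical_cdf ler_pdivrMr//.
  apply: (@le_trans _ _ (count (fun N => (S N - A (M1 n)) / B (M1 n) <= z') (index_iota 1 (M1 n).+1))%:R).
    rewrite ler_nat (count_iota_cat _ (M12' n)) -[X in (_ <= X)%N]addn0 leq_add//.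
      by apply: sub_count => N /= hN; case: (imp N hN).
    rewrite leqn0 -leqn0 leqNgt -has_count; apply/hasPn => N; rewrite mem_index_iota ltnS => hN.
    apply/negP => hz; have [_] := imp N hz; apply/negP; rewrite -leNgt; exact: Smid.
  rewrite mulrAC mulrA; rewrite [X in _ <= X]mulrC -mulrA.
  have c0 : 0 <= (count (fun N => (S N - A (M1 n)) / B (M1 n) <= z') (index_iota 1 (M1 n).+1))%:R / (M1 n)%:R :> R.
    by rewrite divr_ge0.
  have := ler_wpM2l c0 (M12l n); rewrite divfK ?gt_eqF//.
  by move=> h; apply: (le_trans h); rewrite le_eqVlt; apply/orP; left; apply/eqP; ring.
(* z' tends to the continuity point z from the right *)
have lF : F z <= lam * F z.
  apply/ler_addgt0Pr => eps eps0.
  have l0 : 0 <= lam.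
    have := M12l 0; have := M1p 0; rewrite -(ltr_nat R) => h1 h2.
    by rewrite leNgt; apply/negP => ln; have := mulr_le0_ge0 (ltW ln) (ler0n R (M2 0)); lra.
  have lam0 : 0 < 1 + lam by lra.
  have : \forall z' \near z, `|F z - F z'| < eps / (1 + lam).
    by move/cvgrPdist_lt : zc; apply; rewrite divr_gt0.
  move=> /nbhs_ballP[d /= d0 hd].
  pose d' := Num.min (z + d) ((ym + yp) / 2).
  have [z' /andP[zz' z'd] z'c] : exists2 z', z < z' < d' & {for z', continuous F}.
    by apply: (dl_cts dl); rewrite lt_min zmid andbT; lra.
  move: z'd; rewrite lt_min => /andP[z'd z'm].
  have cl : `|F z - F z'| < eps / (1 + lam).
    by apply: hd; rewrite /ball/= ltr_norml; apply/andP; split; lra.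
  have := step z' zz' z'm z'c.
  have k1 : F z' <= F z + eps / (1 + lam) by move: cl; rewrite ltr_norml => /andP[? ?]; lra.
  have k2 : lam * F z' <= lam * F z + lam * (eps / (1 + lam)) by rewrite -mulrDr ler_wpM2l.
  have k3 : lam * (eps / (1 + lam)) <= eps.
    by rewrite mulrA ler_pdivrMr// mulrC ler_pM2l//; lra.
  lra.
have := Fpos _ ymz; nra.
Unshelve. all: end_near. Qed.

End ConvergenceOfTypes.

(** * Distribution functions of random variables *)

Section LimitLaws.
Context {R : realType}.

Lemma nondecreasing_continuity_point (F : R -> R) (u v : R) : u < v ->
  {homo F : x y / x <= y} -> (forall z, 0 <= F z <= 1) -> (forall z, F x @[x --> z^'+] --> F z) ->
  exists2 z, u < z < v & {for z, continuous F}.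
Proof.
move=> uv nd F01 rc; apply: contrapT => none.
have cnt := @discontinuity_countable R u v F (fun x y _ _ => @nd x y).
have sub : `]u, v[ `<=` [set x | x \in (`]u, v[) /\ discontinuity F x].
  move=> z /=; rewrite in_itv/= => zuv; split; first by [].
  have lc : cvg (F x @[x --> z^'-]).
    apply: nondecreasing_at_left_is_cvgr; first by near=> x => a b _ _; exact: nd.
    near=> x; exists 1 => _ [y _ <-]; by case/andP: (F01 y).
  have rc' : cvg (F x @[x --> z^'+]) by apply/cvg_ex; exists (F z); exact: rc.
  split=> //; apply/eqP => E; apply: none; exists z => //.
  apply/left_right_continuousP; split; last exact: rc.
  have <- : lim (F x @[x --> z^'-]) = F z by rewrite E; exact: cvg_lim (rc z).
  exact: lc.
have c0 : countable (`]u, v[%classic : set R) by exact: sub_countable (subset_card_le sub) cnt.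
have := countable_lebesgue_measure0 c0; rewrite lebesgue_measure_itv/= lte_fin uv -EFinB => /eqP.
by rewrite eqe subr_eq0 gt_eqF.
Unshelve. all: end_near. Qed.

Context d (T : measurableType d) (P : probability T R) (Y : {RV P >-> R}).

Definition rcdf (z : R) : R := fine (cdf Y z).

Lemma rcdfE z : (rcdf z)%:E = cdf Y z.
Proof. by rewrite /rcdf fineK// fin_num_measure. Qed.

Lemma rcdf_nd : {homo rcdf : x y / x <= y}.
Proof. by move=> x y xy; rewrite -lee_fin !rcdfE; exact: cdf_nondecreasing. Qed.

Lemma rcdf_01 z : 0 <= rcdf z <= 1.
Proof. by rewrite -!lee_fin rcdfE cdf_ge0 cdf_le1. Qed.

Lemma rcdf_right_continuous z : rcdf x @[x --> z^'+] --> rcdf z.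
Proof.
apply: fine_cvg; rewrite rcdfE; exact: cdf_right_continuous.
Qed.

Lemma rcdf_continuous z : {for z, continuous rcdf} -> {for z, continuous (cdf Y)}.
Proof.
move=> c; rewrite /prop_for /continuous_at.
have -> : cdf Y = EFin \o rcdf by apply/funext => x; rewrite /= rcdfE.
by apply: cvg_EFin; [exact: nearW|exact: c].
Qed.

Lemma rcdf_cvgNy : rcdf x @[x --> -oo] --> (0 : R).
Proof. by apply: fine_cvg; exact: cvg_cdfNy0. Qed.

Lemma rcdf_cvgy : rcdf x @[x --> +oo] --> (1 : R).
Proof. by apply: fine_cvg; exact: cvg_cdfy1. Qed.

Lemma rcdf_low (eps : R) : 0 < eps -> exists z, rcdf z < eps.
Proof.
move=> eps0; have h : \forall x \near -oo, rcdf x < eps by exact: cvgr_lt rcdf_cvgNy _ eps0.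
by near (ninfty_nbhs R) => x; exists x; near: x.
Unshelve. all: end_near. Qed.

Lemma rcdf_high (eps : R) : 0 < eps -> exists z, 1 - eps < rcdf z.
Proof.
move=> eps0; have lt1 : 1 - eps < 1 by lra.
have h : \forall x \near +oo, 1 - eps < rcdf x by exact: cvgr_gt rcdf_cvgy _ lt1.
by near (pinfty_nbhs R) => x; exists x; near: x.
Unshelve. all: end_near. Qed.

(** If the distribution function takes only the values 0 and 1, then it jumps from one to the
   other at a single point, which carries all the mass. *)
Lemma rcdf_mid : nonconstant_rv Y -> exists z1 z2, [/\ z1 < z2, 0 < rcdf z1 & rcdf z2 < 1].
Proof.
move=> nc.
have half0 : 0 < 1 / 2 :> R by lra.
have low := rcdf_low half0; have high := rcdf_high half0.
have [z /andP[z0 z1]] : exists z, 0 < rcdf z < 1.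
  apply: contrapT => none; apply: nc.
  have dich z : rcdf z = 0 \/ rcdf z = 1.
    have /andP[a b] := rcdf_01 z.
    have [->|n0] := eqVneq (rcdf z) 0; first by left.
    right; apply/eqP; rewrite eq_le b /= leNgt; apply/negP => lt1.
    by apply: none; exists z; rewrite lt1 lt_def n0 a.
  pose c := inf [set z | rcdf z = 1].
  have has : has_inf [set z | rcdf z = 1].
    have [zl hl] := low; have [zh hh] := high; split.
      by exists zh => /=; case: (dich zh) => // h; lra.
    exists zl => y /= hy; rewrite leNgt; apply/negP => yl.
    by have := rcdf_nd (ltW yl); lra.
  have above z : c < z -> rcdf z = 1.
    move=> cz; have d0 : 0 < z - c by rewrite subr_gt0.
    have [y /= hy] := inf_adherent d0 has; rewrite -/c => yz.
    have yz' : y <= z by lra.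
    by have := rcdf_nd yz'; have := rcdf_01 z; lra.
  have below z : z < c -> rcdf z = 0.
    move=> zc; case: (dich z) => // h; have := ge_inf has.2 (h : [set z | rcdf z = 1] z).
    rewrite -/c; lra.
  have Fc : rcdf c = 1.
    have h0 := @rcdf_right_continuous c.
    have h : rcdf x @[x --> c^'+] --> (1 : R).
      apply: cvg_near_cst; near=> x; apply: above; near: x; exact: nbhs_right_gt.
    exact: (cvg_unique _ h0 h).
  have mc : distribution P Y [set c] = 1%E.
    have E : `]-oo, c]%classic = [set c] `|` `]-oo, c[%classic :> set R.
      apply/seteqP; split=> x /=; rewrite !in_itv/=.
        by rewrite le_eqVlt => /orP[/eqP|]; [left|right].
      by move=> [->|/ltW].
    have z0 : distribution P Y `]-oo, c[%classic = 0%E.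
      have E2 : `]-oo, c[%classic = \bigcup_n `]-oo, (c - n.+1%:R^-1)]%classic :> set R.
        apply/seteqP; split=> x /=; rewrite ?in_itv/=.
          move=> xc; have cx : 0 < c - x by rewrite subr_gt0.
          exists (Num.truncn (c - x)^-1) => //=; rewrite in_itv/= lerBrDr addrC -lerBrDr.
          rewrite -[leRHS]invrK lef_pV2 ?posrE ?invr_gt0 ?ltr0n//; apply: ltW; exact: truncnS_gt.
        move=> [n _] /=; rewrite in_itv/= => xn.
        by apply: (le_lt_trans xn); rewrite ltrBlDr ltrDl invr_gt0.
      apply/negligibleP; first exact: measurable_itv.
      rewrite E2; apply: negligible_bigcup => n; apply/negligibleP; first exact: measurable_itv.
      by rewrite -[LHS]/(cdf Y _) -rcdfE below// ltrBlDr ltrDl invr_gt0.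
    have := rcdfE c; rewrite Fc /cdf E measureU//; last first.
      by rewrite -subset0 => x [/= ->]; rewrite in_itv/= ltxx.
    by rewrite [X in (_ + X)%E]z0 adde0 => ->.
  exists c => D mD; rewrite diracE; have [cD|ncD] := boolP (c \in D).
    apply/eqP; rewrite eq_le probability_le1//= -mc le_measure ?inE// => x /= ->.
    exact: set_mem.
  apply/eqP; rewrite eq_le measure_ge0 andbT.
  have sub : D `<=` ~` [set c] by move=> x Dx /= xc; move/negP: ncD; apply; rewrite -xc; exact: mem_set.
  apply: (@le_trans _ _ (distribution P Y (~` [set c]))).
    by apply: le_measure; rewrite ?inE//; exact: measurableC.
  have mcC : distribution P Y (~` [set c]) = (1 - distribution P Y [set c])%E by exact: probability_setC.
  by rewrite mcC mc -EFinB subrr.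
have n1 : \forall x \near z^'+, rcdf x < 1 by exact: cvgr_lt (@rcdf_right_continuous z) _ z1.
have [z2 [zz2 hz2]] : exists z2, z < z2 /\ rcdf z2 < 1.
  by near z^'+ => x; exists x; split; near: x => //; exact: nbhs_right_gt.
by exists z, z2.
Unshelve. all: end_near. Qed.

Lemma rcdf_distribution_like : nonconstant_rv Y -> distribution_like rcdf.
Proof.
move=> nc; split.
- exact: rcdf_nd.
- exact: rcdf_01.
- move=> u v uv; apply: nondecreasing_continuity_point => //.
  + exact: rcdf_nd.
  + exact: rcdf_01.
  + exact: rcdf_right_continuous.
- exact: rcdf_low.
- exact: rcdf_high.
- exact: rcdf_mid.
Qed.

End LimitLaws.

(** * Excursions *)

Section Excursions.
Context {R : realType}.
Implicit Types (S A B : nat -> R).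

Lemma empirical_cdf_lt_le S (A B : R) M z : empirical_cdf_lt S A B M z <= empirical_cdf S A B M z :> R.
Proof.
rewrite /empirical_cdf_lt /empirical_cdf ler_wpM2r ?invr_ge0// ler_nat.
by apply: sub_count => N /= /ltW.
Qed.

Lemma empirical_cdf_le_lt S (A B : R) M z' z : z' < z ->
  empirical_cdf S A B M z' <= empirical_cdf_lt S A B M z :> R.
Proof.
move=> zz; rewrite /empirical_cdf_lt /empirical_cdf ler_wpM2r ?invr_ge0// ler_nat.
by apply: sub_count => N /= /le_lt_trans; apply.
Qed.

(** At a continuity point, strict inequalities have the same limit by comparison with the
   distribution functions at continuity points slightly to the left. *)
Lemma temporal_law_weak_limit S : has_temporal_limit_law S ->
  exists A B F, [/\ distribution_like F, forall M, (0 < M)%N -> 0 < B M & weak_limit S A B F].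
Proof.
move=> [A [B [B0 _ [d [T [P [Y [nc lim]]]]]]]].
have dl := rcdf_distribution_like nc.
exists A, B, (rcdf Y); split=> //.
have le z : {for z, continuous (rcdf Y)} ->
    empirical_cdf S (A M) (B M) M z @[M --> \oo] --> rcdf Y z.
  move=> zc; have := lim z (rcdf_continuous zc); rewrite -rcdfE => h.
  exact: (fine_cvg h).
move=> z zc; split; first exact: le.
apply/cvgrPdist_lt => eps eps0.
have : \forall x \near z, `|rcdf Y z - rcdf Y x| < eps / 2.
  by move/cvgrPdist_lt : zc; apply; rewrite divr_gt0.
move=> /nbhs_ballP[r /= r0 hr].
have [z' /andP[z'1 z'2] z'c] : exists2 z', z - r < z' < z & {for z', continuous (rcdf Y)}.
  by apply: (dl_cts dl); lra.
have close : `|rcdf Y z - rcdf Y z'| < eps / 2.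
  by apply: hr; rewrite /ball/= ltr_norml; apply/andP; split; lra.
have e2 : 0 < eps / 2 by rewrite divr_gt0.
have n1 : \forall M \near \oo, `|rcdf Y z - empirical_cdf S (A M) (B M) M z| < eps.
  by move/cvgrPdist_lt : (le z zc); apply.
have n2 : \forall M \near \oo, `|rcdf Y z' - empirical_cdf S (A M) (B M) M z'| < eps / 2.
  by move/cvgrPdist_lt : (le z' z'c); apply.
near=> M.
have m1 : `|rcdf Y z - empirical_cdf S (A M) (B M) M z| < eps by near: M.
have m2 : `|rcdf Y z' - empirical_cdf S (A M) (B M) M z'| < eps / 2 by near: M.
have i1 := empirical_cdf_lt_le S (A M) (B M) M z.
have i2 := empirical_cdf_le_lt S (A M) (B M) M z'2.
move: m1 m2 close; rewrite !ltr_norml => /andP[? ?] /andP[? ?] /andP[? ?].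
by apply/andP; split; lra.
Unshelve. all: end_near. Qed.

Lemma reflect_weak_limit S A B F : weak_limit S A B F ->
  weak_limit (fun N => - S N) (fun M => - A M) B (reflect_cdf F).
Proof.
move=> wl z /reflect_continuous /wl[c1 c2].
have cnt (M : nat) (a b : R) : (0 < M)%N ->
   (empirical_cdf (fun N => - S N) (- a) b M z = 1 - empirical_cdf_lt S a b M (- z)) /\
   (empirical_cdf_lt (fun N => - S N) (- a) b M z = 1 - empirical_cdf S a b M (- z)).
  move=> M0; have MR : M%:R != 0 :> R by rewrite pnatr_eq0 -lt0n.
  have opp N : (- S N - - a) / b = - ((S N - a) / b) by ring.
  have sz : size (index_iota 1 M.+1) = M by rewrite size_iota subn1.
  split; rewrite /empirical_cdf /empirical_cdf_lt; apply: (mulIf MR); rewrite mulrBl mul1r !divfK//; apply/eqP;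
    rewrite eq_sym subr_eq -natrD eqr_nat -{1}sz.
    rewrite -(count_predC (fun N => (S N - a) / b < - z)) addnC eqn_add2r; apply/eqP.
    by apply: eq_count => N /=; rewrite opp lerNl -leNgt.
  rewrite -(count_predC (fun N => (S N - a) / b <= - z)) addnC eqn_add2r; apply/eqP.
  by apply: eq_count => N /=; rewrite opp ltrNl -ltNge.
split.
  apply: cvg_trans (cvgB (cvg_cst (1 : R)) c2); apply: near_eq_cvg; near=> M.
  have M0 : (0 < M)%N by near: M; exact: nbhs_infty_gt.
  by have [-> _] := cnt M (A M) (B M) M0.
apply: cvg_trans (cvgB (cvg_cst (1 : R)) c1); apply: near_eq_cvg; near=> M.
have M0 : (0 < M)%N by near: M; exact: nbhs_infty_gt.
by have [_ ->] := cnt M (A M) (B M) M0.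
Unshelve. all: end_near. Qed.


(** Up to time [J * q], of order [a * q], the sums follow the values at the multiples of q,
   which climb to a height of order [a] by bounded steps and come back near 0. *)
Definition excursion S (V eps : R) (n : nat) : Prop :=
  exists (q J : nat) (a : R), [/\ (0 < q)%N /\ n.+1%:R <= a, J%:R <= 2 * a,
    forall j r, (j <= J)%N -> (r < q)%N -> `|S (j * q + r)%N - S (j * q)%N| <= a / n.+1%:R,
    forall j, `|S (j.+1 * q)%N - S (j * q)%N| <= V &
    `|S (J * q)%N| <= 2 * V + a / n.+1%:R /\ exists2 j, (j <= J)%N & eps * a <= S (j * q)%N].

Lemma excursion_le S V eps n m : (n <= m)%N -> excursion S V eps m -> excursion S V eps n.
Proof.
move=> nm [q [J [a [[q0 ma] Ja b1 b2 [b4 b5]]]]].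
have nmR : n.+1%:R <= m.+1%:R :> R by rewrite ler_nat ltnS.
have a0 : 0 <= a by apply: le_trans ma.
have am : a / m.+1%:R <= a / n.+1%:R by rewrite ler_wpM2l// lef_pV2 ?posrE.
exists q, J, a; split=> //.
- by split=> //; exact: le_trans ma.
- by move=> j r jJ rq; apply: le_trans am; exact: b1.
- by split=> //; apply: (le_trans b4); rewrite lerD2l.
Qed.

Lemma count_interval_ge (p : pred nat) (s t M : nat) : (s <= t <= M)%N ->
  (forall N, (s < N <= t)%N -> p N) -> (t - s <= count p (index_iota 1 M.+1))%N.
Proof.
move=> /andP[st tM] h; rewrite (leq_trans _ (count_iota_mono p tM))//.
rewrite (count_iota_cat p st) (leq_trans _ (leq_addl _ _))//.
have <- : size (index_iota s.+1 t.+1) = (t - s)%N by rewrite size_iota subSS.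
rewrite -(count_predT (index_iota s.+1 t.+1)) eq_leq//; apply: eq_in_count => N.
by rewrite mem_index_iota ltnS => /h ->.
Qed.

Lemma sum_increment_le S (V : R) (q : nat) : (forall j, `|S (j.+1 * q)%N - S (j * q)%N| <= V) ->
  forall j i, `|S ((j + i) * q)%N - S (j * q)%N| <= i%:R * V.
Proof.
move=> h j; elim=> [|i IH]; first by rewrite addn0 subrr normr0 mul0r.
have := ler_normD (S ((j + i.+1) * q)%N - S ((j + i) * q)%N) (S ((j + i) * q)%N - S (j * q)%N).
rewrite addrA subrK -natr1 mulrDl mul1r addnS => /le_trans; apply.
by rewrite addrC lerD.
Qed.

Lemma block_decomposition (q s t N : nat) : (0 < q)%N -> (s * q < N <= t * q)%N ->
  exists j r, [/\ N = (j * q + r)%N, (r < q)%N & (s <= j <= t)%N].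
Proof.
move=> q0 /andP[sN Nt]; exists (N %/ q)%N, (N %% q)%N; split.
- exact: divn_eq.
- exact: ltn_pmod.
- by rewrite leq_divRL// (ltnW sN) /= -(mulnK t q0) leq_div2r.
Qed.

(** The data of [types_contradiction] for one [n]. The last clause says that S spends a
   proportion of the times, depending only on [rho], near either end of its range. *)
Definition excursion_times S (V eps : R) (n M1 M2 : nat) (lo hi : R) : Prop :=
  [/\ (0 < M1 <= M2)%N /\ eps * n.+1%:R / V <= M1%:R,
      M1%:R <= 1 / (1 + eps / (16 * V)) * M2%:R,
      lo < hi /\ (forall N, (0 < N <= M2)%N -> lo <= S N <= hi),
      forall N, (M1 < N <= M2)%N -> (lo + hi) / 2 <= S N &
      forall rho, 0 < rho -> rho <= 1 -> 8 / n.+1%:R <= rho * eps -> 8 * V <= rho * eps * n.+1%:R ->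
       times_at_ends S M1 lo hi rho (rho * eps / (32 * V) * M2%:R)].

(** M1 is the time js * q of the maximum, M2 comes h blocks later, with h of order [a]. Bounded
   steps keep the walk high during these h blocks and, for the same reason, near its
   extreme values during long windows around them; the return near 0 guarantees that the
   maximum is followed by at least h blocks. *)
Lemma excursion_times_exist S (V eps : R) (n : nat) : S 0 = 0 -> 0 < V -> 0 < eps -> eps <= V ->
  16 / n.+1%:R <= eps -> 16 * V <= eps * n.+1%:R -> excursion S V eps n ->
  exists M1 M2 lo hi, excursion_times S V eps n M1 M2 lo hi.
Proof.
move=> S0 V0 eps0 epsV n1 n2 [q [J [a [[q0 an] Ja b1 b2 [b4 [jm jmJ b5]]]]]].
have nR : 0 < n.+1%:R :> R by [].
have a0 : 0 < a by apply: lt_le_trans an.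
pose d := a / n.+1%:R.
have d0 : 0 < d by rewrite divr_gt0.
have dE : 16 * d <= eps * a.
  by rewrite /d mulrCA mulrC ler_pM2r.
have Va : 16 * V <= eps * a by apply: (le_trans n2); rewrite ler_pM2l.
pose w j := S (j * q)%N.
have w0 : w 0 = 0 by rewrite /w mul0n.
have wlip j i : `|w (j + i)%N - w j| <= i%:R * V by exact: sum_increment_le.
pose jmo : 'I_J.+1 := Ordinal (jmJ : (jm < J.+1)%N).
have [js jsJ jsmax] : exists2 js, (js <= J)%N & forall j, (j <= J)%N -> w j <= w js.
  case: (@Order.TotalTheory.arg_maxP _ _ _ jmo xpredT (fun i => w (nat_of_ord i))) => // i _ hi.
  exists i; first by rewrite -ltnS.
  by move=> j jJ; apply: (hi (Ordinal (jJ : (j < J.+1)%N))).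
have [ji jijs jimin] : exists2 ji, (ji <= js)%N & forall j, (j <= js)%N -> w ji <= w j.
  case: (@Order.TotalTheory.arg_minP _ _ 'I_js.+1 ord0 xpredT (fun i => w (nat_of_ord i))) => // i _ hi.
  exists i; first by rewrite -ltnS.
  by move=> j jJ; apply: (hi (Ordinal (jJ : (j < js.+1)%N))).
have top : eps * a <= w js by apply: (le_trans b5); exact: jsmax.
have ji0 : w ji <= 0 by rewrite -w0; apply: jimin.
pose h := Num.truncn (eps * a / (4 * V)).
have V4 : 0 < 4 * V by rewrite mulr_gt0.
have /andP[h1 h2] : h%:R <= eps * a / (4 * V) < h.+1%:R.
  by apply: truncn_itv; rewrite divr_ge0 ?ltW// mulr_gt0.
have hV : h%:R * V <= eps * a / 4.
  have -> : eps * a / 4 = eps * a / (4 * V) * V by field; rewrite gt_eqF.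
  by rewrite ler_pM2r.
have hlow : eps * a / (8 * V) <= h%:R.
  have e1 : eps * a / (4 * V) = eps * a / (8 * V) + eps * a / (8 * V) by field; rewrite gt_eqF.
  have e2 : 1 <= eps * a / (8 * V) by rewrite ler_pdivlMr ?mulr_gt0//; lra.
  by move: h2; rewrite -[h.+1%:R]natr1; lra.
have h0 : (0 < h)%N.
  by rewrite -(ltr_nat R); apply: lt_le_trans hlow; rewrite divr_gt0 ?mulr_gt0.
have jsV : eps * a <= js%:R * V.
  apply: (le_trans top); have := wlip 0 js; rewrite add0n w0 subr0.
  exact: le_trans (ler_norm _).
have h4js : (4 * h <= js)%N.
  by rewrite -(ler_nat R) -(ler_pM2r V0) natrM; lra.
have hjs : (h <= js)%N by apply: leq_trans h4js; rewrite leq_pmull.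
have jsh : (js + h <= J)%N.
  rewrite leqNgt; apply/negP => lt.
  have Jjs : (J - js < h)%N by rewrite ltn_subLR.
  have := wlip js (J - js)%N; rewrite subnKC//.
  have : (J - js)%:R * V <= h%:R * V by rewrite ler_pM2r// ler_nat ltnW.
  have : w J <= 2 * V + d by apply: le_trans b4; exact: ler_norm.
  by rewrite ler_norml => ? ? /andP[? ?]; lra.
have late j : (js <= j <= js + h)%N -> w js - eps * a / 4 <= w j.
  move=> /andP[j1 j2]; have := wlip js (j - js)%N; rewrite subnKC//.
  have : (j - js)%:R * V <= h%:R * V by rewrite ler_pM2r// ler_nat leq_subLR.
  by rewrite ler_norml => ? /andP[? ?]; lra.
have wlo j : (j <= js + h)%N -> w ji <= w j.
  move=> jh; have [|jl] := leqP j js; first exact: jimin.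
  have := late j; rewrite (ltnW jl) jh => /(_ isT).
  have ea : 0 < eps * a by rewrite mulr_gt0.
  by lra.
(* d is the error made inside a block, so the range is widened by it *)
pose lo := w ji - d; pose hi := w js + d.
have near_w j r : (j <= J)%N -> (r < q)%N -> w j - d <= S (j * q + r)%N <= w j + d.
  by move=> jJ rq; have := b1 j r jJ rq; rewrite -/d ler_norml /w => /andP[? ?]; apply/andP; split; lra.
have MhR : (js + h)%:R = js%:R + h%:R :> R by rewrite natrD.
have jsR : js%:R <= 2 * a by apply: le_trans Ja; rewrite ler_nat.
exists (js * q)%N, ((js + h) * q)%N, lo, hi; split.
- split.
    by rewrite muln_gt0 q0 (leq_trans h0 hjs) leq_mul2r leq_addr orbT.
  apply: (@le_trans _ _ js%:R); last by rewrite ler_nat leq_pmulr.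
  by rewrite ler_pdivrMr//; apply: le_trans jsV; rewrite ler_pM2l.
- rewrite !natrM mulrA ler_pM2r ?ltr0n//.
  have k0 : 0 < 1 + eps / (16 * V) by rewrite addr_gt0// divr_gt0// mulr_gt0.
  rewrite mulrC mul1r ler_pdivlMr// mulrDr mulr1 MhR lerD2l.
  apply: le_trans hlow.
  have -> : eps * a / (8 * V) = (2 * a) * (eps / (16 * V)) by field; rewrite gt_eqF.
  by rewrite ler_wpM2r// divr_ge0 ?mulr_ge0// ltW.
- have ea : 0 < eps * a by rewrite mulr_gt0.
  split; first by rewrite /lo /hi; lra.
  move=> N /andP[N0 NM]; have N0' : (0 * q < N <= (js + h) * q)%N by rewrite mul0n N0.
  have [j [r [-> rq /andP[_ jh]]]] := block_decomposition q0 N0'.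
  have jJ := leq_trans jh jsh.
  by have := near_w j r jJ rq; have := wlo j jh; have := jsmax j jJ; rewrite /lo /hi => ? ? /andP[? ?]; apply/andP; split; lra.
- move=> N hN; have [j [r [-> rq jj]]] := block_decomposition q0 hN.
  have jJ : (j <= J)%N by case/andP: jj => _ jh; exact: leq_trans jh jsh.
  by have := near_w j r jJ rq; have := late j jj; rewrite /lo /hi => ? /andP[? ?]; lra.
- move=> rho rho0 rho1 r1 r2.
  pose g := Num.truncn (rho * eps * a / (4 * V)).
  have rea : 0 < rho * eps * a by rewrite !mulr_gt0.
  have re : 0 < rho * eps by rewrite mulr_gt0.
  have /andP[g1 g2] : g%:R <= rho * eps * a / (4 * V) < g.+1%:R.
    by apply: truncn_itv; rewrite divr_ge0 ?ltW.
  have gV : g%:R * V <= rho * eps * a / 4.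
    have -> : rho * eps * a / 4 = rho * eps * a / (4 * V) * V by field; rewrite gt_eqF.
    by rewrite ler_pM2r.
  have Var : 8 * V <= rho * eps * a by apply: (le_trans r2); rewrite ler_pM2l.
  have dr : 8 * d <= rho * eps * a by rewrite /d mulrCA mulrC ler_pM2r.
  have glow : rho * eps * a / (8 * V) <= g%:R.
    have e1 : rho * eps * a / (4 * V) = rho * eps * a / (8 * V) + rho * eps * a / (8 * V) by field; rewrite gt_eqF.
    have e2 : 1 <= rho * eps * a / (8 * V) by rewrite ler_pdivlMr ?mulr_gt0//; lra.
    by move: g2; rewrite -[g.+1%:R]natr1; lra.
  have gh : (g <= h)%N.
    apply: le_truncn; rewrite ler_pM2r ?invr_gt0//.
    by rewrite -mulrA ler_piMl// mulr_ge0// ltW.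
  have gjs : (g <= js)%N := leq_trans gh hjs.
  have width : eps * a <= hi - lo by rewrite /hi /lo; lra.
  have rwidth : rho * eps * a <= rho * (hi - lo) by rewrite -mulrA ler_pM2l.
  have cg : rho * eps / (32 * V) * ((js + h) * q)%:R <= (g * q)%:R.
    rewrite !natrM mulrA ler_pM2r ?ltr0n//; apply: le_trans glow.
    have -> : rho * eps * a / (8 * V) = rho * eps / (32 * V) * (4 * a) by field; rewrite gt_eqF.
    have c0 : 0 <= rho * eps / (32 * V) by rewrite divr_ge0 ?(ltW re)// mulr_ge0// ltW.
    have hjsR : h%:R <= js%:R :> R by rewrite ler_nat.
    by apply: (ler_wpM2l c0); rewrite MhR; clear -hjsR jsR; lra.
  (* g consecutive blocks starting or ending at j0, whichever fits below js *)
  have window (p : pred nat) (j0 : nat) : (j0 <= js)%N ->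
     (forall j r, (j <= js)%N -> (r < q)%N -> `|w j - w j0| <= g%:R * V -> p (j * q + r)%N) ->
     (g * q <= count p (index_iota 1 (js * q).+1))%N.
    move=> j0js hp.
    have [s [sjs sg]] : exists s, (s + g <= js)%N /\ forall j, (s <= j <= s + g)%N -> `|w j - w j0| <= g%:R * V.
      have [le|gt] := leqP (j0 + g) js.
        exists j0; split=> // j /andP[j1 j2].
        have := wlip j0 (j - j0)%N; rewrite subnKC// => /le_trans; apply.
        by rewrite ler_pM2r// ler_nat leq_subLR.
      have gj0 : (g <= j0)%N by move: gt gh h4js; clear; lia.
      exists (j0 - g)%N; rewrite subnK//; split=> // j /andP[j1 j2].
      have := wlip j (j0 - j)%N; rewrite subnKC// distrC => /le_trans; apply.
      by rewrite ler_pM2r// ler_nat leq_subLR addnC -leq_subLR.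
    have := @count_interval_ge p (s * q) ((s + g) * q) (js * q).
    rewrite -mulnBl addKn; apply; first by rewrite !leq_mul2r leq_addr sjs !orbT.
    move=> N hN; have [j [r [-> rq jj]]] := block_decomposition q0 hN.
    apply: hp => //; last exact: sg.
    by case/andP: jj => _ jj; exact: leq_trans jj sjs.
  split; apply: (le_trans cg); rewrite ler_nat.
    apply: (window _ ji) => // j r jjs rq; rewrite ler_norml => /andP[? ?].
    by have /andP[? ?] := near_w j r (leq_trans jjs jsJ) rq; rewrite /lo in rwidth *; lra.
  apply: (window _ js) => // j r jjs rq; rewrite ler_norml => /andP[? ?].
  by have /andP[? ?] := near_w j r (leq_trans jjs jsJ) rq; rewrite /hi in rwidth *; lra.
Qed.

(** * Excursions exclude a limit law *)

Lemma excursions_no_weak_limit S A B F (V eps : R) : S 0 = 0 -> 0 < V -> 0 < eps -> eps <= V ->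
  distribution_like F -> (forall M, (0 < M)%N -> 0 < B M) -> weak_limit S A B F ->
  (forall n, excursion S V eps n) -> False.
Proof.
move=> S0 V0 eps0 epsV dl B0 wl exc.
have large (c : R) : exists n0, forall n, (n0 <= n)%N -> c <= n.+1%:R.
  exists (Num.truncn `|c|) => n hn; apply: (le_trans (ler_norm c)).
  by apply: le_trans (ltW (truncnS_gt _)) _; rewrite ler_nat ltnS.
have [n1 hn1] := large (16 / eps); have [n2 hn2] := large (16 * V / eps).
pose n0 := (n1 + n2)%N.
have ex n : exists y : nat * nat * R * R, excursion_times S V eps (n + n0) y.1.1.1 y.1.1.2 y.1.2 y.2.
  have m1 : (n1 <= n + n0)%N by rewrite /n0 addnCA leq_addr.
  have m2 : (n2 <= n + n0)%N by rewrite /n0 addnA leq_addl.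
  have [|| M1 [M2 [lo [hi H]]]] := excursion_times_exist S0 V0 eps0 epsV _ _ (exc (n + n0)%N).
  - by have := hn1 _ m1; rewrite ler_pdivrMr// ler_pdivrMr// mulrC.
  - by have := hn2 _ m2; rewrite ler_pdivrMr// [_ * eps]mulrC.
  by exists (M1, M2, lo, hi).
have [g hg] := choice ex.
pose M1 n := (g n).1.1.1; pose M2 n := (g n).1.1.2; pose lo n := (g n).1.2; pose hi n := (g n).2.
have H n : excursion_times S V eps (n + n0) (M1 n) (M2 n) (lo n) (hi n) := hg n.
have M12 n : (0 < M1 n <= M2 n)%N by case: (H n) => -[].
have M1oo : M1 n @[n --> \oo] --> \oo.
  apply/cvgnyPge => b; have [nb hb] := large (b%:R * V / eps).
  exists nb => // n /= hn; rewrite -(ler_nat R).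
  have [[_ h] _ _ _ _] := H n; apply: le_trans h.
  have := hb (n + n0)%N (leq_trans hn (leq_addr _ _)).
  by rewrite ler_pdivrMr// ler_pdivlMr// [_ * eps]mulrC.
have M2oo : M2 n @[n --> \oo] --> \oo.
  apply/cvgnyPge => b; move/cvgnyPge : M1oo => /(_ b); apply: filterS => n h.
  by apply: (leq_trans h); case/andP: (M12 n).
pose lam : R := 1 / (1 + eps / (16 * V)).
have k0 : 0 < eps / (16 * V) by rewrite divr_gt0// mulr_gt0.
apply: (@types_contradiction R S A B F M1 M2 lo hi lam) => //.
- by rewrite /lam ltr_pdivrMr; lra.
- by move=> n; have [_ h _ _ _] := H n.
- by move=> n; have [_ _ [h _] _ _] := H n.
- by move=> n; have [_ _ [_ h] _ _] := H n.
- by move=> n; have [_ _ _ h _] := H n.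
- move=> rho rho0; pose r := Num.min rho 1.
  have r0 : 0 < r by rewrite lt_min rho0/=.
  have r1 : r <= 1 by rewrite ge_min lexx orbT.
  have rr : r <= rho by rewrite ge_min lexx.
  have re : 0 < r * eps by rewrite mulr_gt0.
  exists (r * eps / (32 * V)); first by rewrite divr_gt0// mulr_gt0.
  have [m1 hm1] := large (8 / (r * eps)); have [m2 hm2] := large (8 * V / (r * eps)).
  exists (m1 + m2)%N => // n /= hn.
  have l1 : (m1 <= n + n0)%N by rewrite (leq_trans (leq_trans (leq_addr m2 m1) hn))// leq_addr.
  have l2 : (m2 <= n + n0)%N by rewrite (leq_trans (leq_trans (leq_addl m1 m2) hn))// leq_addr.
  have [_ _ [lohi _] _ mass] := H n.
  have [||h1 h2] := mass r r0 r1.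
  - by have := hm1 _ l1; rewrite ler_pdivrMr// ler_pdivrMr// [_ * (r * eps)]mulrC.
  - by have := hm2 _ l2; rewrite ler_pdivrMr// [_ * (r * eps)]mulrC.
  have w : r * (hi n - lo n) <= rho * (hi n - lo n) by rewrite ler_wpM2r// subr_ge0 ltW.
  split; [apply: (le_trans h1)|apply: (le_trans h2)]; rewrite ler_nat; apply: sub_count => N /= hN; lra.
Qed.

(** One of the two signs occurs for all [n], because an excursion for [n] is one for every
   smaller index; reflection reduces the downward case to the upward one. *)
Theorem excursions_no_law S (V eps : R) : S 0 = 0 -> 0 < V -> 0 < eps -> eps <= V ->
  (forall n, excursion S V eps n \/ excursion (fun N => - S N) V eps n) ->
  ~ has_temporal_limit_law S.
Proof.
move=> S0 V0 eps0 epsV exc /temporal_law_weak_limit[A [B [F [dl B0 wl]]]].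
have [up|nup] := pselect (forall n, excursion S V eps n).
  exact: excursions_no_weak_limit S0 V0 eps0 epsV dl B0 wl up.
have [n0 hn0] : exists n0, ~ excursion S V eps n0 by apply/existsNP.
have S0' : - S 0 = 0 by rewrite S0 oppr0.
apply: (excursions_no_weak_limit (S := fun N => - S N) S0' V0 eps0 epsV
  (reflect_distribution_like dl) B0 (reflect_weak_limit wl)) => n.
have nn : (n <= n + n0)%N by rewrite leq_addr.
have n0n : (n0 <= n + n0)%N by rewrite leq_addl.
case: (exc (n + n0)%N) => [h|h]; last exact: excursion_le nn h.
by case: hn0; exact: excursion_le n0n h.
Qed.

End Excursions.

(** * Birkhoff sums near a jump *)

Section Dynamics.
Context {R : realType} (nu : nat) (gamma : 'I_nu -> R) (i0 : 'I_nu).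

Definition differences : seq R := [seq gamma j - gamma i0 | j <- enum 'I_nu & j != i0].

(** The points [k * al], k < q, leave gaps of length about [1 / q] on the circle. *)
Lemma singularity_hits p q al (y : R) : (0 < q)%N -> coprime p q ->
  exists (k : nat) (m : int), (k < q)%N /\
   y <= gamma i0 - k%:R * al + m%:~R <= y + 1 / q%:R + 2 * `|q%:R * al - p%:R|.
Proof.
move=> q0 cop; set sg := q%:R * al - p%:R; have qR : 0 < q%:R :> R by rewrite ltr0n.
pose j := Num.ceil ((y + `|sg| - gamma i0) * q%:R).
have /andP[j1 j2] := ceil_itv ((y + `|sg| - gamma i0) * q%:R).
have j1' : j%:~R - 1 < (y + `|sg| - gamma i0) * q%:R by move: j1; rewrite rmorphB/=.
have rlt : (`|(- j %% q)%Z| < q)%N.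
  by have := ltz_pmod (- j) (_ : 0 < q%:Z); have := modz_ge0 (- j) (_ : q%:Z != 0); lia.
have [g _ gK] := injF_bij (shift_mod_inj (m := 0%N) (q0 := q0) cop).
pose k := g (Ordinal rlt).
have kE : ((k * p) %% q)%N = `|(- j %% q)%Z|%N by have := congr1 val (gK (Ordinal rlt)); rewrite /= add0n.
have [m mE] : exists m : int, (k * p)%N%:Z + j = q%:Z * m.
  exists (((k * p) %/ q)%N%:Z - (- j %/ q)%Z).
  have e1 := divn_eq (k * p) q; have e2 := divz_eq (- j) q.
  have e3 : `|(- j %% q)%Z|%N%:Z = (- j %% q)%Z by rewrite gez0_abs// modz_ge0; lia.
  have e4 : (k * p)%N%:Z = ((k * p) %/ q)%N%:Z * q%:Z + (- j %% q)%Z by rewrite {1}e1 kE PoszD PoszM e3.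
  by rewrite e4 mulrBr; lia.
have mR : k%:R * p%:R + j%:~R = q%:R * m%:~R :> R.
  by have := congr1 (fun z : int => z%:~R : R) mE; rewrite PoszM rmorphD !rmorphM.
exists k, m; split=> //.
have E : gamma i0 - k%:R * al + m%:~R = gamma i0 + j%:~R / q%:R - k%:R * sg / q%:R.
  have -> : m%:~R = (k%:R * p%:R + j%:~R) / q%:R :> R by rewrite mR mulrC mulKf ?gt_eqF.
  by rewrite /sg; field; rewrite gt_eqF.
have ks : `|k%:R * sg / q%:R| <= `|sg|.
  rewrite !normrM normr_nat [`|_^-1|]gtr0_norm ?invr_gt0// mulrAC ler_piMl//.
  by rewrite ler_pdivrMr// mul1r ler_nat ltnW.
have jq1 : y + `|sg| - gamma i0 <= j%:~R / q%:R by rewrite ler_pdivlMr.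
have jq2 : j%:~R / q%:R <= y + `|sg| - gamma i0 + 1 / q%:R.
  by rewrite ler_pdivrMr// mulrDl divfK ?gt_eqF//; lra.
by rewrite E; move: ks; rewrite ler_norml => /andP[? ?]; apply/andP; split; lra.
Qed.

(** If z is near gamma i0 - k al and z + k' al is a singularity gamma j, then q times the
   difference of the two singularities is near an integer. Non-resonance gives j = i0, and
   then q divides k' - k. *)
Lemma isolated_singularity p q al k (m : int) (rho r : R) : (0 < q)%N -> coprime p q -> (k < q)%N ->
  nonresonant differences rho q ->
  q%:R * r + q%:R * `|q%:R * al - p%:R| < rho -> q%:R * r + q%:R * `|q%:R * al - p%:R| < 1 ->
  forall j k' (m' : int) z, (k' < q)%N -> `|z - (gamma i0 - k%:R * al + m%:~R)| <= r ->
    z + k'%:R * al = gamma j + m'%:~R -> [/\ j = i0, k' = k & m' = m].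
Proof.
move=> q0 cop kq nonres small1 small2 j k' m' z k'q; set sg := q%:R * al - p%:R in small1 small2 *.
set xi := gamma i0 - _ + _ => zr zE; have qR : 0 < q%:R :> R by rewrite ltr0n.
pose M : int := (k'%:Z - k%:Z) * p%:Z - q%:Z * (m' - m).
have ME : q%:R * (gamma j - gamma i0) - M%:~R = q%:R * (z - xi) + (k'%:R - k%:R) * sg.
  rewrite /M !rmorphB !rmorphM /= !rmorphB/= /xi /sg.
  have -> : gamma j = z + k'%:R * al - m'%:~R by rewrite zE addrK.
  ring.
have kk : `|(k'%:R - k%:R) * sg| <= q%:R * `|sg|.
  rewrite normrM ler_wpM2r// ler_norml.
  have : 0 <= k%:R :> R by []. have : 0 <= k'%:R :> R by [].
  have : k%:R <= q%:R :> R by rewrite ler_nat ltnW. have : k'%:R <= q%:R :> R by rewrite ler_nat ltnW.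
  by move=> *; apply/andP; split; lra.
have bound : `|q%:R * (gamma j - gamma i0) - M%:~R| <= q%:R * r + q%:R * `|sg|.
  rewrite ME (le_trans (ler_normD _ _))// lerD//.
  by rewrite normrM normr_nat ler_wpM2l.
have [ji|ji] := eqVneq j i0; last first.
  have jd : gamma j - gamma i0 \in differences.
    by apply/mapP; exists j => //; rewrite mem_filter ji mem_enum.
  by have := nonres _ jd M; lra.
rewrite ji subrr mulr0 sub0r normrN in bound.
have M0 : M = 0.
  have : `|M%:~R : R| < 1 by apply: le_lt_trans small2.
  by rewrite -intr_norm -[1]/(1%:~R) ltr_int; lia.
have dvd : (q%:Z %| (k'%:Z - k%:Z))%Z.
  rewrite -(@Gauss_dvdzl q%:Z _ p%:Z); last by rewrite /coprimez /= /gcdz /= gcdnC; move: cop; rewrite /coprime => /eqP ->.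
  by apply/dvdzP; exists (m' - m); move: M0; rewrite /M mulrC => /eqP; rewrite subr_eq0 => /eqP ->; rewrite mulrC.
have kE : k' = k.
  move: dvd => /dvdzP[c hc]; move: hc kq k'q; clear; move=> hc kq k'q.
  have : c = 0 by nia.
  by move=> c0; move: hc; rewrite c0 mul0r; lia.
split=> //; move: M0; rewrite /M kE subrr mul0r sub0r => /eqP.
rewrite oppr_eq0 mulf_eq0 subr_eq0 => /orP[|/eqP//].
by move=> /eqP[qz]; move: q0; rewrite qz.
Qed.

Context (f : R -> R) (C F0 : R).
Hypothesis hf : piecewise_lipschitz f gamma C F0.
Hypothesis C0 : 0 <= C.
Hypothesis F00 : 0 <= F0.
Context (l : R).
Hypothesis l0 : l != 0.
Hypothesis jump : f (gamma i0 - delta) - f (gamma i0 + delta) @[delta --> 0^'+] --> l.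


Lemma birkhoff_sum_int al x N (m : int) : birkhoff_sum f al (x + m%:~R) N = birkhoff_sum f al x N.
Proof.
by rewrite /birkhoff_sum; apply: eq_bigr => k _; rewrite addrAC (pl_periodic hf).
Qed.


(** The limit compares [f] at symmetric points; the Lipschitz bound to the left of the jump
   allows unequal distances. *)
Lemma jump_near : exists2 d0, 0 < d0 & forall r d1 d2, r < d0 -> 0 < d1 <= r -> 0 < d2 <= r ->
  avoids gamma (gamma i0 - r) (gamma i0 - Num.min d1 d2) ->
  `|f (gamma i0 - d1) - f (gamma i0 + d2) - l| <= `|l| / 4 + C * r.
Proof.
have l4 : 0 < `|l| / 4 by rewrite divr_gt0// normr_gt0.
have : \forall d \near (0 : R)^'+, `|l - (f (gamma i0 - d) - f (gamma i0 + d))| < `|l| / 4.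
  by move/cvgrPdist_lt : jump; apply.
move=> [d0 /= d00 hd0]; exists d0 => // r d1 d2 rd /andP[d1p d1l] /andP[d2p d2l] av.
have h2 : `|l - (f (gamma i0 - d2) - f (gamma i0 + d2))| < `|l| / 4.
  by apply: hd0 => //=; rewrite sub0r normrN gtr0_norm//; apply: le_lt_trans rd.
have h1 : `|f (gamma i0 - d1) - f (gamma i0 - d2)| <= C * r.
  wlog d12 : d1 d2 d1p d1l d2p d2l av {h2} / d1 <= d2.
    move=> H; have [le|/ltW le] := lerP d1 d2; first exact: H.
    by rewrite distrC; apply: H => //; rewrite minC.
  have le : gamma i0 - d2 <= gamma i0 - d1 by rewrite lerD2l lerN2.
  rewrite min_l// in av.
  have av' : avoids gamma (gamma i0 - d2) (gamma i0 - d1) by apply: avoids_sub av => //; rewrite lerD2l lerN2.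
  apply: (le_trans (pl_lipschitz hf le av')).
  by rewrite ler_wpM2l//; lra.
have -> : f (gamma i0 - d1) - f (gamma i0 + d2) - l =
   (f (gamma i0 - d1) - f (gamma i0 - d2)) - (l - (f (gamma i0 - d2) - f (gamma i0 + d2))) by ring.
by apply: (le_trans (ler_normB _ _)); lra.
Qed.

(** The orbits of u and v are separated by a singularity at time k only, where the jump
   occurs; the other times contribute Lipschitz terms. *)
Lemma window_difference : exists2 d0, 0 < d0 &
  forall p q al k (m : int) (rho r : R), (0 < q)%N -> coprime p q -> (k < q)%N ->
  nonresonant differences rho q -> 0 < r -> r < d0 ->
  q%:R * r + q%:R * `|q%:R * al - p%:R| < rho -> q%:R * r + q%:R * `|q%:R * al - p%:R| < 1 ->
  let xi := gamma i0 - k%:R * al + m%:~R in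
  forall u v, xi - r <= u < xi -> xi < v <= xi + r ->
  `|birkhoff_sum f al u q - birkhoff_sum f al v q - l| <= 2 * C * (q%:R * r) + C * r + `|l| / 4.
Proof.
have [d0 d00 near0] := jump_near; exists d0 => // p q al k m rho r q0 cop kq nonres r0 rd s1 s2 xi u v.
move=> /andP[u1 u2] /andP[v1 v2].
have iso := isolated_singularity q0 cop kq nonres s1 s2 (m := m).
rewrite -/xi in iso.
rewrite /birkhoff_sum -sumrB big_mkord (bigD1 (Ordinal kq))//=.
set main := f (u + _) - f (v + _); set rest := \sum_(i < q | _) _.
have hrest : `|rest| <= 2 * C * (q%:R * r).
  rewrite (le_trans (ler_norm_sum _ _ _))//.
  apply: (@le_trans _ _ (\sum_(i < q) 2 * C * r)).
    rewrite big_mkcond; apply: ler_sum => i _; case: ifP => ik; last by rewrite !mulr_ge0// ltW.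
    rewrite distrC; have uv : u + i%:R * al <= v + i%:R * al by rewrite lerD2r; lra.
    apply: (le_trans (pl_lipschitz hf uv _)).
      move=> j m' hm; have [|_ e _] := iso j i m' (gamma j + m'%:~R - i%:R * al) (ltn_ord i) _ (subrK _ _).
        by rewrite ler_norml; apply/andP; split; lra.
      by move/negP: ik; apply; apply/eqP/val_inj.
    by rewrite [2 * C]mulrC -mulrA ler_wpM2l//; lra.
  by rewrite sumr_const card_ord -[leLHS]mulr_natr le_eqVlt; apply/orP; left; apply/eqP; ring.
have hmain : `|main - l| <= `|l| / 4 + C * r.
  rewrite /main -(pl_periodic hf (u + _) (- m)) -(pl_periodic hf (v + _) (- m)).
  have -> : u + k%:R * al + (- m)%:~R = gamma i0 - (xi - u) by rewrite /xi rmorphN/=; ring.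
  have -> : v + k%:R * al + (- m)%:~R = gamma i0 + (v - xi) by rewrite /xi rmorphN/=; ring.
  apply: near0 => //; try by apply/andP; split; lra.
  have mn : 0 < Num.min (xi - u) (v - xi) by rewrite lt_min; apply/andP; split; lra.
  move=> j m' /andP[h1 h2].
  have hz' : `|gamma j + (m' + m)%:~R - k%:R * al - xi| <= r.
    by rewrite /xi rmorphD/= ler_norml; apply/andP; split; lra.
  have [ji _ mm] := iso j k (m' + m) _ kq hz' (subrK _ _).
  have m'0 : m' = 0 by apply: (addIr m); rewrite add0r.
  by move: h2; rewrite ji m'0 mulr0z; lra.
have -> : main + rest - l = (main - l) + rest by ring.
by apply: (le_trans (ler_normD _ _)); lra.
Qed.

End Dynamics.

(** * Well approximated rotations have excursions *)

Section ExcursionExistence.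
Context {R : realType} (f : R -> R) (nu : nat) (gamma : 'I_nu -> R) (C F0 : R).
Hypothesis hf : piecewise_lipschitz f gamma C F0.
Hypothesis C0 : 0 <= C.
Context (i0 : 'I_nu) (l : R).
Hypothesis l0 : l != 0.
Hypothesis jump : f (gamma i0 - delta) - f (gamma i0 + delta) @[delta --> 0^'+] --> l.
Context (V : R) (V0 : 0 <= V).
Hypothesis dk : denjoy_koksma_bound f V.

(** Dirichlet's theorem just above 1 / |q al - p| gives a fraction closer in the sense of
   |q' al - p'| < |q al - p|, hence different from p / q; the determinant of the two is at least
   1 in absolute value, which bounds q' below. *)
Lemma irrational_next_denominator p q (al : R) : (0 < q)%N -> coprime p q -> 0 <= al ->
  0 < `|q%:R * al - p%:R| ->
  exists p' q' : nat, [/\ (0 < q')%N /\ coprime p' q',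
    q'%:R <= 1 / `|q%:R * al - p%:R| + 1,
    `|q'%:R * al - p'%:R| <= 1 / q'%:R &
    1 - q%:R * `|q%:R * al - p%:R| <= q'%:R * `|q%:R * al - p%:R|].
Proof.
move=> q0 cop al0; set eta := `|_| => eta0; have qR : 0 < q%:R :> R by rewrite ltr0n.
pose N := (Num.truncn (1 / eta)).+1.
have ie0 : 0 <= 1 / eta by rewrite divr_ge0// ltW.
have /andP[N1 N2] : N.-1%:R <= 1 / eta < N%:R by exact: truncn_itv.
have [p' [q' [/andP[q0' q'N] cop' close]]] := dirichlet_approximation al0 (isT : 0 < N)%N.
have q'R : 0 < q'%:R :> R by rewrite ltr0n.
have NR : 0 < N%:R :> R by rewrite ltr0n.
have q'NR : q'%:R <= N%:R :> R by rewrite ler_nat.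
have small : `|q'%:R * al - p'%:R| < eta.
  apply: (lt_trans close); rewrite ltr_pdivrMr// mulrC -ltr_pdivrMr//.
exists p', q'; split=> //.
- by apply: (le_trans q'NR); rewrite /N -natr1 lerD2r.
- by apply: (le_trans (ltW close)); rewrite !mul1r lef_pV2.
have det : (p * q' != p' * q)%N.
  apply/eqP => E.
  have : (q %| q')%N by rewrite -(@Gauss_dvdr q p) 1?coprime_sym// E dvdn_mull.
  move=> /dvdnP[c cE].
  have pE : p' = (c * p)%N.
    by apply/eqP; rewrite -(eqn_pmul2r q0) -E cE mulnA (mulnC p).
  have c1 : 1 <= c%:R :> R by rewrite ler1n; case: c cE {pE} q0' => // ->.
  move: small; rewrite cE pE !natrM -mulrA -mulrBr normrM normr_nat -/eta.
  by apply/negP; rewrite -leNgt ler_peMl// ltW.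
have one : 1 <= `|(p * q')%:R - (p' * q)%:R| :> R.
  have [lt|lt|eq] := ltngtP (p * q')%N (p' * q)%N; last by rewrite eq eqxx in det.
    by rewrite distrC -natrB ?(ltnW lt)// normr_nat ler1n subn_gt0.
  by rewrite -natrB ?(ltnW lt)// normr_nat ler1n subn_gt0.
have : `|(p * q')%:R - (p' * q)%:R| <= q%:R * eta + q'%:R * eta.
  have -> : (p * q')%:R - (p' * q)%:R = q%:R * (q'%:R * al - p'%:R) - q'%:R * (q%:R * al - p%:R).
    by rewrite !natrM; ring.
  apply: (le_trans (ler_normB _ _)); rewrite !normrM !normr_nat lerD//.
  by rewrite ler_wpM2l// ltW.
lra.
Qed.

(** The walk w_j = S_(j q) has increments S_q(x0 + j sg) with sg = q al - p. The times s - h .. s and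
   s + 1 .. s + 1 + h lie on either side of the crossing of a singularity, h being a small
   multiple of a; the increments over the two stretches differ by about h l, so one of the
   four end values of w is of order a. The walk is bounded at time J, since J q is within q
   of twice the next denominator. *)
Theorem well_approximated_excursions (rho : R) : 0 < rho -> exists V' eps : R,
  [/\ 0 < V', 0 < eps, eps <= V' & forall al x0, 0 <= al ->
    (forall p q : nat, (0 < q)%N -> q%:R * al != p%:R) ->
    (forall K, well_approximated f (differences gamma i0) rho K al) ->
    forall n, excursion (birkhoff_sum f al x0) V' eps n \/
              excursion (fun N => - birkhoff_sum f al x0 N) V' eps n].
Proof.
move=> rho0; have [d0 d00 window] := window_difference hf C0 l0 jump.
have ln0 : 0 < `|l| by rewrite normr_gt0.
(* r1 * a blocks on either side of the crossing: few enough for the Lipschitz terms to stay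
   below the jump and for the other singularities to stay outside *)
pose r1 := Num.min (1 / 8) (Num.min (rho / 8) (`|l| / (24 * (C + 1)))).
have C1 : 0 < C + 1 by rewrite ltr_wpDl.
have r10 : 0 < r1 by rewrite !lt_min !divr_gt0// mulr_gt0.
have r18 : r1 <= 1 / 8 by rewrite ge_min lexx.
have r1rho : r1 <= rho / 8 by rewrite !ge_min lexx !orbT.
have r1l : 6 * (C * r1) <= `|l| / 4.
  have h : r1 <= `|l| / (24 * (C + 1)) by rewrite !ge_min lexx !orbT.
  rewrite ler_pdivlMr ?mulr_gt0// in h.
  have : C * r1 <= (C + 1) * r1 by rewrite ler_pM2r// lerDl.
  lra.
clearbody r1.
have r12 : 2 * r1 < 1 by lra.
have r1_rho b : b <= rho / 4 -> 2 * r1 + b < rho by move=> ?; lra.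
have r1_one b : b <= 1 / 16 -> 2 * r1 + b < 1 by move=> ?; lra.
have r1_l b : b <= 2 * (C * r1) -> 2 * C * (2 * r1) + b + `|l| / 4 <= `|l| / 2 by move=> ?; lra.
pose eps := r1 * `|l| / 32; have eps0 : 0 < eps by rewrite divr_gt0// mulr_gt0.
exists (V + eps), eps; split=> //; [by rewrite ltr_wpDl|by rewrite lerDr|].
move=> al x0 al0 irr wa n.
pose c := n.+1%:R + 16 + 4 / rho + 1 / d0 + 2 / r1.
have p1 : 0 < 4 / rho by rewrite divr_gt0.
have p2 : 0 < 1 / d0 by rewrite divr_gt0.
have p3 : 0 < 2 / r1 by rewrite divr_gt0.
have p4 : 1 <= n.+1%:R :> R by rewrite ler1n.
pose K := (Num.truncn c).+1.
have cK : c < K%:R by exact: truncnS_gt.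
have [Kn K16 Krho Kd Kr] : [/\ n.+1%:R <= K%:R :> R, 16 <= K%:R :> R, 4 / rho <= K%:R, 1 / d0 <= K%:R & 2 / r1 <= K%:R].
  by rewrite /c in cK; split; lra.
have [p [q [/andP[Kq q0] cop nonres small sums]]] := wa K.
clearbody K.
have qR : 0 < q%:R :> R by rewrite ltr0n.
have KR : 0 < K%:R :> R by lra.
pose sg := q%:R * al - p%:R; rewrite -/sg in small sums.
have sg0 : sg != 0 by rewrite subr_eq0; exact: irr.
pose eta := `|sg|; rewrite -/eta in small sums.
have eta0 : 0 < eta by rewrite normr_gt0.
have qe0 : 0 < q%:R * eta by rewrite mulr_gt0.
pose a := 1 / (q%:R * eta).
have aE : q%:R * eta = 1 / a by rewrite /a; field; rewrite !gt_eqF.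
have aK : K%:R <= a by rewrite ler_pdivlMr.
have a0 : 0 < a by lra.
have etaE : eta = 1 / a / q%:R by rewrite -aE mulrC mulKf// gt_eqF.
have ia : 1 / a <= 1 / K%:R by rewrite !mul1r lef_pV2.
have iaV : a * (1 / a) = 1 by field; rewrite gt_eqF.
clearbody a.
have ia16 : 1 / a <= 1 / 16 by rewrite !mul1r lef_pV2 ?posrE//; lra.
have iar : 1 / a <= r1 / 2.
  apply: (le_trans ia); rewrite ler_pdivrMr//; move: Kr; rewrite ler_pdivrMr//; lra.
have iarho : 1 / a <= rho / 4.
  apply: (le_trans ia); rewrite ler_pdivrMr//; move: Krho; rewrite ler_pdivrMr//; lra.
have Ssmall x N : (N < q)%N -> `|birkhoff_sum f al x N| <= a / K%:R.
  move=> Nq; have := sums x N Nq; rewrite aE mulrA mulr1 ler_pdivrMr// mul1r.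
  by rewrite ler_pdivlMr// mulrC.
have dkq x : `|birkhoff_sum f al x q| <= V.
  apply: (denjoy_koksma_mul dk _ q0 cop); rewrite -/sg -/eta ler_pdivlMr// mulrC aE; lra.
pose S := birkhoff_sum f al x0; pose w j := S (j * q)%N.
have [p' [q' [[q0' cop'] q'up dk' q'low]]] := irrational_next_denominator q0 cop al0 (eta0 : 0 < `|q%:R * al - p%:R|).
rewrite -/sg -/eta in q'up q'low.
pose J := ((2 * q') %/ q)%N.
have JE : (2 * q' = J * q + (2 * q') %% q)%N := divn_eq _ _.
have Jlt : (2 * q' < J.+1 * q)%N by exact: ltn_ceil.
have q'q : q'%:R * eta = q'%:R / q%:R * (1 / a) by rewrite etaE; ring.
have Jup : J%:R <= 4 * a.
  have : (J * q)%:R <= 2 * q'%:R :> R by rewrite -natrM ler_nat leq_trunc_div.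
  rewrite natrM -ler_pdivlMr// => /le_trans; apply.
  rewrite ler_pdivrMr//.
  have : q'%:R <= a * q%:R + 1.
    by move: q'up; rewrite etaE; have -> : 1 / (1 / a / q%:R) = a * q%:R by field; rewrite !gt_eqF.
  have : 1 <= a * q%:R by rewrite mulr_ege1 ?ler1n//; lra.
  lra.
have Jlow : 2 * a - 3 < J%:R.
  have h1 : 2 * q'%:R < J.+1%:R * q%:R :> R by rewrite -!natrM ltr_nat.
  rewrite -ltr_pdivrMr// -[J.+1%:R]natr1 in h1.
  have h2 : a - 1 <= q'%:R / q%:R.
    move: q'low; rewrite q'q aE => h; have := ler_wpM2l (ltW a0) h.
    by rewrite mulrCA iaV mulr1 mulrBr iaV mulr1.
  by rewrite -mulrA in h1; lra.
have b2 j : `|S (j.+1 * q)%N - S (j * q)%N| <= V + eps.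
  by rewrite mulSn addnC /S birkhoff_sumD addrC addKr (le_trans (dkq _))// lerDl ltW.
have b1 j r : (r < q)%N -> `|S (j * q + r)%N - S (j * q)%N| <= 2 * a / n.+1%:R.
  move=> rq; rewrite /S birkhoff_sumD addrC addKr (le_trans (Ssmall _ _ rq))//.
  apply: ler_pM; rewrite ?invr_ge0 ?(ltW a0)//; first by lra.
  by rewrite lef_pV2 ?posrE.
have b4 : `|S (J * q)%N| <= 2 * (V + eps) + 2 * a / n.+1%:R.
  have h2 : `|S (2 * q')%N| <= 2%:R * V.
    apply: birkhoff_sumM => x; exact: (denjoy_koksma_mul dk _ q0' cop').
  have h3 := b1 J ((2 * q') %% q)%N (ltn_pmod _ q0); rewrite -JE in h3.
  have -> : S (J * q)%N = S (2 * q')%N - (S (2 * q')%N - S (J * q)%N) by rewrite opprB addrC subrK.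
  apply: (le_trans (ler_normB _ _)); apply: lerD; last exact: h3.
  by apply: (le_trans h2); rewrite ler_pM2l// lerDl ltW.
have finish : (exists2 j, (j <= J)%N & eps * (2 * a) <= `|w j|) ->
   excursion S (V + eps) eps n \/ excursion (fun N => - S N) (V + eps) eps n.
  move=> [j jJ]; rewrite ler_normr => /orP[up|down]; [left|right]; exists q, J, (2 * a); split=> //.
  - by split=> //; apply: (le_trans Kn); apply: (le_trans aK); rewrite ler_peMl ?ler1n// ltW.
  - by rewrite mulrA -[2 * 2]natrM.
  - by move=> *; exact: b1.
  - by split=> //; exists j.
  - by split=> //; apply: (le_trans Kn); apply: (le_trans aK); rewrite ler_peMl ?ler1n// ltW.
  - by rewrite mulrA -[2 * 2]natrM.
  - by move=> *; rewrite -opprD normrN; exact: b1.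
  - by move=> *; rewrite -opprD normrN; exact: b2.
  - by split; [rewrite normrN|exists j].
apply: finish.
pose h := Num.truncn (r1 * a).
have ra0 : 0 <= r1 * a by rewrite mulr_ge0// ltW.
have /andP[hup hlow] : h%:R <= r1 * a < h.+1%:R by exact: truncn_itv.
rewrite -[h.+1%:R]natr1 in hlow.
have ra2 : 2 <= r1 * a.
  by rewrite -ler_pdivrMl// mulrC; apply: le_trans aK.
have hlarge : r1 * a / 2 <= h%:R by move: hlow ra2; move: (r1 * a) (h%:R : R) => b b'; lra.
have h0R : 0 <= h%:R :> R by [].
(* the crossing takes place after block h + 1, whatever the sign of sg *)
pose y := x0 + (h%:R + 1) * sg - (if 0 < sg then 0 else 1 / q%:R + 2 * eta).
have [k [m [kq hxi]]] := singularity_hits gamma i0 al y q0 cop.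
rewrite -/sg -/eta in hxi.
set xi := gamma i0 - k%:R * al + m%:~R in hxi.
pose t := (xi - x0) / sg.
have xiE : xi = x0 + t * sg by rewrite /t divfK// addrC subrK.
have aq : (1 / q%:R + 2 * eta) = (a + 2) * eta.
  have -> : 1 / q%:R = a * eta :> R by rewrite etaE mulrA iaV.
  by rewrite [RHS]mulrDl.
(* t is the fractional number of blocks before the crossing *)
have [t1 t2] : h%:R + 1 <= t /\ t <= h%:R + 3 + a.
  move: hxi; rewrite /y -[_ + 1 / _ + _]addrA aq xiE; case: ltrP => sgs.
    rewrite subr0 /eta gtr0_norm// => /andP[l1 l2]; split; rewrite -(ler_pM2r sgs); move: l1 l2; clear; lra.
  have sgn : sg < 0 by rewrite lt_neqAle sg0.
  rewrite /eta ltr0_norm// => /andP[l1 l2]; split; rewrite -(ler_nM2r sgn); move: l1 l2; clear; lra.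
pose s := Num.truncn t.
have t0 : 0 <= t by apply: le_trans t1; rewrite addr_ge0.
have /andP[s1 s2] : s%:R <= t < s.+1%:R by exact: truncn_itv.
rewrite -[s.+1%:R]natr1 in s2.
have hs : (h <= s)%N by rewrite -ltnS -(ltr_nat R) -natr1; move: t1 s2; clear; lra.
have sJ : (s + 1 + h <= J)%N.
  have ra8 : r1 * a <= 1 / 8 * a by rewrite ler_pM2r.
  have a16 : 16 <= a by apply: le_trans aK.
  rewrite -ltnS -(ltr_nat R) -[J.+1%:R]natr1 !natrD.
  move: s1 t2 hup Jlow ra8 a16; clear; lra.
pose r := 2 * r1 / q%:R.
have rq : q%:R * r = 2 * r1 by rewrite /r mulrC divfK// gt_eqF.
have r0 : 0 < r by rewrite divr_gt0// mulr_gt0.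
have rd : r < d0.
  rewrite ltr_pdivrMr//; have : 1 <= d0 * q%:R.
    rewrite mulrC -ler_pdivrMr//; apply: (le_trans Kd); by rewrite ler_nat.
  exact: lt_le_trans r12.
have small1 : q%:R * r + q%:R * eta < rho by rewrite rq aE; exact: r1_rho.
have small2 : q%:R * r + q%:R * eta < 1 by rewrite rq aE; exact: r1_one.
have Dr : (h%:R + 1) * eta <= r.
  rewrite etaE /r mulrA ler_pM2r ?invr_gt0//.
  have : h%:R * (1 / a) <= r1 by rewrite mulrA mulr1 ler_pdivrMr.
  rewrite mulrDl mul1r => /lerD; rewrite [2 * r1]mulr_natl mulr2n; apply.
  by apply: (le_trans iar); rewrite ler_pdivrMr// ler_peMr ?ler1n// ltW.
have wE i : w i.+1 - w i = birkhoff_sum f al (x0 + i%:R * sg) q.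
  rewrite /w mulSn addnC /S birkhoff_sumD addrC addKr.
  rewrite -(birkhoff_sum_int hf al (x0 + i%:R * sg) q (i * p)%N%:Z); congr (birkhoff_sum f al _ q).
  by rewrite -[(i * p)%N%:Z%:~R]/((i * p)%:R) !natrM /sg; ring.
(* the sign of sg decides on which side of the jump the earlier block starts *)
have [L LE pair] : exists2 L, `|L| = `|l| & forall j, (j < h)%N ->
    `|(w (s - h + j).+1 - w (s - h + j)%N) - (w (s + 1 + j).+1 - w (s + 1 + j)%N) - L| <= `|l| / 2.
  have crude : 2 * C * (q%:R * r) + C * r + `|l| / 4 <= `|l| / 2.
    rewrite rq; apply: r1_l; rewrite [leRHS]mulrCA ler_wpM2l// ler_pdivrMr//.
    by rewrite ler_peMr ?mulr_ge0 ?(ltW r10)// ler1n.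
  have pos j : (j < h)%N ->
     [/\ t - (s - h + j)%:R <= h%:R + 1, 0 < t - (s - h + j)%:R,
         (s + 1 + j)%:R - t <= h%:R + 1 & 0 < (s + 1 + j)%:R - t].
    move=> jh; have jR : j%:R + 1 <= h%:R :> R by rewrite natr1 ler_nat.
    have j0R : 0 <= j%:R :> R by [].
    by rewrite !natrD natrB//; split; move: t1 s1 s2 jR j0R; clear; lra.
  have xiD i : x0 + i%:R * sg = xi + (i%:R - t) * sg by rewrite xiE; ring.
  have [sgs|sgs] := ltrP 0 sg.
    have etas : eta = sg by rewrite /eta gtr0_norm.
    exists l => // j jh; have [q1 q2 q3 q4] := pos j jh.
    rewrite !wE; apply: le_trans crude.
    apply: (window p q al k m rho r) => //; rewrite -/xi !xiD; rewrite etas in Dr.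
      have h1 : (t - (s - h + j)%:R) * sg <= r by apply: le_trans Dr; rewrite ler_pM2r.
      have h2 : 0 < (t - (s - h + j)%:R) * sg by rewrite mulr_gt0.
      by apply/andP; split; move: h1 h2; clear; lra.
    have h1 : ((s + 1 + j)%:R - t) * sg <= r by apply: le_trans Dr; rewrite ler_pM2r.
    have h2 : 0 < ((s + 1 + j)%:R - t) * sg by rewrite mulr_gt0.
    by apply/andP; split; move: h1 h2; clear; lra.
  have sgn : 0 < - sg by rewrite oppr_gt0 lt_neqAle sg0.
  have etas : eta = - sg by rewrite /eta ltr0_norm// -oppr_gt0.
  exists (- l); first by rewrite normrN.
  move=> j jh; have [q1 q2 q3 q4] := pos j jh.
  rewrite !wE; apply: le_trans crude.
  set A := birkhoff_sum _ _ _ _; set B := birkhoff_sum _ _ _ _.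
  have -> : A - B - - l = - (B - A - l) by ring.
  rewrite normrN {}/A {}/B.
  apply: (window p q al k m rho r) => //; rewrite -/xi !xiD; rewrite etas in Dr.
    have h1 : ((s + 1 + j)%:R - t) * - sg <= r by apply: le_trans Dr; rewrite ler_pM2r.
    have h2 : 0 < ((s + 1 + j)%:R - t) * - sg by rewrite mulr_gt0.
    by apply/andP; split; move: h1 h2; clear; lra.
  have h1 : (t - (s - h + j)%:R) * - sg <= r by apply: le_trans Dr; rewrite ler_pM2r.
  have h2 : 0 < (t - (s - h + j)%:R) * - sg by rewrite mulr_gt0.
  by apply/andP; split; move: h1 h2; clear; lra.
have tele i : (i <= h)%N ->
    `|(w (s - h + i)%N - w (s - h)%N) - (w (s + 1 + i)%N - w (s + 1)%N) - i%:R * L| <= i%:R * (`|l| / 2).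
  elim: i => [|i IH] ih; first by rewrite !addn0 !subrr mul0r subrr normr0 mul0r.
  have ih' := IH (ltnW ih); have pi := pair i ih.
  have -> : i.+1%:R * (`|l| / 2) = i%:R * (`|l| / 2) + `|l| / 2 by rewrite -natr1 mulrDl mul1r.
  apply: le_trans (lerD ih' pi); apply: le_trans (ler_normD _ _).
  by rewrite !addnS -[i.+1%:R]natr1 le_eqVlt; apply/orP; left; apply/eqP; congr (`|_|); ring.
have := tele h (leqnn h); rewrite subnK// => telh.
(* otherwise the four end values are too small for the telescoped difference *)
apply: contrapT => none.
have bnd j : (j <= J)%N -> `|w j| < eps * (2 * a).
  by move=> jJ; rewrite ltNge; apply/negP => le; apply: none; exists j.
have hL : `|h%:R * L| = h%:R * `|l| by rewrite normrM normr_nat LE.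
have sJ' : (s <= J)%N by apply: leq_trans sJ; rewrite -addnA leq_addr.
have B1 := bnd _ sJ'; have B2 := bnd (s - h)%N (leq_trans (leq_subr _ _) sJ').
have B3 := bnd _ sJ; have B4 := bnd (s + 1)%N (leq_trans (leq_addr _ _) sJ).
have e1 : eps * (2 * a) = r1 * a * `|l| / 16 by rewrite /eps; field.
have hl : r1 * a / 2 * `|l| <= h%:R * `|l| by rewrite ler_pM2r.
have tri : `|h%:R * L| <= h%:R * (`|l| / 2) + (`|w s| + `|w (s - h)%N| + (`|w (s + 1 + h)%N| + `|w (s + 1)%N|)).
  have -> : h%:R * L = - ((w s - w (s - h)%N - (w (s + 1 + h)%N - w (s + 1)%N)) - h%:R * L) +
     (w s - w (s - h)%N - (w (s + 1 + h)%N - w (s + 1)%N)) by ring.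
  apply: (le_trans (ler_normD _ _)); rewrite normrN lerD//.
  apply: (le_trans (ler_normB _ _)); apply: lerD; exact: ler_normB.
rewrite hL in tri; move: tri hl e1 B1 B2 B3 B4 eps0 a0 ln0; clear; lra.
Qed.

End ExcursionExistence.

(** * The limit theorem fails for almost every rotation *)

Lemma ae_no_rational (R : realType) :
  {ae (@lebesgue_measure R), forall al : R, forall p q : nat, (0 < q)%N -> q%:R * al != p%:R}.
Proof.
pose Q : set R := range (fun pq : nat * nat => pq.1%:R / pq.2%:R).
have cQ : countable Q by apply: sub_countable (card_image_le _ _) _; exact: countableP.
have Q0 : (@lebesgue_measure R).-negligible Q.
  apply/negligibleP; last exact: countable_lebesgue_measure0.
  by apply: countable_measurable => // t; exact: measurable_set1.
apply: negligibleS Q0 => al /= /existsNP[p /existsNP[q /not_implyP[q0 /negP]]].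
rewrite negbK => /eqP E; exists (p, q) => //=.
by rewrite -E mulrC mulKf// pnatr_eq0 -lt0n.
Qed.

Theorem theorem1 (R : realType) (f : R -> R) (hf : piecewise_smooth f) :
  {ae lebesgue_measure, forall alpha : R, 0 <= alpha < 1 ->
    forall x0 : R, ~ has_temporal_limit_law (birkhoff_sum f alpha x0)}.
Proof.
have hz : zero_mean f by case: hf.
have [nu [gamma [C [F0 [i0 [l [pl [C0 F00] sep l0 jump]]]]]]] := piecewise_smooth_lipschitz hf.
have av0 := arc_variation_ge0 nu C0 F00.
pose V := 2 * arc_variation nu C F0.
have V0 : 0 <= V by rewrite mulr_ge0.
have dk : denjoy_koksma_bound f V := denjoy_koksma pl C0 F00 hz.
have pert : perturbation_bound f V.
  move=> p q al al' x N q0 cop h1 h2 Nq.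
  apply: (le_trans (rotation_perturbation pl C0 F00 x q0 cop h1 h2 Nq)).
  by rewrite /V ler_peMl// ler1n.
have nint d : d \in differences gamma i0 -> forall m : int, d <> m%:~R.
  by move=> /mapP[j]; rewrite mem_filter => /andP[ji _] ->; exact: sep.
have [rho rho0 wa] := ae_well_approximated V0 dk pert nint.
have [V' [eps [V'0 eps0 epsV exc]]] := well_approximated_excursions pl C0 l0 jump V0 dk rho0.
have wa' : {ae (@lebesgue_measure R), forall al K, 0 < al < 1 -> well_approximated f (differences gamma i0) rho K al}.
  exact: ae_foralln.
have := wa'; apply: filter_app; first exact: (ae_filter_ringOfSetsType lebesgue_measure).
have := @ae_no_rational R; apply: filter_app; first exact: (ae_filter_ringOfSetsType lebesgue_measure).
apply: aeW => al irr waal /andP[al0 al1] x0.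
have alp : 0 < al by rewrite lt_neqAle al0 andbT eq_sym; have := irr 0%N 1%N isT; rewrite mul1r.
apply: (excursions_no_law _ V'0 eps0 epsV); first exact: birkhoff_sum0.
by apply: exc => // K; apply: waal; rewrite alp.
Qed.
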